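(* Let $F$ be a field and let $\Gamma$ be a uniform layered graph. Then the $F$-algebra $R(\Gamma)$ is Koszul if and only if $R(\Gamma_x)$ is Koszul for every vertex $x$ of $\Gamma$.
   Context: A layered graph is identified with a finite ranked poset $\Gamma$: a finite poset with a unique minimal element $\bar 0$ such that for each $x$ all maximal chains in $[\bar 0,x]$ have the same length, called $rk(x)$. Vertices are the elements of $\Gamma$. Put $S_a(1)=\{b<a : rk(a)-rk(b)=1\}$ and $\Gamma_x=[\bar 0,x]$, which is again a ranked poset. $\Gamma$ is uniform if for each $a\ne\bar 0$ the equivalence relation on $S_a(1)$ generated by [$b\sim c$ if $b=c$ or $S_b(1)\cap S_c(1)\neq\emptyset$] has only one equivalence class. The algebra $R(\Gamma)$: let $\Gamma'=\Gamma\setminus\{\bar 0\}$ and let $W$ be the $F$-vector space with basis $\{r_x : x\in\Gamma'\}$. For $x\in\Gamma'$ put $r_x(1)=\sum_{y\in S_x(1)} r_y$ if $rk(x)\ge 2$ and $r_x(1)=0$ if $rk(x)=1$. Then $R(\Gamma)=T(W)/I$, where $I$ is the two-sided ideal generated by all $r_x\otimes r_y$ with $x,y\in\Gamma'$, $y\notin S_x(1)$, and all $r_x\otimes r_x(1)$ with $x\in\Gamma'$. It is graded with each $r_x$ in degree 1. A connected graded $F$-algebra $R$ generated in degree 1 is Koszul if its trivial module $R/R_+=F$ has a linear graded projective resolution. *)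

(* Defs.v *)
From HB Require Import structures.
From mathcomp Require Import all_boot all_order all_algebra.
From mathcomp Require Import finmap multinomials.monalg boolp.

Set Implicit Arguments.
Unset Strict Implicit.
Unset Printing Implicit Defensive.

Import Order.TTheory GRing.Theory.
Local Open Scope ring_scope.

(* Layered graphs.  In a finite poset a unique minimal element is the same as
   a least element, whence the carrier [finBPOrderType].                      *)
Section LayeredGraph.
Context {d : Order.disp_t} {G : finBPOrderType d}.
Implicit Types (x y a b c : G) (C D : {set G}).

Definition is_chain C := [forall y in C, forall z in C, (y >=< z)%O].

Definition max_chain x C :=
  maxset (fun D : {set G} =>
    (D \subset [set y : G | (\bot <= y <= x)%O]) && is_chain D) C.

(* The length of a chain is its number of elements minus one.  When G is
   [ranked] all the terms of the \max in [rk] are equal.                      *)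
Definition rk x : nat := (\max_(C : {set G} | max_chain x C) #|C|.-1)%N.

Definition S1 a : {set G} := [set b : G | (b < a)%O && (rk a == (rk b).+1)].

Definition sib_rel a : rel G :=
  [rel b c | [&& b \in S1 a, c \in S1 a
               & (b == c) || (S1 b :&: S1 c != set0)]].

End LayeredGraph.

Definition ranked (d : Order.disp_t) (G : finBPOrderType d) : Prop :=
  forall (x : G) (C D : {set G}),
    max_chain x C -> max_chain x D -> #|C|.-1 = #|D|.-1.

(* [sib_rel a] is symmetric, so that its reflexive transitive closure
   [connect] is the equivalence relation it generates.                        *)
Definition uniform (d : Order.disp_t) (G : finBPOrderType d) : Prop :=
  forall a : G, a != \bot%O ->
  forall b c : G, b \in S1 a -> c \in S1 a -> connect (sib_rel a) b c.

(* The interval [\bot, x], with the induced order. *)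
Section Below.
Context {d : Order.disp_t} {G : finBPOrderType d} (x : G).

Definition below : predArgType := {y : G | (y <= x)%O}.

HB.instance Definition _ := Finite.on below.
HB.instance Definition _ : isSub G (fun y => (y <= x)%O) below :=
  SubType.on below.
HB.instance Definition _ := [SubChoice_isSubPOrder of below by <: with d].

Definition below_bot : below := exist _ \bot%O (le0x x).

Fact below_botP (y : below) : (below_bot <= y)%O.
Proof. by rewrite -Order.le_val; exact: le0x. Qed.

HB.instance Definition _ := Order.hasBottom.Build d below below_botP.

End Below.

(* The quotient of an algebra by the two-sided ideal generated by a set. *)
Section IdealQuotient.
Context {F : fieldType} {A : lalgType F} (Rel : A -> Prop).

Inductive ideal_gen : A -> Prop :=
| ideal_gen0 : ideal_gen 0
| ideal_genD a r b u :
    Rel r -> ideal_gen u -> ideal_gen (a * r * b + u).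

Fact ideal_genDD u v : ideal_gen u -> ideal_gen v -> ideal_gen (u + v).
Proof.
move=> + Iv; elim=> [|a r b w Rr _ IH]; first by rewrite add0r.
by rewrite -addrA; apply: ideal_genD.
Qed.

Fact ideal_genMl a u : ideal_gen u -> ideal_gen (a * u).
Proof.
elim=> [|a' r b w Rr _ IH]; first by rewrite mulr0; constructor.
by rewrite mulrDr !mulrA; apply: ideal_genD.
Qed.

Fact ideal_genMr a u : ideal_gen u -> ideal_gen (u * a).
Proof.
elim=> [|a' r b w Rr _ IH]; first by rewrite mul0r; constructor.
by rewrite mulrDl -mulrA; apply: ideal_genD.
Qed.

Definition ideal_pred : {pred A} := fun u => `[< ideal_gen u >].

Fact ideal_predP u : reflect (ideal_gen u) (u \in ideal_pred).
Proof. exact: asboolP. Qed.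

Fact ideal_pred_zmod : zmod_closed ideal_pred.
Proof.
split=> [|u v /ideal_predP Iu /ideal_predP Iv]; apply/ideal_predP.
  by constructor.
by apply: ideal_genDD => //; rewrite -mulN1r; apply: ideal_genMl.
Qed.

HB.instance Definition _ := GRing.isZmodClosed.Build A ideal_pred
  ideal_pred_zmod.

Definition quot_alg : Type := Quotient.quot ideal_pred.
HB.instance Definition _ := GRing.Zmodule.on quot_alg.

Definition quot_pi : A -> quot_alg := fun u => \pi_(Quotient.quot ideal_pred)%qT u.

Fact quot_pi_additive : zmod_morphism quot_pi.
Proof. by move=> u v; rewrite /quot_pi; exact: raddfB. Qed.
HB.instance Definition _ :=
  GRing.isZmodMorphism.Build A quot_alg quot_pi quot_pi_additive.

Lemma quot_pi_eq u v : quot_pi u = quot_pi v <-> ideal_gen (u - v).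
Proof.
split=> [/eqP|/ideal_predP]; rewrite /quot_pi -?Quotient.idealrBE.
  by move/ideal_predP.
by rewrite Quotient.idealrBE => /eqP.
Qed.

Definition quot_repr (q : quot_alg) : A := repr (q : Quotient.quot ideal_pred).

Lemma quot_reprK : cancel quot_repr quot_pi.
Proof. by move=> q; exact: reprK. Qed.

Lemma quot_repr_pi u : ideal_gen (quot_repr (quot_pi u) - u).
Proof. by apply/quot_pi_eq; rewrite quot_reprK. Qed.

Definition quot_one : quot_alg := quot_pi 1.
Definition quot_mul (p q : quot_alg) := quot_pi (quot_repr p * quot_repr q).
Definition quot_scale (c : F) (p : quot_alg) := quot_pi (c *: quot_repr p).

Lemma quot_mulE u v : quot_mul (quot_pi u) (quot_pi v) = quot_pi (u * v).
Proof.
apply/quot_pi_eq; set u' := quot_repr _; set v' := quot_repr _.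
have -> : u' * v' - u * v = (u' - u) * v' + u * (v' - v).
  by rewrite mulrBl mulrBr addrA subrK.
by apply: ideal_genDD; [apply: ideal_genMr|apply: ideal_genMl];
  apply: quot_repr_pi.
Qed.

Lemma quot_scaleE c u : quot_scale c (quot_pi u) = quot_pi (c *: u).
Proof.
apply/quot_pi_eq; rewrite -scalerBr -[_ - u]mul1r scalerAl.
by apply: ideal_genMl; apply: quot_repr_pi.
Qed.

Lemma quot_piP (q : quot_alg) : exists u, q = quot_pi u.
Proof. by exists (quot_repr q); rewrite quot_reprK. Qed.

Fact quot_mulA : associative quot_mul.
Proof.
move=> p q r; have [u ->] := quot_piP p; have [v ->] := quot_piP q.
by have [w ->] := quot_piP r; rewrite !quot_mulE mulrA.
Qed.

Fact quot_mul1 : left_id quot_one quot_mul.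
Proof. by move=> p; have [u ->] := quot_piP p; rewrite quot_mulE mul1r. Qed.

Fact quot_mulr1 : right_id quot_one quot_mul.
Proof. by move=> p; have [u ->] := quot_piP p; rewrite quot_mulE mulr1. Qed.

Fact quot_mulDl : left_distributive quot_mul +%R.
Proof.
move=> p q r; have [u ->] := quot_piP p; have [v ->] := quot_piP q.
by have [w ->] := quot_piP r; rewrite -raddfD !quot_mulE -raddfD mulrDl.
Qed.

Fact quot_mulDr : right_distributive quot_mul +%R.
Proof.
move=> p q r; have [u ->] := quot_piP p; have [v ->] := quot_piP q.
by have [w ->] := quot_piP r; rewrite -raddfD !quot_mulE -raddfD mulrDr.
Qed.

HB.instance Definition _ := GRing.Zmodule_isPzRing.Build quot_alg
  quot_mulA quot_mul1 quot_mulr1 quot_mulDl quot_mulDr.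

Fact quot_pi_monoid : monoid_morphism quot_pi.
Proof. by split=> // u v; rewrite -quot_mulE. Qed.
HB.instance Definition _ :=
  GRing.isMonoidMorphism.Build A quot_alg quot_pi quot_pi_monoid.

Fact quot_scaleA c c' p : quot_scale c (quot_scale c' p) = quot_scale (c * c') p.
Proof. by have [u ->] := quot_piP p; rewrite !quot_scaleE scalerA. Qed.

Fact quot_scale1 : left_id 1 quot_scale.
Proof. by move=> p; have [u ->] := quot_piP p; rewrite quot_scaleE scale1r. Qed.

Fact quot_scaleDr : right_distributive quot_scale +%R.
Proof.
move=> c p q; have [u ->] := quot_piP p; have [v ->] := quot_piP q.
by rewrite -raddfD !quot_scaleE -raddfD scalerDr.
Qed.

Fact quot_scaleDl p : {morph quot_scale^~ p : c c' / c + c'}.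
Proof.
by move=> c c'; have [u ->] := quot_piP p; rewrite !quot_scaleE -raddfD scalerDl.
Qed.

HB.instance Definition _ := GRing.Zmodule_isLmodule.Build F quot_alg
  quot_scaleA quot_scale1 quot_scaleDr quot_scaleDl.

Fact quot_pi_scalable : scalable quot_pi.
Proof. by move=> c u; rewrite -quot_scaleE. Qed.
HB.instance Definition _ :=
  GRing.isScalable.Build F A quot_alg *:%R quot_pi quot_pi_scalable.

End IdealQuotient.

Definition is_grading (V : zmodType) (gr : nat -> V -> Prop) : Prop :=
  [/\ forall n, gr n 0,
      forall n u v, gr n u -> gr n v -> gr n (u - v),
      forall v, exists n (c : nat -> V),
        (forall i, gr i (c i)) /\ v = \sum_(i < n) c i
    & forall n (c : nat -> V), (forall i, gr i (c i)) ->
        \sum_(i < n) c i = 0 -> forall i, (i < n)%N -> c i = 0].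

Section GradedModules.
Variables (B : pzRingType) (gr : nat -> B -> Prop).

(* Gradings by nat rather than by int lose nothing here: a module generated in
   degree i >= 0 over a nonnegatively graded ring vanishes in negative degrees. *)
Record grmod := GrMod {
  grmod_sort :> lmodType B;
  mdeg : nat -> grmod_sort -> Prop;
  mdeg_grading : is_grading mdeg;
  mdeg_scale : forall i j a m, gr i a -> mdeg j m -> mdeg (i + j)%N (a *: m)
}.

Definition graded_map (M N : grmod) (f : M -> N) : Prop :=
  forall n m, mdeg n m -> mdeg n (f m).

Definition surjective_map (T U : Type) (f : T -> U) : Prop :=
  forall u, exists t, f t = u.

Definition exact_at (L M N : lmodType B) (f : L -> M) (g : M -> N) : Prop :=
  forall m, g m = 0 <-> exists l, f l = m.

Definition projective (P : lmodType B) : Prop :=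
  forall (M N : lmodType B) (g : {linear M -> N}) (f : {linear P -> N}),
    surjective_map g -> exists h : {linear P -> M}, forall p, g (h p) = f p.

Definition generated_in_degree (n : nat) (M : grmod) : Prop :=
  forall m : M, exists k (a : 'I_k -> B) (g : 'I_k -> M),
    (forall j, mdeg n (g j)) /\ m = \sum_j a j *: g j.

(* ... -> P 2 -> P 1 -> P 0 -> K -> 0 *)
Definition linear_projective_resolution (K : grmod) (P : nat -> grmod)
    (d : forall i, {linear P i.+1 -> P i}) (e : {linear P 0%N -> K}) : Prop :=
  [/\ forall i, projective (P i) /\ generated_in_degree i (P i),
      graded_map e /\ forall i, graded_map (d i),
      surjective_map e,
      exact_at (d 0%N) e
    & forall i, exact_at (d i.+1) (d i)].

Definition irrelevant_ideal (a : B) : Prop :=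
  exists n (c : nat -> B),
    (forall i, gr i.+1 (c i)) /\ a = \sum_(i < n) c i.

(* K is the graded module B / B_+ : the codomain of a degree-preserving linear
   surjection from the regular module B^o whose kernel is B_+.                *)
Definition is_trivial_module (K : grmod) : Prop :=
  exists pi : {linear B^o -> K},
    [/\ surjective_map pi,
        forall a, pi a = 0 <-> irrelevant_ideal a
      & forall n a, gr n a -> mdeg n (pi a)].

End GradedModules.

Section Koszul.
Variables (F : fieldType) (A : algType F) (gr : nat -> A -> Prop).

Definition connected_graded : Prop :=
  [/\ is_grading gr,
      forall n (c : F) a, gr n a -> gr n (c *: a),
      forall i j a b, gr i a -> gr j b -> gr (i + j)%N (a * b)
    & forall a, gr 0%N a <-> exists c : F, a = c%:A].

Definition generated_in_degree_1 : Prop :=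
  forall S : A -> Prop,
    S 1 -> (forall (c : F) a b, S a -> S b -> S (c *: a + b)) ->
    (forall a b, S a -> S b -> S (a * b)) ->
    (forall a, gr 1%N a -> S a) -> forall a, S a.

(* Modules are right modules, i.e. left modules over the converse ring A^c. *)
Definition Koszul : Prop :=
  [/\ connected_graded, generated_in_degree_1
    & exists (K : grmod (gr : nat -> A^c -> Prop))
             (P : nat -> grmod (gr : nat -> A^c -> Prop))
             (d : forall i, {linear P i.+1 -> P i})
             (e : {linear P 0%N -> K}),
        is_trivial_module K /\ linear_projective_resolution d e].

End Koszul.

(* The algebra R(Gamma).  The tensor algebra of the space with basis
   (r_x), x in G', is the free associative algebra on G', that is, the algebra
   of the free monoid {fmonom G'}.                                            *)
Section AlgebraR.
Variables (F : fieldType) (d : Order.disp_t) (G : finBPOrderType d).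

Definition nonbot : predArgType := {x : G | x != \bot%O}.
HB.instance Definition _ := Finite.on nonbot.
HB.instance Definition _ : isSub G (fun x => x != \bot%O) nonbot :=
  SubType.on nonbot.

Local Notation tensor_alg := {malg F[{fmonom nonbot}]}.

Definition rgen (x : nonbot) : tensor_alg := << fmu x >>.

Definition rgen1 (x : nonbot) : tensor_alg :=
  if (2 <= rk (val x))%N then \sum_(y : nonbot | val y \in S1 (val x)) rgen y
  else 0.

Inductive R_rel : tensor_alg -> Prop :=
| R_rel_mul (x y : nonbot) : val y \notin S1 (val x) -> R_rel (rgen x * rgen y)
| R_rel_sum (x : nonbot) : R_rel (rgen x * rgen1 x).

Definition R_alg : Type := quot_alg R_rel.
HB.instance Definition _ := GRing.PzRing.on R_alg.
HB.instance Definition _ := GRing.Lmodule.on R_alg.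

Lemma rgen_coeff1 x : (rgen x)@_mone = 0.
Proof. by rewrite /rgen mcoeffU fm1_eq1. Qed.

Lemma ideal_coeff1 u : ideal_gen R_rel u -> u@_mone = 0.
Proof.
elim=> [|a r b w Rr _ IH]; first by rewrite mcoeff0.
rewrite mcoeffD IH addr0 !rmorphM /=.
suff -> : r@_mone = 0 by rewrite mulr0 mul0r.
by case: Rr => [x y _|x]; rewrite rmorphM /= rgen_coeff1 mul0r.
Qed.

Fact R_alg_nonzero : (1 : R_alg) != 0.
Proof.
apply/eqP; rewrite -[1]/(quot_pi R_rel 1) -(raddf0 (quot_pi R_rel)).
move/quot_pi_eq/ideal_coeff1; rewrite subr0 mcoeff1 eqxx => /eqP.
by rewrite oner_eq0.
Qed.
HB.instance Definition _ := GRing.PzSemiRing_isNonZero.Build R_alg R_alg_nonzero.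

Fact R_alg_scalerAl (c : F) (p q : R_alg) : c *: (p * q) = (c *: p) * q.
Proof.
have [u ->] := quot_piP p; have [v ->] := quot_piP q.
rewrite -[in RHS]linearZ -2!(rmorphM (quot_pi R_rel)).
by rewrite -[in LHS]linearZ scalerAl.
Qed.
HB.instance Definition _ := GRing.Lmodule_isLalgebra.Build F R_alg R_alg_scalerAl.

Fact malg_scalerAr (c : F) (u v : tensor_alg) : c *: (u * v) = u * (c *: v).
Proof.
rewrite -!mul_malgC !mulrA; congr (_ * v).
rewrite !malgM_def fgmulUg fgmulgU; apply: eq_bigr => k _.
by rewrite mul1m mulm1 mulrC.
Qed.

Fact R_alg_scalerAr (c : F) (p q : R_alg) : c *: (p * q) = p * (c *: q).
Proof.
have [u ->] := quot_piP p; have [v ->] := quot_piP q.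
rewrite -[in RHS]linearZ -2!(rmorphM (quot_pi R_rel)).
by rewrite -[in LHS]linearZ malg_scalerAr.
Qed.
HB.instance Definition _ := GRing.Lalgebra_isAlgebra.Build F R_alg R_alg_scalerAr.

Definition R_deg (n : nat) (p : R_alg) : Prop :=
  exists2 u : tensor_alg, {in msupp u, forall m, fdeg m = n}
    & p = quot_pi R_rel u.

End AlgebraR.

Arguments Koszul {F} A gr.
Arguments R_alg F {d} G.
Arguments R_deg F {d} G n p.

(* Main.v *)
From HB Require Import structures.
From mathcomp Require Import all_boot all_order all_algebra.
From mathcomp Require Import finmap multinomials.monalg boolp zify.
Require Import Defs.

Set Implicit Arguments.
Unset Strict Implicit.
Unset Printing Implicit Defensive.

Import Order.TTheory GRing.Theory Num.Theory.
Local Open Scope ring_scope.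

(** Write R for the algebra of the poset, r_x for its generators and s_x for
    r_x(1).  Every relation of R begins with one letter, so the augmentation
    ideal R_+ is the direct sum of the right ideals r_x R, and the right
    annihilator of r_x is the direct sum of s_x R and of the r_z R with z
    outside S_x(1).  Call a module linear when it has a linear resolution.
    The exact sequences 0 -> ann(r_x) -> R -> r_x R -> 0 then show that R is
    Koszul if and only if every s_x R is linear.

    For a vertex x, killing the r_z with z not below x is a retraction of R
    onto R_x, the algebra of the interval.  Its kernel is the sum of these
    r_z R, and it maps s_y R isomorphically to s_y R_x when y <= x.  Hence, once
    the r_z R are linear, R_x is a linear R-module, and then an R_x-module is
    linear over R_x if and only if it is linear over R.

    If R is Koszul, the modules s_y R_x, for y <= x, are linear over R, hence
    over R_x, and R_x is Koszul.  Conversely let all the R_x be Koszul; the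
    first n steps of a resolution of r_x R are shown to be linear by induction
    on n, for all x at once.  Given this for n, the R-module R_x is linear for
    n + 1 steps; so s_x R = s_x R_x, which is linear over R_x, is linear for n
    steps over R, and so are ann(r_x) and, with one more step, r_x R.

    Such truncated statements are handled through regularity: [reg n c M] says
    that the first n terms of some projective resolution of M are generated in
    degrees at most c, c + 1, and so on.  Unlike generation in exactly these
    degrees, this passes along short exact sequences as Tor does
    ([reg_extension], [reg_quotient], [reg_kernel]) and does not depend on the
    resolution.  A module with finite-dimensional parts that vanishes in degrees
    below c and has regularity c for all n is linear, because the kernel of its
    minimal free cover is again such a module, with c + 1 for c ([min_cover],
    [cover_step]); thus an algebra is Koszul if and only if its
    augmentation ideal has regularity 1 ([Koszul_reg]).  Change of rings is
    [reg_ascent] and [reg_descent]; the properties of R and of R -> R_x that the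
    argument uses are collected in [letter_algebra] and [restriction], and the
    two implications are [Koszul_restriction] and [Koszul_extension]. *)

(** * Graded modules and regularity *)
Section GradedModules.
Variables (B : pzRingType) (gr : nat -> B -> Prop).

(** A graded module is given by its homogeneous parts, inside an ambient module
    that is any module containing them: everything below is done degree by
    degree, so that kernels, shifts and restrictions of scalars keep the ambient
    module.  Degrees are integers so that shifts can be undone. *)
Record gmod := GMod {
  gcar :> lmodType B;
  gdeg : int -> gcar -> Prop;
  gdeg0 : forall n, gdeg n 0;
  gdegB : forall n u v, gdeg n u -> gdeg n v -> gdeg n (u - v);
  gdegZ : forall n i a u, gr i a -> gdeg n u -> gdeg (n + i%:Z) (a *: u)
}.

Lemma gdegN (M : gmod) n (u : M) : gdeg n u -> gdeg n (- u).
Proof. by move=> Mu; rewrite -[- u]add0r; apply: gdegB => //; exact: gdeg0. Qed.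

Lemma gdegD (M : gmod) n (u v : M) : gdeg n u -> gdeg n v -> gdeg n (u + v).
Proof. by move=> Mu Mv; rewrite -[v]opprK; apply: gdegB => //; exact: gdegN. Qed.

Lemma gdeg_sum (M : gmod) n (I : Type) (r : seq I) (P : pred I) (u : I -> M) :
  (forall i, P i -> gdeg n (u i)) -> gdeg n (\sum_(i <- r | P i) u i).
Proof.
by move=> Mu; apply: (big_ind (gdeg n)) => //;
  [exact: gdeg0 | move=> *; exact: gdegD].
Qed.

(** The function may depend on the degree: the graded lifts through a
    projective module are components of one ungraded lift. *)
Record gmap (M N : gmod) := GMap {
  gfun :> int -> M -> N;
  gmap_deg : forall n u, gdeg n u -> gdeg n (gfun n u);
  gmapB : forall n u v, gdeg n u -> gdeg n v ->
    gfun n (u - v) = gfun n u - gfun n v;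
  gmapZ : forall n i a u, gr i a -> gdeg n u ->
    gfun (n + i%:Z) (a *: u) = a *: gfun n u
}.

Section GmapTheory.
Variables (M N : gmod) (f : gmap M N).

Lemma gmap0 n : f n 0 = 0.
Proof.
by have := gmapB f (gdeg0 M n) (gdeg0 M n); rewrite subr0 => {1}->; rewrite subrr.
Qed.

Lemma gmapN n u : gdeg n u -> f n (- u) = - f n u.
Proof.
move=> Mu; rewrite -[- u]add0r gmapB ?gmap0 ?add0r //; exact: gdeg0.
Qed.

Lemma gmapD n u v : gdeg n u -> gdeg n v -> f n (u + v) = f n u + f n v.
Proof.
move=> Mu Mv; rewrite -[v in LHS]opprK gmapB ?gmapN ?opprK //; exact: gdegN.
Qed.

Definition ginj := forall n u, gdeg n u -> f n u = 0 -> u = 0.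
Definition gsurj := forall n v, gdeg n v -> exists2 u, gdeg n u & f n u = v.

Fact gker_subproof0 n : gdeg n (0 : M) /\ f n 0 = 0.
Proof. by split; [exact: gdeg0 | exact: gmap0]. Qed.

Fact gker_subproofB n (u v : M) : gdeg n u /\ f n u = 0 ->
  gdeg n v /\ f n v = 0 -> gdeg n (u - v) /\ f n (u - v) = 0.
Proof.
by move=> [Mu fu] [Mv fv]; split; [exact: gdegB | rewrite gmapB ?fu ?fv ?subrr].
Qed.

Fact gker_subproofZ n i a (u : M) : gr i a -> gdeg n u /\ f n u = 0 ->
  gdeg (n + i%:Z) (a *: u) /\ f (n + i%:Z) (a *: u) = 0.
Proof.
by move=> ga [Mu fu]; split; [exact: gdegZ | rewrite gmapZ ?fu ?scaler0].
Qed.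

Definition gker : gmod :=
  @GMod M (fun n u => gdeg n u /\ f n u = 0)
    gker_subproof0 gker_subproofB gker_subproofZ.

End GmapTheory.

Definition glin (M N : gmod) (f : {linear M -> N})
    (fdeg : forall n u, gdeg n u -> gdeg n (f u)) : gmap M N :=
  @GMap M N (fun _ => f) fdeg (fun _ u v _ _ => raddfB f u v)
    (fun _ _ a u _ _ => linearZ_LR f a u).

Definition gcomp (M N K : gmod) (g : gmap N K) (f : gmap M N) :
  gmap M K.
Proof.
refine (@GMap M K (fun n u => g n (f n u)) _ _ _).
- by move=> n u Mu; exact: (gmap_deg g (gmap_deg f Mu)).
- by move=> n u v Mu Mv /=; rewrite !gmapB //; exact: gmap_deg.
- by move=> n i a u ga Mu /=; rewrite !gmapZ //; exact: gmap_deg.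
Defined.

Definition gshift (k : int) (M : gmod) : gmod.
Proof.
refine (@GMod M (fun n u => gdeg (n + k) u) _ _ _).
- by move=> n; exact: gdeg0.
- by move=> n u v; exact: gdegB.
- by move=> n i a u ga Mu /=; rewrite addrAC; exact: gdegZ.
Defined.

Definition gprod (M N : gmod) : gmod.
Proof.
refine (@GMod (gcar M * gcar N)%type (fun n u => gdeg n u.1 /\ gdeg n u.2) _ _ _).
- by move=> n; split; exact: gdeg0.
- by move=> n u v [u1 u2] [v1 v2]; split; exact: gdegB.
- by move=> n i a u ga [u1 u2]; split; exact: gdegZ.
Defined.

Definition gcopair (M N K : gmod) (f : gmap M K) (g : gmap N K) :
  gmap (gprod M N) K.
Proof.
refine (@GMap (gprod M N) K (fun n u => f n u.1 + g n u.2) _ _ _).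
- by move=> n u [u1 u2]; apply: gdegD; exact: gmap_deg.
- move=> n u v [u1 u2] [v1 v2] /=.
  by rewrite !gmapB // opprD !addrA; congr (_ - _); rewrite addrAC.
- by move=> n i a u ga [u1 u2]; rewrite !gmapZ // -scalerDr.
Defined.

Definition gproj (P : gmod) : Prop :=
  forall (M N : gmod) (g : gmap M N) (f : gmap P N), gsurj g ->
  exists h : gmap P M, forall n u, gdeg n u -> g n (h n u) = f n u.

(** Generation in degrees at most c, stated as an induction principle on
    families of subgroups stable under the ring. *)
Definition gen_le (c : int) (M : gmod) : Prop :=
  forall S : int -> M -> Prop,
    (forall n, S n 0) ->
    (forall n u v, S n u -> S n v -> S n (u - v)) ->
    (forall n i a u, gr i a -> S n u -> S (n + i%:Z) (a *: u)) ->
    (forall n u, n <= c -> gdeg n u -> S n u) ->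
  forall n u, gdeg n u -> S n u.

(** Castelnuovo-Mumford regularity at most c, seen by the first n terms of a
    projective resolution. *)
Fixpoint reg (n : nat) (c : int) (M : gmod) : Prop :=
  if n is n'.+1 then
    exists (P : gmod) (f : gmap P M),
      [/\ gproj P, gen_le c P, gsurj f & reg n' (c + 1) (gker f)]
  else True.

Lemma gen_le_mono c c' M : c <= c' -> gen_le c M -> gen_le c' M.
Proof.
move=> le_c genM S S0 SB SZ Sle; apply: genM => // n u le_n.
by apply: Sle; apply: le_trans le_c.
Qed.

Lemma gen_le_surj c M N (f : gmap M N) : gsurj f -> gen_le c M -> gen_le c N.
Proof.
move=> fs genM S S0 SB SZ Sle n v /fs [u Mu <-].
suff: gdeg n u /\ S n (f n u) by case.
apply: (genM (fun n u => gdeg n u /\ S n (f n u))) => // {n u v Mu}.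
- by move=> n; rewrite gmap0; split=> //; exact: gdeg0.
- move=> n u v [Mu Su] [Mv Sv]; rewrite gmapB //.
  by split; [exact: gdegB | exact: SB].
- move=> n i a u ga [Mu Su]; rewrite gmapZ //.
  by split; [exact: gdegZ | exact: SZ].
- by move=> n u le_n Mu; split=> //; apply: Sle => //; exact: gmap_deg.
Qed.

Lemma gen_le_prod c M N : gen_le c M -> gen_le c N -> gen_le c (gprod M N).
Proof.
move=> genM genN S S0 SB SZ Sle n [u v] [/= Mu Nv].
have -> : (u, v) = (u, 0) - (0, - v) :> gprod M N.
  by congr pair; rewrite /= ?subr0 ?opprK ?add0r.
apply: (SB).
  apply: (genM (fun n u => S n ((u, 0) : gprod M N))) => //= {n u v Mu Nv}.
  - move=> n u v Su Sv.
    have -> : (u - v, 0) = (u, 0) - (v, 0) :> gprod M N.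
      by congr pair; rewrite /= ?subr0.
    exact: SB.
  - move=> n i a u ga Su.
    have -> : (a *: u, 0) = a *: (u, 0) :> gprod M N.
      by congr pair; rewrite /= ?scaler0.
    exact: SZ.
  - by move=> n u le_n Mu; apply: Sle => //; split=> //; exact: gdeg0.
apply: (genN (fun n v => S n ((0, v) : gprod M N))) => //= {Mu}.
- move=> {Nv u v}n u v Su Sv.
  have -> : (0, u - v) = (0, u) - (0, v) :> gprod M N.
    by congr pair; rewrite /= ?subr0.
  exact: SB.
- move=> {Nv u v}n i a u ga Su.
  have -> : (0, a *: u) = a *: (0, u) :> gprod M N.
    by congr pair; rewrite /= ?scaler0.
  exact: SZ.
- by move=> {Nv u v}n u le_n Mu; apply: Sle => //; split=> //; exact: gdeg0.
- exact: gdegN.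
Qed.

Definition ginl (M N : gmod) : gmap M (gprod M N).
Proof.
refine (@GMap M (gprod M N) (fun _ u => (u, 0)) _ _ _).
- by move=> n u Mu; split=> //; exact: gdeg0.
- by move=> n u v _ _; congr pair; rewrite /= subr0.
- by move=> n i a u _ _; congr pair; rewrite /= scaler0.
Defined.

Definition ginr (M N : gmod) : gmap N (gprod M N).
Proof.
refine (@GMap N (gprod M N) (fun _ u => (0, u)) _ _ _).
- by move=> n u Mu; split=> //; exact: gdeg0.
- by move=> n u v _ _; congr pair; rewrite /= subr0.
- by move=> n i a u _ _; congr pair; rewrite /= scaler0.
Defined.

Lemma gproj_prod P Q : gproj P -> gproj Q -> gproj (gprod P Q).
Proof.
move=> pP pQ M N g f gs.
have [h1 h1P] := pP M N g (gcomp f (ginl P Q)) gs.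
have [h2 h2P] := pQ M N g (gcomp f (ginr P Q)) gs.
exists (gcopair h1 h2) => n [u v] [/= Pu Qv].
rewrite gmapD ?h1P ?h2P //=; try exact: gmap_deg.
rewrite -gmapD; first by congr (f n _); congr pair; rewrite /= ?addr0 ?add0r.
  by split=> //; exact: gdeg0.
by split=> //; exact: gdeg0.
Qed.

Lemma reg_iso n c (M N : gmod) (f : gmap M N) :
  ginj f -> gsurj f -> reg n c M -> reg n c N.
Proof.
elim: n c M N f => [//|n IH] c M N f fi fs [P [g [pP gP gs rK]]].
exists P, (gcomp f g); split=> //.
  by move=> m v /fs [u /gs [w Pw <-] <-]; exists w.
have sub m u : gdeg m (u : gker g) -> gdeg m (u : gker (gcomp f g)).
  by move=> [Pu gu]; split=> //=; rewrite gu gmap0.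
apply: (IH _ _ _ (@glin (gker g) (gker (gcomp f g)) idfun sub)) => //.
move=> m u [Pu fgu]; exists u => //; split=> //.
by apply: fi fgu; exact: gmap_deg.
Qed.

Lemma reg_iso_lin n c (M N : gmod) (f : {linear M -> N}) :
    (forall m u, gdeg m u -> gdeg m (f u)) ->
    (forall m u, gdeg m u -> f u = 0 -> u = 0) ->
    (forall m v, gdeg m v -> exists2 u, gdeg m u & f u = v) ->
  reg n c M -> reg n c N.
Proof. by move=> fd fi fs; apply: (reg_iso (f := glin fd)). Qed.

(** The inverse exists in every degree by choice; its additivity and linearity
    follow from injectivity. *)
Lemma gmap_inv (M N : gmod) (f : gmap M N) : ginj f -> gsurj f ->
  exists2 g : gmap N M, ginj g & gsurj g.
Proof.
move=> fi fs.
have finj n u v : gdeg n u -> gdeg n v -> f n u = f n v -> u = v.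
  move=> Mu Mv /eqP; rewrite -subr_eq0 => /eqP fuv; apply/eqP.
  rewrite -subr_eq0; apply/eqP/(fi n); first exact: gdegB.
  by rewrite gmapB.
have [g gP] : exists g : int -> N -> M,
    forall n v, gdeg n v -> gdeg n (g n v) /\ f n (g n v) = v.
  have /choice [g gP] : forall p : int * N, exists u : M,
      gdeg p.1 p.2 -> gdeg p.1 u /\ f p.1 u = p.2.
    move=> [n v] /=; case: (pselect (gdeg n v)) => [/fs [u Mu fu]|nv].
      by exists u.
    by exists 0.
  by exists (fun n v => g (n, v)) => n v; exact: (gP (n, v)).
have gmapP : forall n u v, gdeg n u -> gdeg n v -> g n (u - v) = g n u - g n v.
  move=> n u v Nu Nv; have [gu fu] := gP _ _ Nu; have [gv fv] := gP _ _ Nv.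
  have [guv fuv] := gP _ _ (gdegB Nu Nv).
  by apply: (finj n) => //; rewrite ?gmapB ?fu ?fv //; exact: gdegB.
have gZP : forall n i a u, gr i a -> gdeg n u ->
    g (n + i%:Z) (a *: u) = a *: g n u.
  move=> n i a u ga Nu; have [gu fu] := gP _ _ Nu.
  have [gau fau] := gP _ _ (gdegZ ga Nu).
  by apply: (finj (n + i%:Z)) => //; rewrite ?gmapZ ?fu ?fau //; exact: gdegZ.
exists (@GMap N M g (fun n u Nu => proj1 (gP n u Nu)) gmapP gZP).
  by move=> n v /gP [_ {2}<-] /= ->; rewrite gmap0.
move=> n u Mu; exists (f n u) => /=; first exact: gmap_deg.
have [gu fu] := gP _ _ (gmap_deg f Mu).
exact: (finj n).
Qed.

Lemma reg_isoV n c (M N : gmod) (f : gmap M N) :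
  ginj f -> gsurj f -> reg n c N -> reg n c M.
Proof. by move=> fi fs; have [g gi gs] := gmap_inv fi fs; exact: (reg_iso gi gs). Qed.

Lemma reg_mono_c n c c' M : c <= c' -> reg n c M -> reg n c' M.
Proof.
elim: n c c' M => [//|n IH] c c' M le_c [P [f [pP gP fs rK]]].
exists P, f; split=> //; first exact: gen_le_mono gP.
by apply: IH rK; rewrite lerD2r.
Qed.

Lemma reg_pred n c M : reg n.+1 c M -> reg n c M.
Proof.
elim: n c M => [//|n IH] c M [P [f [pP gP fs rK]]].
by exists P, f; split=> //; exact: IH.
Qed.

Lemma reg_le n m c M : (m <= n)%N -> reg n c M -> reg m c M.
Proof.
move=> /subnK <-; elim: (n - m)%N => [//|k IH]; rewrite addSn => /reg_pred.
exact: IH.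
Qed.

Lemma reg_zero n c (M : gmod) : (forall m u, gdeg m (u : M) -> u = 0) -> reg n c M.
Proof.
elim: n c M => [//|n IH] c M M0.
exists M, (@glin M M idfun (fun _ _ => id)); split=> //.
- move=> K N g f gs; unshelve eexists.
    refine (@GMap M K (fun _ _ => 0) _ _ _).
    + by move=> *; exact: gdeg0.
    + by move=> *; rewrite subr0.
    + by move=> *; rewrite scaler0.
  by move=> k u /= Mu; rewrite gmap0 (M0 _ _ Mu) gmap0.
- by move=> S S0 _ _ _ k u /M0 ->.
- by move=> k u Mu; exists u.
by apply: IH => k u [/M0].
Qed.

Lemma reg_gproj n c P : gproj P -> gen_le c P -> reg n c P.
Proof.
case: n => [//|n] pP gP.
exists P, (@glin P P idfun (fun _ _ => id)); split=> //.
  by move=> k u Pu; exists u.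
by apply: reg_zero => k u [].
Qed.

(** The horseshoe lemma: the direct sum of a cover of the kernel and of a lifted
    cover of the quotient covers M, and its kernel is again an extension. *)
Lemma reg_extension n c (M N : gmod) (p : gmap M N) :
  gsurj p -> reg n c (gker p) -> reg n c N -> reg n c M.
Proof.
elim: n c M N p => [//|n IH] c M N p ps [P [f [pP gP fs rP]]].
move=> [Q [g [pQ gQ gs rQ]]].
have [h hP] := pQ M N p g ps.
have subK k u : gdeg k (u : gker p) -> gdeg k (u : M) by case.
pose f' := gcomp (@glin (gker p) M idfun subK) f.
have pf' k u : gdeg k u -> p k (f' k u) = 0.
  by move=> Pu; case: (gmap_deg f Pu).
pose F := gcopair f' h.
have gF k (u : gprod P Q) : gdeg k u -> p k (F k u) = g k u.2.
  by case: u => u v [/= Pu Qv]; rewrite gmapD ?pf' ?hP ?add0r //;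
    exact: (gmap_deg f') || exact: gmap_deg.
exists (gprod P Q), F; split.
- exact: gproj_prod.
- exact: gen_le_prod.
- move=> k m Mm; have [v Qv gv] := gs _ _ (gmap_deg p Mm).
  have Khm : gdeg k (m - h k v : gker p).
    split; first by apply: gdegB => //; exact: gmap_deg.
    by rewrite gmapB ?hP ?gv ?subrr //; exact: gmap_deg.
  have [u Pu fu] := fs _ _ Khm; exists (u, v) => //=.
  by rewrite fu subrK.
have sndP k u : gdeg k (u : gker F) -> gdeg k (u.2 : gker g).
  by case: u => u v [] [/= Pu Qv] Fuv; split=> //; rewrite -(gF k (u, v)) //= Fuv gmap0.
pose q := @glin (gker F) (gker g) snd sndP.
apply: (IH _ _ _ q) => //.
- move=> k v [Qv gv].
  have Khv : gdeg k (- h k v : gker p).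
    split; first by apply: gdegN; exact: gmap_deg.
    by rewrite gmapN ?hP ?gv ?oppr0 //; exact: gmap_deg.
  have [u Pu fu] := fs _ _ Khv; exists (u, v) => //.
  by split=> //=; rewrite fu addNr.
- have inK k u : gdeg k (u : gker f) -> gdeg k (ginl P Q k u : gker q).
    move=> [Pu fu]; split=> //; split; first exact: (gmap_deg (ginl P Q)).
    by rewrite /= fu gmap0 addr0.
  pose i := @GMap (gker f) (gker q) (ginl P Q) inK
    (fun k u v Ku Kv => gmapB (ginl P Q) (proj1 Ku) (proj1 Kv))
    (fun k j a u ga Ku => gmapZ (ginl P Q) ga (proj1 Ku)).
  apply: (@reg_iso _ _ _ _ i) => //.
    by move=> k u _ /= [].
  move=> k [u v] [] [[/= Pu Qv] Fuv] v0; exists u; last by rewrite /= -v0.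
  by split=> //; rewrite -Fuv /= v0 gmap0 addr0.
Qed.

(** A cover P of M also covers N, and the kernel of P -> N is an extension of
    the kernel of M -> N by that of P -> M. *)
Lemma reg_quotient n c (M N : gmod) (p : gmap M N) :
  gsurj p -> reg n.+1 c M -> reg n (c + 1) (gker p) -> reg n.+1 c N.
Proof.
move=> ps [P [f [pP gP fs rP]]] rK; exists P, (gcomp p f); split=> //.
  by move=> k v /ps [u /fs [w Pw <-] <-]; exists w.
have fK k u : gdeg k (u : gker (gcomp p f)) -> gdeg k (f k u : gker p).
  by move=> [Pu pfu]; split=> //; exact: gmap_deg.
pose q := @GMap (gker (gcomp p f)) (gker p) f fK
  (fun k u v Ku Kv => gmapB f (proj1 Ku) (proj1 Kv))
  (fun k j a u ga Ku => gmapZ f ga (proj1 Ku)).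
apply: (@reg_extension _ _ _ _ q) => //.
  move=> k u [Mu pu]; have [w Pw fw] := fs _ _ Mu.
  by exists w => //; split=> //=; rewrite fw.
apply: (@reg_iso_lin _ _ (gker f) (gker q) idfun) rP => //.
  by move=> k u [Pu fu]; split=> //; split=> //=; rewrite fu gmap0.
by move=> k u [] [Pu pfu] fu; exists u.
Qed.

(** Let P be a cover of N.  The fibre product X of M and P over N is an extension
    of M by the kernel of P -> N, and it is also the direct sum of P and of the
    kernel of M -> N, because P -> N lifts to M.  With M projective this is
    Schanuel's lemma. *)
Lemma reg_kernel n c (M N : gmod) (p : gmap M N) :
  gsurj p -> reg n (c + 1) M -> reg n.+1 c N -> reg n (c + 1) (gker p).
Proof.
case: n => [//|n] ps rM [P [f [pP gP fs rK]]].
have {}rK : reg n.+1 (c + 1) (gker f) := rK.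
have [t tP] := pP M N p f ps.
(* X is the fibre product of M and P over N. *)
pose D := gprod M P.
pose subX k (u : D) := gdeg k u /\ p k u.1 = f k u.2.
have X0 k : subX k 0 by split; [exact: gdeg0 | rewrite !gmap0].
have XB k u v : subX k u -> subX k v -> subX k (u - v).
  move=> [[u1 u2] eu] [[v1 v2] ev]; split; first by split; exact: gdegB.
  by rewrite !gmapB // eu ev.
have XZ k i a u : gr i a -> subX k u -> subX (k + i%:Z) (a *: u).
  move=> ga [[u1 u2] eu]; split; first by split; exact: gdegZ.
  by rewrite !gmapZ // eu.
pose X := @GMod D subX X0 XB XZ.
have fstX k u : gdeg k (u : X) -> gdeg k (u.1 : M) by move=> [] [].
pose q := @glin X M fst fstX.
have rX : reg n.+1 (c + 1) X.
  apply: (@reg_extension _ _ _ _ q) => //.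
    move=> k u Mu; have [v Pv fv] := fs _ _ (gmap_deg p Mu).
    by exists (u, v).
  have inK k u : gdeg k (u : gker f) -> gdeg k (ginr M P k u : gker q).
    move=> [Pu fu]; split=> //; split; first exact: (gmap_deg (ginr M P)).
    by rewrite /= fu gmap0.
  pose i := @GMap (gker f) (gker q) (ginr M P) inK
    (fun k u v Ku Kv => gmapB (ginr M P) (proj1 Ku) (proj1 Kv))
    (fun k j a u ga Ku => gmapZ (ginr M P) ga (proj1 Ku)).
  apply: (@reg_iso _ _ _ _ i _ _ rK).
    by move=> k u _ /= [].
  move=> k [u v] [] [[/= Pu Qv] Fuv] v0; exists v; last by rewrite /= -v0.
  by split=> //; rewrite -Fuv v0 gmap0.
(* As t lifts P -> N to M, subtracting it maps X onto the kernel of M -> N,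
   and the kernel of this map is the graph of t, a copy of P. *)
have rdeg k u : gdeg k (u : X) -> gdeg k (u.1 - t k u.2 : gker p).
  move=> [[u1 u2] e]; split; first by apply: gdegB => //; exact: gmap_deg.
  by rewrite gmapB ?tP ?e ?subrr //; exact: gmap_deg.
have rB k u v : gdeg k (u : X) -> gdeg k (v : X) ->
  (u - v).1 - t k (u - v).2 = u.1 - t k u.2 - (v.1 - t k v.2).
  move=> [[u1 u2] _] [[v1 v2] _].
  by rewrite gmapB //= !opprD !opprK !addrA; congr (_ + _); rewrite addrAC.
have rZ k i a u : gr i a -> gdeg k (u : X) ->
  (a *: u).1 - t (k + i%:Z) (a *: u).2 = a *: (u.1 - t k u.2).
  by move=> ga [[u1 u2] _]; rewrite gmapZ // -scalerBr.
pose r := @GMap X (gker p) (fun k u => u.1 - t k u.2) rdeg rB rZ.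
apply: (@reg_quotient _ _ _ _ r) => //.
  move=> k u [Mu pu]; exists (u, 0); last by rewrite /= gmap0 subr0.
  by split; [split=> //; exact: gdeg0 | rewrite /= gmap0].
have tK k u : gdeg k (u : P) -> gdeg k ((t k u, u) : gker r).
  move=> Pu; split; last by rewrite /= subrr.
  by split; [split=> //; exact: gmap_deg | exact: tP].
have tB k u v : gdeg k (u : P) -> gdeg k (v : P) ->
  (t k (u - v), u - v) = (t k u, u) - (t k v, v) :> gker r.
  by move=> Pu Pv; rewrite gmapB.
have tZ k i a u : gr i a -> gdeg k (u : P) ->
  (t (k + i%:Z) (a *: u), a *: u) = a *: (t k u, u) :> gker r.
  by move=> ga Pu; rewrite gmapZ.
apply: (@reg_iso _ _ P _ (@GMap P (gker r) (fun k u => (t k u, u)) tK tB tZ)).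
- by move=> k u _ /= [].
- move=> k [u v] [] [[/= Mu Pv] e] /eqP; rewrite /= subr_eq0 => /eqP uE.
  by exists v; rewrite //= uE.
by apply: reg_gproj => //; apply: gen_le_mono gP; lia.
Qed.

(** The complement of a retract is a retract too, so that both can be treated by
    one induction: the complement is the kernel in [reg_quotient]. *)
Lemma reg_retract n c (L M : gmod) (s : gmap L M) (r : gmap M L) :
    (forall k u, gdeg k u -> r k (s k u) = u) ->
  reg n c M -> reg n c L.
Proof.
elim: n c L M s r => [//|n IH] c L M s r rs rM.
apply: (@reg_quotient _ _ _ _ r) => //.
  by move=> k u Lu; exists (s k u); rewrite ?rs //; exact: gmap_deg.
have subK k u : gdeg k (u : gker r) -> gdeg k (u : M) by case.
have pdeg k u : gdeg k (u : M) -> gdeg k (u - s k (r k u) : gker r).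
  move=> Mu; have ? := gmap_deg r Mu; have ? : gdeg k (s k (r k u)) by exact: gmap_deg.
  by split; [exact: gdegB | rewrite gmapB // rs // subrr].
have pB k u v : gdeg k (u : M) -> gdeg k (v : M) ->
  u - v - s k (r k (u - v)) = (u - s k (r k u)) - (v - s k (r k v)).
  move=> Mu Mv; rewrite !gmapB //; try exact: gmap_deg.
  by rewrite !opprD !opprK !addrA; congr (_ + _); rewrite addrAC.
have pZ k i a u : gr i a -> gdeg k (u : M) ->
  a *: u - s (k + i%:Z) (r (k + i%:Z) (a *: u)) = a *: (u - s k (r k u)).
  by move=> ga Mu; rewrite !gmapZ -?scalerBr //; exact: gmap_deg.
apply: (IH _ _ _ (@glin (gker r) M idfun subK)
  (@GMap M (gker r) (fun k u => u - s k (r k u)) pdeg pB pZ)).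
  by move=> k u [_ /= ->]; rewrite gmap0 subr0.
by apply: (@reg_mono_c _ c); [lia | exact: reg_pred].
Qed.

Lemma reg_shift n c k M : reg n c M -> reg n (c - k) (gshift k M).
Proof.
elim: n c M => [//|n IH] c M [P [f [pP gP fs rK]]].
have fZ m i a u : gr i a -> gdeg m (u : gshift k P) ->
  f (m + i%:Z + k) (a *: u) = a *: f (m + k) u.
  by move=> ga Pu; rewrite addrAC gmapZ.
pose sf := @GMap (gshift k P) (gshift k M) (fun m => f (m + k))
  (fun m u => @gmap_deg _ _ f (m + k) u)
  (fun m u v => @gmapB _ _ f (m + k) u v) fZ.
exists (gshift k P), sf; split.
- move=> K N g h gs.
  have gZ m i a u : gr i a -> gdeg m (u : gshift (- k) K) ->
      g (m + i%:Z - k) (a *: u) = a *: g (m - k) u.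
    by move=> ga Pu; rewrite addrAC gmapZ.
  have hZ m i a u : gr i a -> gdeg m (u : P) ->
      h (m + i%:Z - k) (a *: u) = a *: h (m - k) u.
    by move=> ga Pu; rewrite addrAC gmapZ //= subrK.
  have hdeg m u : gdeg m (u : P) -> gdeg (m - k) (h (m - k) u).
    by move=> Pu; apply: gmap_deg; rewrite /= subrK.
  have hB m u v : gdeg m (u : P) -> gdeg m (v : P) ->
      h (m - k) (u - v) = h (m - k) u - h (m - k) v.
    by move=> Pu Pv; apply: gmapB; rewrite /= subrK.
  pose sg := @GMap (gshift (- k) K) (gshift (- k) N) (fun m => g (m - k))
    (fun m u => @gmap_deg _ _ g (m - k) u)
    (fun m u v => @gmapB _ _ g (m - k) u v) gZ.
  pose sh := @GMap P (gshift (- k) N) (fun m => h (m - k)) hdeg hB hZ.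
  have [|l lP] := pP _ _ sg sh; first by move=> m; exact: gs.
  have ldeg m u : gdeg m (u : gshift k P) -> gdeg m (l (m + k) u : K).
    by move=> /(gmap_deg l) /=; rewrite addrK.
  have lZ m i a u : gr i a -> gdeg m (u : gshift k P) ->
      l (m + i%:Z + k) (a *: u) = a *: l (m + k) u.
    by move=> ga Pu; rewrite addrAC gmapZ.
  exists (@GMap (gshift k P) K (fun m => l (m + k)) ldeg
    (fun m u v => @gmapB _ _ l (m + k) u v) lZ).
  by move=> m u /lP /=; rewrite addrK.
- move=> S S0 SB SZ Sle m u Pu; rewrite -[m](addrK k).
  apply: (gP (fun m => S (m - k))) => //.
  + by move=> j v w; exact: SB.
  + by move=> j i a v ga; rewrite addrAC; exact: SZ.
  + by move=> j v le_j Pv; apply: Sle; rewrite ?lerB //= subrK.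
- by move=> m; exact: fs.
move: (IH _ _ rK); rewrite addrAC.
by apply: (@reg_iso_lin _ _ (gshift k (gker f)) (gker sf) idfun) => // m u; exists u.
Qed.

End GradedModules.

(** * Free modules and minimal covers *)
Definition hdeg (B : pzRingType) (gr : nat -> B -> Prop) (n : int) (a : B) :=
  match n with Posz i => gr i a | Negz _ => a = 0 end.

(** The embedding of the scalars is a plain function: for a right module over an
    algebra A, the ring is the converse of A, and the scalars enter through the
    unit of A. *)
Record connected (F : fieldType) (B : pzRingType) (gr : nat -> B -> Prop)
    (sc : F -> B) : Prop := Connected {
  scD : forall c c', sc (c + c') = sc c + sc c';
  scM : forall c c', sc (c * c') = sc c * sc c';
  sc1 : sc 1 = 1;
  gr_sub0 : forall i, gr i 0;
  gr_subB : forall i a b, gr i a -> gr i b -> gr i (a - b);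
  gr_mul : forall i j a b, gr i a -> gr j b -> gr (i + j)%N (a * b);
  gr_sc : forall c, gr 0%N (sc c);
  gr_scP : forall a, gr 0%N a -> exists c, a = sc c
}.

Section FreeModules.
Variables (F : fieldType) (B : pzRingType) (gr : nat -> B -> Prop).
Variables (sc : F -> B) (gr_conn : connected gr sc).
Local Notation gmod := (gmod gr).

Lemma sc0 : sc 0 = 0.
Proof.
by apply: (addrI (sc 0)); rewrite -(scD gr_conn) !addr0.
Qed.

Lemma scN c : sc (- c) = - sc c.
Proof.
by apply: (addrI (sc c)); rewrite -(scD gr_conn) !subrr sc0.
Qed.

Lemma sc_sum (I : Type) (r : seq I) (P : pred I) (c : I -> F) :
  sc (\sum_(i <- r | P i) c i) = \sum_(i <- r | P i) sc (c i).
Proof. by apply: (big_morph sc (scD gr_conn) sc0). Qed.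

Lemma hdeg0 n : hdeg gr n 0.
Proof. by case: n => //= n; exact: gr_sub0 gr_conn _. Qed.

Lemma hdegB n a b : hdeg gr n a -> hdeg gr n b -> hdeg gr n (a - b).
Proof.
by case: n => [n|n] /=; [exact: gr_subB gr_conn _ _ _ | move=> -> ->; rewrite subrr].
Qed.

Lemma hdegZ n i a b : gr i a -> hdeg gr n b -> hdeg gr (n + i%:Z) (a * b).
Proof.
case: n => [n|n] ga /= gb; last by rewrite gb mulr0; exact: hdeg0.
by rewrite addnC; exact: (gr_mul gr_conn).
Qed.

Definition greg : gmod := @GMod B gr B^o (hdeg gr) hdeg0 hdegB hdegZ.

Lemma gdeg_hdeg (M : gmod) n c a (u : M) :
  hdeg gr (n - c) a -> gdeg c u -> gdeg n (a *: u).
Proof.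
case E: (n - c) => [i|i] /= ga Mu; last by rewrite ga scale0r; exact: gdeg0.
have -> : n = c + i by lia.
exact: gdegZ.
Qed.

Lemma gmap_hdeg (M N : gmod) (f : gmap M N) n c a u :
  hdeg gr (n - c) a -> gdeg c u -> f n (a *: u) = a *: f c u.
Proof.
case E: (n - c) => [i|i] /= ga Mu; last by rewrite ga !scale0r gmap0.
have -> : n = c + i by lia.
exact: gmapZ.
Qed.

Lemma gmap_sum (M N : gmod) (f : gmap M N) n (I : Type) (r : seq I) (u : I -> M) :
  (forall i, gdeg n (u i)) -> f n (\sum_(i <- r) u i) = \sum_(i <- r) f n (u i).
Proof.
move=> Mu; elim: r => [|i r IH]; first by rewrite !big_nil gmap0.
by rewrite !big_cons gmapD ?IH //; exact: gdeg_sum.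
Qed.

(** A module with a finite dual basis of degree c is projective: a lift is
    determined by lifts of the elements of the basis. *)
Lemma dual_basis c (P : gmod) (T : finType) (e : T -> P) (x : T -> P -> B) :
    (forall t, gdeg c (e t)) ->
    (forall t n u, gdeg n u -> hdeg gr (n - c) (x t u)) ->
    (forall t u v, x t (u - v) = x t u - x t v) ->
    (forall t a u, x t (a *: u) = a * x t u) ->
    (forall n u, gdeg n u -> u = \sum_t x t u *: e t) ->
  gproj P /\ gen_le c P.
Proof.
move=> edeg xdeg xB xZ xE; split=> [M N g f gs|S S0 SB SZ Sle n u Pu].
  have /choice [l lP] : forall t, exists u : M, gdeg c u /\ g c u = f c (e t).
    by move=> t; have [u Mu gu] := gs _ _ (gmap_deg f (edeg t)); exists u.
  pose h (n : int) (u : P) := \sum_t x t u *: l t.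
  have tdeg n u t : gdeg n u -> gdeg n (x t u *: l t).
    by move=> /(xdeg t)/gdeg_hdeg; apply; case: (lP t).
  have hdegP n u : gdeg n u -> gdeg n (h n u).
    by move=> Pu; apply: gdeg_sum => t _; exact: tdeg.
  have hB n u v : gdeg n u -> gdeg n v -> h n (u - v) = h n u - h n v.
    by move=> _ _; rewrite /h -sumrB; apply: eq_bigr => t _; rewrite xB scalerBl.
  have hZ n i a u : gr i a -> gdeg n u -> h (n + i%:Z) (a *: u) = a *: h n u.
    move=> _ _; rewrite /h scaler_sumr; apply: eq_bigr => t _.
    by rewrite xZ scalerA.
  exists (GMap hdegP hB hZ) => n u Pu /=; rewrite gmap_sum => [|t]; last exact: tdeg.
  rewrite [in RHS](xE _ _ Pu) gmap_sum => [|t]; last first.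
    exact: gdeg_hdeg (xdeg t _ _ Pu) (edeg t).
  apply: eq_bigr => t _; rewrite !(@gmap_hdeg _ _ _ _ c) ?(proj2 (lP t)) //;
    by [exact: xdeg | case: (lP t)].
have SD m v w : S m v -> S m w -> S m (v + w).
  move=> Sv Sw; rewrite -[w]opprK; apply: (SB) => //.
  by rewrite -[- w]add0r; exact: SB.
rewrite (xE _ _ Pu); apply: (big_ind (S n)) => [//|v w|t _]; first exact: SD.
have := xdeg t _ _ Pu; case E: (n - c) => [i|i] /= ga; last by rewrite ga scale0r.
have -> : n = c + i by lia.
by apply: SZ => //; apply: Sle.
Qed.

Lemma greg_proj : gproj greg /\ gen_le 0 greg.
Proof.
apply: (@dual_basis 0 greg unit (fun=> 1) (fun _ a => a)) => //=.
- by move=> _; rewrite -(sc1 gr_conn); exact: gr_sc gr_conn _.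
- by move=> _ n u; rewrite subr0.
- by move=> n u _; rewrite big_const card_unit /= addr0 /GRing.scale /= mulr1.
Qed.

Definition gfree_deg (c : int) m n (v : 'rV[B]_m) := forall k, hdeg gr (n - c) (v 0 k).

Definition gfree (m : nat) (c : int) : gmod.
Proof.
refine (@GMod B gr 'rV[B]_m (@gfree_deg c m) _ _ _).
- by move=> n k; rewrite mxE; exact: hdeg0.
- by move=> n u v du dv k; rewrite !mxE; exact: hdegB.
- by move=> n i a u ga du k; rewrite mxE addrAC; exact: hdegZ.
Defined.

Lemma row_sum_basis m (v : 'rV[B]_m) : v = \sum_k v 0 k *: delta_mx 0 k.
Proof.
apply/rowP => j; rewrite summxE (bigD1 j) //= big1 => [|k nkj].
  by rewrite !mxE !eqxx mulr1 addr0.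
by rewrite !mxE eq_sym (negPf nkj) mulr0.
Qed.

Lemma gfree_proj m c : gproj (gfree m c) /\ gen_le c (gfree m c).
Proof.
apply: (@dual_basis c (gfree m c) 'I_m (fun k => delta_mx 0 k)
  (fun k v => v 0 k)) => /=.
- move=> k j; rewrite mxE subrr /=.
  case: (j == k); rewrite ?mulr1n ?mulr0n; last exact: gr_sub0 gr_conn _.
  by rewrite -(sc1 gr_conn); exact: gr_sc gr_conn _.
- by move=> k n u; apply.
- by move=> k u v; rewrite !mxE.
- by move=> k a u; rewrite mxE.
- by move=> n u _; exact: row_sum_basis.
Qed.

Section FreeFun.
Variables (V : lmodType B) (m : nat) (g : 'I_m -> V).

Definition free_fun (v : 'rV[B]_m) : V := \sum_k v 0 k *: g k.

Fact free_fun_linear : linear free_fun.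
Proof.
move=> a u v; rewrite /free_fun scaler_sumr -big_split /=.
by apply: eq_bigr => k _; rewrite !mxE scalerDl scalerA.
Qed.
HB.instance Definition _ :=
  GRing.isLinear.Build B 'rV[B]_m V _ free_fun free_fun_linear.

End FreeFun.

Section FreeMap.
Variables (M : gmod) (c : int) (m : nat) (g : 'I_m -> M).
Hypothesis gdegg : forall k, gdeg c (g k).

Fact free_fun_deg n (v : gfree m c) : gdeg n v -> gdeg n (free_fun g v).
Proof.
by move=> dv; apply: gdeg_sum => k _; apply: gdeg_hdeg (dv k) (gdegg k).
Qed.

Definition gfree_map : gmap (gfree m c) M :=
  @glin _ _ (gfree m c) M (free_fun g) free_fun_deg.

End FreeMap.

(** The finite spanning families are taken in the ambient module, so that the
    property passes to submodules at once. *)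
Definition fdim (M : gmod) : Prop := forall n, exists (T : finType) (w : T -> M),
  forall u, gdeg n u -> exists c : T -> F, u = \sum_t sc (c t) *: w t.

Definition indep (V : lmodType B) m (g : 'I_m -> V) :=
  forall c : 'I_m -> F, \sum_k sc (c k) *: g k = 0 -> forall k, c k = 0.

(** Otherwise the matrix of the coordinates has a nonzero row in its kernel. *)
Lemma indep_le (V : lmodType B) (T : finType) (w : T -> V) m (g : 'I_m -> V) :
    (forall k, exists c : T -> F, g k = \sum_t sc (c t) *: w t) ->
  indep g -> (m <= #|T|)%N.
Proof.
move=> /choice [a aE] gI; rewrite leqNgt; apply/negP => ltTm.
pose A : 'M[F]_(m, #|T|) := \matrix_(k, j) a k (enum_val j).
have: ~~ row_free A.
  by rewrite /row_free neq_ltn (leq_ltn_trans (rank_leq_col A)).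
rewrite -kermx_eq0 => /(_ =P _) kA; pose v := nz_row (kermx A).
have vA : v *m A = 0 by apply/sub_kermxP; exact: nz_row_sub.
apply: kA; apply/eqP; rewrite -nz_row_eq0; apply/eqP/rowP => k.
rewrite mxE; apply: (gI (fun k => v 0 k)) => {k}.
under eq_bigr => k _ do rewrite aE scaler_sumr.
rewrite exchange_big /=; apply: big1 => t _.
under eq_bigr => k _ do rewrite scalerA -(scM gr_conn).
rewrite -scaler_suml -sc_sum.
have := congr1 (fun M : 'rV_ _ => M 0 (enum_rank t)) vA; rewrite !mxE.
under eq_bigr => k _ do rewrite mxE enum_rankK.
by move=> ->; rewrite sc0 scale0r.
Qed.

(** An independent family of maximal size spans. *)
Lemma homog_basis (M : gmod) n : fdim M -> exists m (g : 'I_m -> M),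
  [/\ forall k, gdeg n (g k), indep g
    & forall u, gdeg n u -> exists c : 'I_m -> F, u = \sum_k sc (c k) *: g k].
Proof.
move=> /(_ n) [T [w wP]].
pose Q m := `[< exists g : 'I_m -> M, (forall k, gdeg n (g k)) /\ indep g >].
have Q0 : exists m, Q m.
  by exists 0%N; apply/asboolP; exists (fun=> 0); split=> [k|c _ []//]; exact: gdeg0.
have Qle m : Q m -> (m <= #|T|)%N.
  by move=> /asboolP [g [gd gI]]; apply: (indep_le (w := w) (g := g)) => // k; exact: wP.
case: (ex_maxnP Q0 Qle) => m /asboolP [g [gd gI]] mmax.
exists m, g; split=> // u Mu.
pose g' (k : 'I_m.+1) := if unlift ord0 k is Some j then g j else u.
have [c [cE [k ck]]] : exists c : 'I_m.+1 -> F,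
    \sum_k sc (c k) *: g' k = 0 /\ exists k, c k <> 0.
  apply: contrapT => nc; have: (m.+1 <= m)%N; last by rewrite ltnn.
  apply: mmax; apply/asboolP; exists g'; split=> [k|c cE k].
    by rewrite /g'; case: unliftP => [j|].
  by apply: contrapT => ck; apply: nc; exists c; split=> //; exists k.
have g'0 : g' ord0 = u by rewrite /g' unlift_none.
have g'S j : g' (lift ord0 j) = g j by rewrite /g' liftK.
move: cE; rewrite big_ord_recl g'0; under eq_bigr => j _ do rewrite g'S.
move=> cE; have c0 : c ord0 != 0.
  apply/eqP => c0; move: cE; rewrite c0 sc0 scale0r add0r => cE; apply: ck.
  case: (unliftP ord0 k) => [j ->|-> //]; exact: (gI (fun j => c (lift ord0 j))).
exists (fun j => - (c ord0)^-1 * c (lift ord0 j)).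
under eq_bigr => j _ do rewrite (scM gr_conn) -scalerA.
rewrite -scaler_sumr -[\sum_k _](addKr (sc (c ord0) *: u)) cE addr0 scN.
by rewrite scaleNr scalerN opprK scalerA -(scM gr_conn) mulVf // (sc1 gr_conn) scale1r.
Qed.

(** The free cover given by a basis of the lowest part M_c is minimal: its kernel
    vanishes in degree c by independence.  This is what turns the upper bounds
    of a regularity statement into generation in one degree. *)
Lemma min_cover c (M : gmod) :
    fdim M -> (forall n u, n < c -> gdeg n (u : M) -> u = 0) -> gen_le c M ->
  exists m (g : 'I_m -> M) (gd : forall k, gdeg c (g k)),
    gsurj (gfree_map gd) /\
    (forall n u, n < c + 1 -> gdeg n (u : gker (gfree_map gd)) -> u = 0).
Proof.
move=> fM Mlow genM; have [m [g [gd gI gS]]] := homog_basis c fM.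
exists m, g, gd; split.
  pose S n (u : M) := exists2 v : gfree m c, gdeg n v & free_fun g v = u.
  have SP : forall n u, gdeg n u -> S n u; last by move=> n u /SP.
  apply: genM.
  - by move=> n; exists 0; rewrite ?raddf0 //; exact: gdeg0.
  - move=> n u v [u' du <-] [v' dv <-].
    by exists (u' - v'); rewrite ?raddfB //; exact: gdegB.
  - move=> n i a u ga [u' du <-].
    by exists (a *: u'); rewrite ?linearZ //; exact: gdegZ.
  move=> n u; rewrite le_eqVlt => /orP[/eqP -> Mu|lt_n Mu]; last first.
    rewrite (Mlow _ _ lt_n Mu).
    by exists 0; rewrite ?raddf0 //; exact: gdeg0.
  have [b ->] := gS _ Mu; exists (\row_k sc (b k)).
    by move=> k; rewrite mxE subrr; exact: gr_sc gr_conn _.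
  by apply: eq_bigr => k _; rewrite mxE.
move=> n u lt_n [du fu]; apply/rowP => k; rewrite mxE.
have := du k; case E: (n - c) => [i|i] //= _.
have {}E : n - c = 0 by lia.
have /choice [b bE] : forall k, exists b, u 0 k = sc b.
  by move=> j; have := du j; rewrite E => /(gr_scP gr_conn).
rewrite bE (gI b) ?sc0 //.
by rewrite -[RHS]fu; apply: eq_bigr => j _; rewrite bE.
Qed.

Lemma fdim_gker M N (f : gmap M N) : fdim M -> fdim (gker f).
Proof. by move=> fM n; have [T [w wP]] := fM n; exists T, w => u [/wP]. Qed.

Lemma fdim_free m c : fdim greg -> fdim (gfree m c).
Proof.
move=> fB n; have [T [w wP]] := fB (n - c).
exists ('I_m * T)%type, (fun kt => w kt.2 *: delta_mx 0 kt.1) => v dv.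
have /choice [b bE] : forall k, exists b : T -> F,
    v 0 k = \sum_t sc (b t) * w t.
  by move=> k; have [b bE] := wP _ (dv k); exists b.
exists (fun kt => b kt.1 kt.2).
rewrite [LHS]row_sum_basis.
rewrite -(pair_bigA _ (fun k t => sc (b k t) *: (w t *: delta_mx 0 k))) /=.
apply: eq_bigr => k _; rewrite bE scaler_suml; apply: eq_bigr => t _.
by rewrite scalerA.
Qed.

End FreeModules.

(** * Change of rings *)
Section ChangeOfRings.
Variables (F : fieldType) (B S : pzRingType).
Variables (grB : nat -> B -> Prop) (grS : nat -> S -> Prop).
Variables (sc : F -> S) (S_conn : connected grS sc).
Variables (phi : {rmorphism B -> S}).
Hypothesis phi_deg : forall i a, grB i a -> grS i (phi a).
Hypothesis S_fdim : fdim sc (greg S_conn).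

Definition restr (f : {rmorphism B -> S}) (M : lmodType S) : Type := M.
HB.instance Definition _ M := GRing.Zmodule.on (restr phi M).

Definition restr_scale M (a : B) (u : restr phi M) : restr phi M := phi a *: (u : M).

Fact restr_scaleA M a b (u : restr phi M) :
  restr_scale a (restr_scale b u) = restr_scale (a * b) u.
Proof. by rewrite /restr_scale scalerA rmorphM. Qed.
Fact restr_scale1 M : left_id 1 (@restr_scale M).
Proof. by move=> u; rewrite /restr_scale rmorph1 scale1r. Qed.
Fact restr_scaleDr M : right_distributive (@restr_scale M) +%R.
Proof. by move=> a u v; rewrite /restr_scale scalerDr. Qed.
Fact restr_scaleDl M (u : restr phi M) : {morph (@restr_scale M)^~ u : a b / a + b}.
Proof. by move=> a b; rewrite /restr_scale rmorphD scalerDl. Qed.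
HB.instance Definition _ M := GRing.Zmodule_isLmodule.Build B (restr phi M)
  (@restr_scaleA M) (@restr_scale1 M) (@restr_scaleDr M) (@restr_scaleDl M).

Definition gres (M : gmod grS) : gmod grB :=
  @GMod B grB (restr phi M) (fun n u => gdeg n (u : M)) (@gdeg0 _ _ M)
    (@gdegB _ _ M) (fun n i a u ga => gdegZ (phi_deg ga)).

Definition gres_map (M N : gmod grS) (f : gmap M N) : gmap (gres M) (gres N) :=
  @GMap B grB (gres M) (gres N) f (gmap_deg f) (gmapB f)
    (fun n i a u ga => gmapZ f (phi_deg ga)).

Lemma reg_res_ker n c (M N : gmod grS) (f : gmap M N) :
  reg n c (gres (gker f)) <-> reg n c (gker (gres_map f)).
Proof.
by split; [apply: (@reg_iso_lin _ _ _ _ (gres (gker f)) (gker (gres_map f)) idfun)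
  | apply: (@reg_iso_lin _ _ _ _ (gker (gres_map f)) (gres (gker f)) idfun)];
  move=> // k u; exists u.
Qed.

Lemma reg_res_free n m c :
  reg n 0 (gres (greg S_conn)) -> reg n c (gres (gfree S_conn m c)).
Proof.
move=> rS; elim: m => [|m IH]; first by apply: reg_zero => k u _; apply/rowP => [[]].
have pB k (u v : gres (gfree S_conn m.+1 c)) : gdeg k u -> gdeg k v ->
    (u - v) 0 ord0 = u 0 ord0 - v 0 ord0 :> gshift (- c) (gres (greg S_conn)).
  by move=> _ _; rewrite !mxE.
have pZ k i a (u : gres (gfree S_conn m.+1 c)) : grB i a -> gdeg k u ->
    (a *: u) 0 ord0 = a *: (u 0 ord0 : gshift (- c) (gres (greg S_conn))).
  by move=> _ _; rewrite mxE.
pose p := @GMap B grB (gres (gfree S_conn m.+1 c)) (gshift (- c) (gres (greg S_conn)))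
  (fun _ v => v 0 ord0) (fun k u du => du ord0) pB pZ.
apply: (@reg_extension _ _ _ _ _ _ p); last 1 first.
- by have := reg_shift (- c) rS; rewrite sub0r opprK.
- move=> k a da; exists (\row_j if j == ord0 then a else 0); last by rewrite /= mxE eqxx.
  by move=> j; rewrite mxE; case: eqP => _; [exact: da | exact: (hdeg0 S_conn)].
pose i (v : 'rV[S]_m) : 'rV[S]_m.+1 :=
  \row_j if unlift ord0 j is Some j' then v 0 j' else 0.
have idg k (u : gres (gfree S_conn m c)) : gdeg k u -> gdeg k (i u : gker p).
  move=> du; split; last by rewrite /= mxE unlift_none.
  by move=> j; rewrite mxE; case: unliftP => [j' _|_];
    [exact: du | exact: (hdeg0 S_conn)].
have iB k (u v : gres (gfree S_conn m c)) : gdeg k u -> gdeg k v ->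
    i (u - v) = (i u : gker p) - i v.
  move=> _ _; apply/rowP => j; rewrite !mxE.
  by case: unliftP => [j' _|_]; rewrite ?mxE ?subrr.
have iZ k l a (u : gres (gfree S_conn m c)) : grB l a -> gdeg k u ->
    i (a *: u) = a *: (i u : gker p).
  move=> _ _; apply/rowP => j; rewrite !mxE.
  by case: unliftP => [j' _|_]; rewrite ?mxE ?mulr0.
apply: (reg_iso (f := @GMap B grB (gres (gfree S_conn m c)) (gker p)
  (fun _ => i) idg iB iZ)) IH.
- move=> k u _ /= /rowP iu; apply/rowP => j.
  by have := iu (lift ord0 j); rewrite !mxE liftK.
- move=> k v [dv v0]; exists (\row_j v 0 (lift ord0 j)).
    by move=> j; rewrite mxE; exact: dv.
  apply/rowP => j; rewrite !mxE.
  by case: unliftP => [j' ->|->]; rewrite ?mxE //; symmetry.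
Qed.

(** Over S the minimal cover P of M is free, so P is as regular over B as S is,
    and the kernel of P -> M is again regular over B by [reg_kernel].  The kernel
    starts one degree higher, and the induction applies to it. *)
Lemma reg_ascent n c (M : gmod grS) :
    (forall k, reg k 0 (gres (greg S_conn))) ->
    fdim sc M -> (forall (k : int) u, k < c -> gdeg k (u : M) -> u = 0) ->
  (forall k, reg k c (gres M)) -> reg n c M.
Proof.
move=> rS; elim: n c M => [//|n IH] c M fM Mlow rM.
have genM : gen_le c M.
  have [P [f [_ /(gen_le_surj (f := f)) gP /gP genM _]]] := rM 1%N.
  move=> S' S0 SB SZ Sle; apply: genM => // k i a u ga.
  by apply: SZ; exact: phi_deg.
have [m [g [gd [gS gK]]]] := min_cover S_conn fM Mlow genM.
have [pP gP] := gfree_proj S_conn m c.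
exists (gfree S_conn m c), (gfree_map S_conn gd); split=> //.
apply: IH => //; first by apply: fdim_gker; exact: fdim_free.
move=> k; apply/reg_res_ker; apply: reg_kernel => //.
by apply: (@reg_mono_c _ _ _ c); [lia | exact: reg_res_free].
Qed.

(** The same minimal cover as for [reg_ascent], but its kernel is now handled by
    induction first, and [reg_quotient] then gives M. *)
Lemma reg_descent N n c (M : gmod grS) :
    reg N 0 (gres (greg S_conn)) -> (n <= N)%N ->
    fdim sc M -> (forall (k : int) u, k < c -> gdeg k (u : M) -> u = 0) ->
  reg n c M -> reg n c (gres M).
Proof.
move=> rS; elim: n c M => [//|n IH] c M le_n fM Mlow rM.
have genM : gen_le c M.
  by have [P [f [_ gP fs _]]] := rM; exact: (gen_le_surj fs gP).
have [m [g [gd [gS gK]]]] := min_cover S_conn fM Mlow genM.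
have [pP gP] := gfree_proj S_conn m c.
apply: (@reg_quotient _ _ _ _ _ _ (gres_map (gfree_map S_conn gd))) => //.
  by apply: reg_res_free; exact: reg_le rS.
apply/reg_res_ker; apply: IH => //; first exact: ltnW.
  by apply: fdim_gker; exact: fdim_free.
apply: reg_kernel => //; apply: reg_gproj => //.
by apply: gen_le_mono gP; lia.
Qed.

End ChangeOfRings.

(** * Homogeneous components *)
Section Components.
Variables (V : zmodType) (gr : nat -> V -> Prop) (grP : is_grading gr).

Lemma grading_sum n (I : Type) (r : seq I) (P : pred I) (u : I -> V) :
  (forall i, P i -> gr n (u i)) -> gr n (\sum_(i <- r | P i) u i).
Proof.
have [g0 gB _ _] := grP; move=> gu; apply: (big_ind (gr n)) => // x y gx gy.
by rewrite -[y]opprK; apply: (gB) => //; rewrite -[- y]add0r; exact: gB.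
Qed.

Lemma grading_uniq N (c c' : nat -> V) :
    (forall i, gr i (c i)) -> (forall i, gr i (c' i)) ->
    \sum_(i < N) c i = \sum_(i < N) c' i -> forall i, (i < N)%N -> c i = c' i.
Proof.
have [_ gB _ gI] := grP; move=> gc gc' /eqP; rewrite -subr_eq0 -sumrB => /eqP E i ltiN.
apply/eqP; rewrite -subr_eq0; apply/eqP.
by apply: (gI N (fun i => c i - c' i)) => // j; exact: gB.
Qed.

Lemma sum_ord_widen N M (c : nat -> V) : (N <= M)%N ->
  (forall i, (N <= i)%N -> c i = 0) -> \sum_(i < M) c i = \sum_(i < N) c i.
Proof.
move=> leNM c0; rewrite -(subnKC leNM) big_split_ord /= [X in _ + X]big1 ?addr0 //.
by move=> i _; rewrite c0 // leq_addr.
Qed.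

Fact component_ex : exists comp : nat -> V -> V, forall v,
  (forall n, gr n (comp n v)) /\
  exists2 N, v = \sum_(i < N) comp i v & forall i, (N <= i)%N -> comp i v = 0.
Proof.
have [g0 _ gE _] := grP.
have /choice [c cP] : forall v, exists c : nat -> V,
    (forall n, gr n (c n)) /\
    exists2 N, v = \sum_(i < N) c i & forall i, (N <= i)%N -> c i = 0.
  move=> v; have [N [c [gc ->]]] := gE v.
  exists (fun i => if (i < N)%N then c i else 0); split=> [n|].
    by case: ifP.
  exists N; first by apply: eq_bigr => i _; rewrite ltn_ord.
  by move=> i; rewrite leqNgt => /negPf ->.
by exists (fun n v => c v n).
Qed.

Definition component := sval (cid component_ex).

Lemma component_deg n v : gr n (component n v).
Proof. by case: (svalP (cid component_ex) v). Qed.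

Lemma component_sum v : exists2 N, v = \sum_(i < N) component i v &
  forall i, (N <= i)%N -> component i v = 0.
Proof. by case: (svalP (cid component_ex) v). Qed.

Lemma component_uniq v N (c : nat -> V) : (forall i, gr i (c i)) ->
    v = \sum_(i < N) c i -> (forall i, (N <= i)%N -> c i = 0) ->
  forall i, component i v = c i.
Proof.
move=> gc vE c0 i; have [N' vE' c0'] := component_sum v.
apply: (@grading_uniq (maxn (maxn N N') i.+1) (component^~ v) c).
- by move=> j; exact: component_deg.
- by [].
- rewrite (@sum_ord_widen N' _ (component^~ v)) -?vE' //; last lia.
  by rewrite (@sum_ord_widen N) -?vE //; lia.
by lia.
Qed.

Lemma component_homog n v : gr n v ->
  forall m, component m v = if m == n then v else 0.
Proof.
have [g0 _ _ _] := grP; move=> gv.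
apply: (@component_uniq _ n.+1 (fun m => if m == n then v else 0)).
- by move=> i; case: eqP => // ->.
- by rewrite big_ord_recr /= eqxx big1 ?add0r // => i _; rewrite ltn_eqF.
- by move=> i lt_n; rewrite gtn_eqF.
Qed.

Lemma componentB n u v : component n (u - v) = component n u - component n v.
Proof.
have [_ gB _ _] := grP.
have [N uE u0] := component_sum u; have [N' vE v0] := component_sum v.
apply: (@component_uniq _ (maxn N N') (fun n => component n u - component n v)).
- by move=> i; apply: (gB); exact: component_deg.
- rewrite sumrB (@sum_ord_widen N _ (component^~ u)) ?leq_maxl // -uE.
  by rewrite (@sum_ord_widen N' _ (component^~ v)) ?leq_maxr // -vE.
- by move=> i le_i; rewrite u0 ?v0 ?subrr //; lia.
Qed.

Lemma component0 n : component n 0 = 0.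
Proof. by have := componentB n 0 0; rewrite !subrr. Qed.

Lemma componentD n u v : component n (u + v) = component n u + component n v.
Proof.
by rewrite -[v in LHS]opprK componentB -[- v]add0r componentB component0 add0r opprK.
Qed.

Lemma component_bigsum n (I : Type) (r : seq I) (u : I -> V) :
  component n (\sum_(i <- r) u i) = \sum_(i <- r) component n (u i).
Proof. by apply: (big_morph (component n) (componentD n) (component0 n)). Qed.

End Components.

Lemma sum_shift (V : zmodType) (c : nat -> V) i N :
  \sum_(k < i + N) (if (i <= k)%N then c (k - i)%N else 0) = \sum_(j < N) c j.
Proof.
rewrite big_split_ord /= big1 ?add0r => [|k _]; last by rewrite leqNgt ltn_ord.
by apply: eq_bigr => k _; rewrite leq_addr addKn.
Qed.

Lemma shift_grading (V : zmodType) (gr : nat -> V -> Prop) i : is_grading gr ->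
  is_grading (fun n v => if (i <= n)%N then gr (n - i)%N v else v = 0).
Proof.
move=> [g0 gB gE gI]; split.
- by move=> n; case: ifP.
- by move=> n u v; case: ifP => _; [exact: gB | move=> -> ->; rewrite subrr].
- move=> v; have [N [c [gc ->]]] := gE v; exists (i + N)%N.
  exists (fun k => if (i <= k)%N then c (k - i)%N else 0).
  split; last by rewrite sum_shift.
  by move=> k; case: (i <= k)%N.
- move=> N c gc cE k ltkN; have := gc k; case: ifP => // leik _.
  have gc' j : gr j (c (i + j)%N) by have := gc (i + j)%N; rewrite leq_addr addKn.
  rewrite -(subnKC leik); apply: (gI (N - i)%N (fun j => c (i + j)%N)) => //; last lia.
  rewrite -[RHS]cE -[in RHS](@subnKC i N) ?big_split_ord /=; last lia.
  rewrite [X in _ = X + _]big1 ?add0r // => j _.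
  by have := gc j; rewrite leqNgt ltn_ord.
Qed.

Lemma row_grading (V : zmodType) (gr : nat -> V -> Prop) m : is_grading gr ->
  is_grading (fun n (v : 'rV[V]_m) => forall k, gr n (v 0 k)).
Proof.
move=> grP; have [g0 gB gE gI] := grP; split.
- by move=> n k; rewrite mxE.
- by move=> n u v gu gv k; rewrite !mxE; exact: gB.
- move=> v; have /choice [N NP] : forall k, exists N,
      v 0 k = \sum_(i < N) component grP i (v 0 k) /\
      forall i, (N <= i)%N -> component grP i (v 0 k) = 0.
    by move=> k; have [N E0 E1] := component_sum grP (v 0 k); exists N.
  exists (\max_k N k)%N, (fun n => \row_k component grP n (v 0 k)); split.
    by move=> n k; rewrite mxE; exact: component_deg.
  apply/rowP => k; rewrite summxE; have [E0 E1] := NP k.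
  rewrite [RHS](eq_bigr (fun n : 'I__ => component grP n (v 0 k))) => [|n _]; last first.
    by rewrite mxE.
  by rewrite (@sum_ord_widen _ (N k) _ (fun n => component grP n (v 0 k))) ?leq_bigmax.
- move=> N c gc cE i ltiN; apply/rowP => k; rewrite mxE.
  apply: (gI N (fun i => c i 0 k)) => [j||//]; first exact: gc.
  by have := congr1 (fun M : 'rV_ _ => M 0 k) cE; rewrite summxE mxE.
Qed.

(** * From a linear resolution to regularity *)
Section Evaluation.
Variables (R : nzRingType) (K : choiceType) (M : lmodType R) (T : R -> R) (l : K -> M).
Hypothesis TB : forall a b, T (a - b) = T a - T b.
Implicit Types u v : {malg R[K]}.

(** The coefficients are transformed by an additive map T: the linear evaluation
    is the case of the identity, and taking a component of every coefficient
    gives the graded parts of the evaluation. *)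
Definition malg_eval u : M := \sum_(k <- msupp u) T u@_k *: l k.

Let T0 : T 0 = 0. Proof. by have := TB 0 0; rewrite !subrr. Qed.

Lemma malg_evalE (d : {fset K}) u : (msupp u `<=` d)%fset ->
  malg_eval u = \sum_(k <- d) T u@_k *: l k.
Proof.
move=> sub; apply: big_fset_incl => // k _ /mcoeff_outdom ->.
by rewrite T0 scale0r.
Qed.

Lemma malg_evalB u v : malg_eval (u - v) = malg_eval u - malg_eval v.
Proof.
pose d := (msupp u `|` msupp v)%fset.
rewrite (@malg_evalE d) ?msuppB_le // (@malg_evalE d u) ?fsubsetUl //.
rewrite (@malg_evalE d v) ?fsubsetUr // -sumrB.
by apply: eq_bigr => k _; rewrite mcoeffB TB scalerBl.
Qed.

Lemma malg_evalU a k : malg_eval << a *g k >> = T a *: l k.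
Proof.
rewrite (@malg_evalE [fset k]%fset) ?msuppU_le // big_seq_fset1.
by rewrite mcoeffUU.
Qed.

End Evaluation.

Lemma malg_evalZ (R : nzRingType) (K : choiceType) (M : lmodType R) (T T' : R -> R)
    (l : K -> M) a (u : {malg R[K]}) :
    (forall a b, T (a - b) = T a - T b) -> (forall a b, T' (a - b) = T' a - T' b) ->
    (forall b, T' (a * b) = a * T b) ->
  malg_eval T' l (a *: u) = a *: malg_eval T l u.
Proof.
move=> TB TB' TZ; rewrite (@malg_evalE _ _ _ _ _ TB' (msupp u)) ?msuppZ_le //.
rewrite /malg_eval scaler_sumr; apply: eq_bigr => k _.
by rewrite mcoeffZ TZ scalerA.
Qed.

Definition malg_lin (R : nzRingType) (K : choiceType) (M : lmodType R) (l : K -> M)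
  (u : {malg R[K]}) : M := malg_eval id l u.

Section MalgLin.
Variables (R : nzRingType) (K : choiceType) (M : lmodType R) (l : K -> M).
Fact malg_lin_is_linear : linear (malg_lin l).
Proof.
move=> a u v; rewrite /malg_lin -[v in LHS]opprK malg_evalB //.
rewrite (@malg_evalZ _ _ _ id id) // -[- v]add0r malg_evalB // opprB.
by rewrite /malg_eval msupp0 big_seq_fset0 subr0.
Qed.
HB.instance Definition _ := GRing.isLinear.Build R {malg R[K]} M _ (malg_lin l)
  malg_lin_is_linear.
End MalgLin.

Section Interface.
Variables (F : fieldType) (B : nzRingType) (gr : nat -> B -> Prop) (sc : F -> B).
Hypothesis (conn : connected gr sc) (grP : is_grading gr).
Local Notation grmod := (grmod gr).
Local Notation gmod := (gmod gr).

Definition hcomp (n : int) (a : B) : B :=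
  if n is Posz i then component grP i a else 0.

Lemma hcomp_deg n a : hdeg gr n (hcomp n a).
Proof. by case: n => n //=; exact: component_deg. Qed.

Lemma hcompB n a b : hcomp n (a - b) = hcomp n a - hcomp n b.
Proof. by case: n => n /=; rewrite ?subrr ?componentB. Qed.

Lemma component_scale (M : grmod) n i a (m : M) : mdeg i m ->
  component (mdeg_grading M) n (a *: m) = hcomp (n%:Z - i%:Z) a *: m.
Proof.
move=> dm; have [N aE a0] := component_sum grP a.
rewrite (@component_uniq _ _ (mdeg_grading M) (a *: m) (i + N)
  (fun k => if (i <= k)%N then component grP (k - i)%N a *: m else 0)).
- case: leqP => [lein|ltni].
    have -> : n%:Z - i%:Z = (n - i)%N by lia.
    by [].
  by case E: (n%:Z - i%:Z) => [k|k] /=; [lia | rewrite scale0r].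
- move=> k; case: leqP => [leik|_]; last by case: (mdeg_grading M) => + _ _ _; apply.
  rewrite -[X in mdeg X](subnK leik); apply: mdeg_scale => //; exact: component_deg.
- by rewrite (sum_shift (fun k => component grP k a *: m)) -scaler_suml -aE.
- by move=> k lek; case: ifP => // leik; rewrite a0 ?scale0r //; lia.
Qed.

Definition grmod_reg : grmod :=
  @GrMod B gr B^o gr grP (fun i j a b => @gr_mul _ _ _ _ conn i j a b).

Lemma hcompZ n i a b : gr i a -> hcomp (n + i%:Z) (a * b) = a * hcomp n b.
Proof.
move=> ga; have [N bE b0] := component_sum grP b.
case E: (n + i%:Z) => [k|k] /=; last by case: n E => n E; [lia | rewrite mulr0].
rewrite (@component_uniq _ _ grP (a * b) (i + N)
  (fun k => if (i <= k)%N then a * component grP (k - i)%N b else 0)).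
- case: leqP => [leik|ltki].
    have -> : n = (k - i)%N by lia.
    by [].
  by case: n E => n E; [lia | rewrite /= mulr0].
- move=> j; case: leqP => [leij|_]; last exact: gr_sub0 conn _.
  by rewrite -[X in gr X](subnKC leij); apply: (gr_mul conn) => //; exact: component_deg.
- by rewrite (sum_shift (fun k => a * component grP k b)) -mulr_sumr -bE.
- by move=> j lej; case: ifP => // leij; rewrite b0 ?mulr0 //; lia.
Qed.

Definition gm_deg (M : grmod) (n : int) (u : M) :=
  if n is Posz i then mdeg i u else u = 0.

Definition gm (M : grmod) : gmod.
Proof.
refine (@GMod B gr M (@gm_deg M) _ _ _).
- by case=> n //=; case: (mdeg_grading M).
- case=> n u v /=; first by case: (mdeg_grading M) => _ + _ _; apply.
  by move=> -> ->; rewrite subrr.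
- case=> n i a u ga /=; first by move=> du; rewrite addnC; exact: mdeg_scale.
  move=> ->; rewrite scaler0; case: (_ + _) => k //=.
  by case: (mdeg_grading M) => + _ _ _; apply.
Defined.

Definition gm_map (M N : grmod) (f : {linear M -> N}) (fd : graded_map f) :
  gmap (gm M) (gm N).
Proof.
refine (@glin _ _ (gm M) (gm N) f _).
by case=> n u /=; [exact: fd | move=> ->; rewrite raddf0].
Defined.

Lemma graded_preimage (M N : grmod) (f : {linear M -> N}) n (v : N) :
  graded_map f -> mdeg n v -> (exists u, f u = v) -> exists2 u, mdeg n u & f u = v.
Proof.
move=> fd dv [u fu]; exists (component (mdeg_grading M) n u).
  exact: component_deg.
have [N' uE _] := component_sum (mdeg_grading M) u.
have := component_homog (mdeg_grading N) dv n; rewrite eqxx => {1}<-.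
rewrite -fu {2}uE raddf_sum component_bigsum.
have cE i : component (mdeg_grading N) n (f (component (mdeg_grading M) i u)) =
    if n == i then f (component (mdeg_grading M) i u) else 0.
  by apply: component_homog; apply: fd; exact: component_deg.
under eq_bigr => i _ do rewrite cE.
case: (ltnP n N') => [ltn|len].
  rewrite (bigD1 (Ordinal ltn)) //= eqxx big1 ?addr0 // => i /eqP ni.
  by case: eqP => // nE; case: ni; apply/val_inj.
rewrite big1 => [|i _]; last by rewrite gtn_eqF // (leq_trans (ltn_ord i)).
have [N'' _ u0] := component_sum (mdeg_grading M) u.
move: uE => /(f_equal (component (mdeg_grading M) n)).
rewrite component_bigsum big1 => [->|i _]; first by rewrite raddf0.
rewrite (component_homog (mdeg_grading M) (component_deg _ i u)).
by rewrite gtn_eqF // (leq_trans (ltn_ord i)).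
Qed.

Lemma gen_in_degreeE (P : grmod) i n (u : P) : generated_in_degree i P ->
    mdeg n u -> exists k (a : 'I_k -> B) (g : 'I_k -> P),
  [/\ forall j, mdeg i (g j), forall j, hdeg gr (n%:Z - i%:Z) (a j)
    & u = \sum_j a j *: g j].
Proof.
move=> gP du; have [k [a [g [dg uE]]]] := gP u.
exists k, (fun j => hcomp (n%:Z - i%:Z) (a j)), g; split=> //.
  by move=> j; exact: hcomp_deg.
have := component_homog (mdeg_grading P) du n; rewrite eqxx => {1}<-.
rewrite {1}uE component_bigsum; apply: eq_bigr => j _.
exact: component_scale.
Qed.

Lemma gen_le_gm (P : grmod) (i : nat) : generated_in_degree i P -> gen_le i (gm P).
Proof.
move=> gP S S0 SB SZ Sle n u.
have SD m v w : S m v -> S m w -> S m (v + w).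
  move=> Sv Sw; rewrite -[w]opprK; apply: (SB) => //.
  by rewrite -[- w]add0r; exact: SB.
case: n => n /=; last by move=> ->.
move=> /(gen_in_degreeE gP) [k [a [g [dg da ->]]]].
apply: (big_ind (S n)) => [//|v w|j _]; first exact: SD.
have := da j; case E: (n%:Z - i%:Z) => [m|m] /= ga; last by rewrite ga scale0r.
have -> : n%:Z = i%:Z + m by lia.
by apply: SZ => //; exact: (Sle _ (g j) (lexx _) (dg j)).
Qed.

(** Projectivity is only given for ungraded maps.  Being generated in degree i,
    P is a direct factor of the free module on its set of elements, where those
    that are not of degree i are sent to 0; a section h of that evaluation gives
    coordinates, and their homogeneous components define the graded lift. *)
Lemma gproj_gm (P : grmod) (i : nat) :
  projective P -> generated_in_degree i P -> gproj (gm P).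
Proof.
move=> pP gP M N g f gs.
pose e (k : P) : P := if `[< mdeg i k >] then k else 0.
have [|h hP] := pP _ _ (malg_lin e) idfun.
  move=> u; have [k [a [b [db ->]]]] := gP u.
  exists (\sum_j << a j *g b j >>); rewrite raddf_sum; apply: eq_bigr => j _ /=.
  by rewrite /malg_lin malg_evalU // /e asboolT.
have ed k : mdeg i (e k).
  by rewrite /e; case: asboolP => // _; case: (mdeg_grading P).
have /choice [l lP] : forall k, exists u : M, gdeg (i : int) u /\ g i u = f i (e k).
  move=> k.
  have [u Mu gu] := gs i _ (gmap_deg f (ed k : gdeg (i : int) (e k : gm P))).
  by exists u.
pose H (n : int) (p : gm P) := malg_eval (hcomp (n - i%:Z)) l (h p).
have HT n : forall a b, hcomp n (a - b) = hcomp n a - hcomp n b by exact: hcompB.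
have Hdeg n p : gdeg n p -> gdeg n (H n p).
  move=> _; apply: gdeg_sum => k _.
  by apply: (gdeg_hdeg (hcomp_deg _ _)); case: (lP k).
have HB n u v : gdeg n u -> gdeg n v -> H n (u - v) = H n u - H n v.
  by move=> _ _; rewrite /H raddfB malg_evalB.
have HZ n j a u : gr j a -> gdeg n u -> H (n + j%:Z) (a *: u) = a *: H n u.
  move=> ga _; rewrite /H linearZ; apply: malg_evalZ => // b.
  by rewrite addrAC hcompZ.
exists (GMap Hdeg HB HZ) => n p Pp /=.
have term n' k a : gdeg n' (hcomp (n' - i%:Z) a *: l k).
  by apply: (gdeg_hdeg (hcomp_deg _ _)); case: (lP k).
rewrite /H /malg_eval gmap_sum => [|k]; last exact: term.
have pE : p = \sum_(k <- msupp (h p)) hcomp (n - i%:Z) (h p)@_k *: e k.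
  case: n Pp => n /= Pp; last first.
    rewrite Pp raddf0 big1 // => k _.
    by case E: (Negz n - i%:Z) => [m|m] /=; [lia | rewrite scale0r].
  have := component_homog (mdeg_grading P) Pp n; rewrite eqxx => {1}<-.
  rewrite -[X in component _ n X](hP p) /= /malg_lin /malg_eval component_bigsum.
  by apply: eq_bigr => k _; exact: component_scale.
have tP k : gdeg n (hcomp (n - i%:Z) (h p)@_k *: e k : gm P).
  by apply: (gdeg_hdeg (M := gm P) (hcomp_deg _ _)); exact: (ed k).
rewrite [in RHS]pE.
rewrite (@gmap_sum _ _ _ _ f n _ _ (fun k => hcomp (n - i%:Z) (h p)@_k *: e k)) //.
apply: eq_bigr => k _; have [dl gl] := lP k.
rewrite (gmap_hdeg g (hcomp_deg _ _) dl) gl.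
by rewrite (gmap_hdeg f (hcomp_deg _ _) (ed k : gdeg (i : int) (e k : gm P))).
Qed.

(** One exact step of a resolution covers a kernel with the next projective. *)
Lemma resolution_step n (i : nat) (P' P Q : grmod) (d' : {linear P' -> P})
    (d : {linear P -> Q}) (gd' : graded_map d') (gd : graded_map d) :
    projective P' -> generated_in_degree i P' -> exact_at d' d ->
  reg n (i%:Z + 1) (gker (gm_map gd')) -> reg n.+1 i (gker (gm_map gd)).
Proof.
move=> pP gP ex rK.
have fd k u : gdeg k (u : gm P') -> gdeg k (d' u : gker (gm_map gd)).
  move=> Pu; split; first exact: (gmap_deg (gm_map gd')).
  by apply/ex; exists u.
exists (gm P'), (@glin _ _ (gm P') (gker (gm_map gd)) d' fd); split.
- exact: gproj_gm gP.
- exact: gen_le_gm.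
- case=> [k|k] u [/= du /ex]; first exact: (graded_preimage gd' du).
  by move=> _; exists 0; rewrite ?raddf0.
apply: (@reg_iso_lin _ _ _ _ (gker (gm_map gd')) (gker (glin fd)) idfun) rK => //.
by move=> k u; exists u.
Qed.

Definition gplus : gmod.
Proof.
refine (@GMod B gr B^o (fun n a => hdeg gr n a /\ (n <= 0 -> a = 0)) _ _ _).
- by move=> n; split=> // ; exact: hdeg0 conn _.
- move=> n u v [du u0] [dv v0]; split; first exact: (hdegB conn).
  by move=> n0; rewrite u0 ?v0 ?subrr.
- move=> n i a u ga [du u0]; split; first exact: (hdegZ conn).
  by move=> n0; rewrite u0 ?scaler0 //; lia.
Defined.

Lemma irrelevant_homog n (a : B) : gr n a ->
  irrelevant_ideal gr a <-> (n = 0%N -> a = 0).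
Proof.
have [g0 _ _ _] := grP; move=> ga; split.
  move=> [N [c [gc aE]]] n0.
  have := component_homog grP ga 0%N; rewrite n0 eqxx => <-.
  rewrite (@component_uniq _ _ grP a N.+1 (fun j => if j is i.+1 then
     if (i < N)%N then c i else 0 else 0)) //.
  - by case=> // i; case: ifP.
  - rewrite big_ord_recl add0r aE; apply: eq_bigr => i _.
    by rewrite ltn_ord.
  - by case=> // i; rewrite ltnS leqNgt => /negPf ->.
case: n ga => [|n] ga a0; first by exists 0%N, (fun=> 0); rewrite big_ord0 a0.
exists n.+1, (fun i => if i == n then a else 0); split.
  by move=> i; case: eqP => // ->.
by rewrite big_ord_recr /= eqxx big1 ?add0r // => i _; rewrite ltn_eqF.
Qed.

(** The kernels of the differentials are regular by [resolution_step], hence the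
    trivial module has regularity 0, and [reg_kernel] gives the augmentation
    ideal, which is the kernel of B -> K. *)
Lemma reg_of_resolution (K : grmod) (P : nat -> grmod)
    (d : forall i, {linear P i.+1 -> P i}) (e : {linear P 0%N -> K}) :
  is_trivial_module K -> linear_projective_resolution d e ->
  forall n, reg n 1 gplus.
Proof.
move=> [pi [pis pi0 pid]] [Pi [ed dd] es ex0 ex] n.
have rd k i : reg k (i.+2 : int) (gker (gm_map (dd i))).
  elim: k i => [//|k IH] i; have [pP gP] := Pi i.+2.
  apply: (resolution_step (gd' := dd i.+1)) => //.
  by have := IH i.+1; congr reg; lia.
have re k : reg k 1 (gker (gm_map ed)).
  case: k => [//|k]; have [pP gP] := Pi 1%N.
  by apply: (resolution_step (i := 1%N) (gd' := dd 0%N)) => //; exact: rd.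
have rK : reg n.+1 0 (gm K).
  have [pP gP] := Pi 0%N.
  exists (gm (P 0%N)), (gm_map ed); split.
  - exact: gproj_gm gP.
  - exact: (gen_le_gm gP).
  - case=> [k|k] u /= du; last by exists 0; rewrite ?raddf0.
    exact: (graded_preimage ed du).
  - exact: re.
have piK k a : gdeg k (a : greg conn) -> gdeg k (pi a : gm K).
  by case: k => k /=; [exact: pid | move=> ->; rewrite raddf0].
pose p := @glin _ _ (greg conn) (gm K) pi piK.
have ps : gsurj p.
  case=> [k|k] u /= du; last by exists 0; rewrite ?raddf0.
  exact: (@graded_preimage grmod_reg K pi k u pid du (pis u)).
have [pB gB] := greg_proj conn.
have rB : reg n (0 + 1) (greg conn).
  by apply: reg_gproj => //; apply: gen_le_mono gB.
have := reg_kernel ps rB rK.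
apply: (@reg_iso_lin _ _ _ _ (gker p) gplus idfun) => //.
  case=> k u [/= du /pi0]; last by [].
  by move=> /(irrelevant_homog du) k0; split=> // le0; apply: k0; lia.
case=> k u [/= du k0]; exists u => //; last first.
  by split=> //; rewrite /= du raddf0.
split=> //; apply/pi0/(irrelevant_homog du) => E.
by apply: k0; lia.
Qed.

End Interface.

(** * From regularity to a linear resolution *)
Lemma projective_row (B : pzRingType) m : projective ('rV[B]_m : lmodType B).
Proof.
move=> M N g f gs.
have /choice [l lP] : forall k : 'I_m, exists u : M, g u = f (delta_mx 0 k).
  by move=> k; exact: gs.
exists (free_fun l) => v; rewrite [in RHS](row_sum_basis v) /free_fun /=.
rewrite (linear_sum g) (linear_sum f).
by apply: eq_bigr => k _; rewrite (linearZ_LR g) (linearZ_LR f) lP.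
Qed.

Section TrivialModule.
Variables (F : fieldType) (B : nzRingType).

Definition triv (eps : {rmorphism B -> F}) : Type := F.
Variable eps : {rmorphism B -> F}.
HB.instance Definition _ := GRing.Zmodule.on (triv eps).

Definition triv_scale (a : B) (x : triv eps) : triv eps := eps a * (x : F).

Fact triv_scaleA a b x : triv_scale a (triv_scale b x) = triv_scale (a * b) x.
Proof. by rewrite /triv_scale rmorphM mulrA. Qed.
Fact triv_scale1 : left_id 1 triv_scale.
Proof. by move=> x; rewrite /triv_scale rmorph1 mul1r. Qed.
Fact triv_scaleDr : right_distributive triv_scale +%R.
Proof. by move=> a x y; rewrite /triv_scale mulrDr. Qed.
Fact triv_scaleDl x : {morph triv_scale^~ x : a b / a + b}.
Proof. by move=> a b; rewrite /triv_scale rmorphD mulrDl. Qed.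
HB.instance Definition _ := GRing.Zmodule_isLmodule.Build B (triv eps)
  triv_scaleA triv_scale1 triv_scaleDr triv_scaleDl.

Definition triv_pi (a : B^o) : triv eps := eps a.
Fact triv_pi_linear : linear triv_pi.
Proof. by move=> a u v; rewrite /triv_pi rmorphD rmorphM. Qed.
HB.instance Definition _ :=
  GRing.isLinear.Build B B^o (triv eps) _ triv_pi triv_pi_linear.

End TrivialModule.

Section Construction.
Variables (F : fieldType) (B : nzRingType) (gr : nat -> B -> Prop) (sc : F -> B).
Hypothesis (conn : connected gr sc) (grP : is_grading gr).
Hypothesis B_fdim : fdim sc (greg conn).
Variable eps : {rmorphism B -> F}.
Hypothesis eps_sc : forall c, eps (sc c) = c.
Hypothesis eps_pos : forall i a, gr i.+1 a -> eps a = 0.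
Local Notation grmod := (grmod gr).
Local Notation gmod := (gmod gr).

Definition grfree (m i : nat) : grmod.
Proof.
refine (@GrMod B gr 'rV[B]_m _ (row_grading m (shift_grading i grP)) _).
move=> k j a v ga dv l; rewrite mxE; have := dv l.
case: (leqP i j) => [leij|ltji] gv.
  rewrite (leq_trans leij (leq_addl _ _)) -addnBA //.
  exact: (gr_mul conn).
rewrite gv mulr0; case: ifP => // _; exact: gr_sub0 conn _.
Defined.

Definition grtriv : grmod.
Proof.
refine (@GrMod B gr (triv eps) (fun n x => (0 < n)%N -> x = 0) _ _).
  split.
  - by [].
  - by move=> n u v u0 v0 n0; rewrite u0 ?v0 ?subrr.
  - move=> v; exists 1%N, (fun n => if n == 0%N then v else 0); split.
      by case.
    by rewrite big_ord1.
  - move=> [|N] c c0; first by [].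
    rewrite big_ord_recl big1 ?addr0 => [c00 [|i] _ //|i _]; last exact: c0.
    exact: c0.
move=> i j a x ga x0 ij; case: (posnP j) => [j0|j0]; last by rewrite x0 // scaler0.
case: i ij ga => [|i] ij ga; first by rewrite j0 in ij.
by rewrite /GRing.scale /= /triv_scale (eps_pos ga) mul0r.
Defined.

Lemma hdeg_mulr n i a b : hdeg gr n a -> gr i b -> hdeg gr (n + i%:Z) (a * b).
Proof.
case: n => [n|n] /= ga gb; first exact: (gr_mul conn).
by rewrite ga mul0r; exact: hdeg0 conn _.
Qed.

Lemma row_map_deg m n (G : 'M[B]_(m, n)) (Gd : forall j k, gr 1%N (G j k)) c v :
  gdeg c (v : gfree conn m 0) -> gdeg c (mulmxr G v : gshift 1 (gfree conn n 0)).
Proof.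
move=> dv k; rewrite mxE.
apply: (big_ind (hdeg gr (c + 1 - 0))) => [|x y|j _]; first exact: hdeg0 conn _.
- move=> hx hy; rewrite -[y]opprK; apply: (hdegB conn) => //.
  by rewrite -[- y]add0r; apply: (hdegB conn) => //; exact: hdeg0 conn _.
- by rewrite addrAC; apply: hdeg_mulr => //; exact: dv.
Qed.

Definition row_map m n (G : 'M[B]_(m, n)) (Gd : forall j k, gr 1%N (G j k)) :
    gmap (gfree conn m 0) (gshift 1 (gfree conn n 0)) :=
  @glin _ _ (gfree conn m 0) (gshift 1 (gfree conn n 0)) (mulmxr G) (row_map_deg Gd).

(** The step that builds a resolution.  The minimal cover of the kernel Z of a
    graded map out of a free module is given by the rows of a matrix G of degree
    1, and the relations between these rows are again regular and start in
    degree 1, after the shift that puts their generators in degree 0. *)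
Lemma cover_step m (N : gmod) (q : {linear 'rV[B]_m -> N})
    (qd : forall n v, gdeg n (v : gfree conn m 0) -> gdeg n (q v)) :
    let Z := gker (@glin _ _ (gfree conn m 0) N q qd) in
    (forall n, reg n 1 Z) ->
    (forall (n : int) v, n < 1 -> gdeg n (v : Z) -> v = 0) ->
    (forall M (c : nat -> N), (forall i : nat, gdeg (i : int) (c i)) ->
       \sum_(i < M) c i = 0 -> forall i, (i < M)%N -> c i = 0) ->
  exists m' (G : 'M[B]_(m', m)) (Gd : forall j k, gr 1%N (G j k)),
    [/\ forall v, q v = 0 <-> exists w : 'rV_m', w *m G = v,
        forall n, reg n 1 (gker (row_map Gd))
      & forall (n : int) v, n < 1 -> gdeg n (v : gker (row_map Gd)) -> v = 0].
Proof.
move=> Z rZ Zlow Nind.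
have genZ : gen_le 1 Z.
  by have [P [f [_ gP fs _]]] := rZ 1%N; exact: (gen_le_surj fs gP).
have fZ : fdim sc Z by apply: fdim_gker; exact: fdim_free.
have [m' [g [gd [gS gK]]]] := min_cover conn fZ Zlow genZ.
pose G : 'M[B]_(m', m) := \matrix_(j, k) (g j : 'rV[B]_m) 0 k.
have GE w : w *m G = free_fun g w.
  rewrite mulmx_sum_row; apply: eq_bigr => j _; congr (_ *: _).
  by apply/rowP => k; rewrite !mxE.
have Gd j k : gr 1%N (G j k) by have [dg _] := gd j; rewrite mxE; exact: (dg k).
have kerE n v : gdeg n (v : gker (row_map Gd)) ->
    gdeg (n + 1) (v : gker (gfree_map conn gd)).
  move=> [dv v0]; split; last by rewrite -[RHS]v0 /= GE.
  by move=> k; rewrite addrK -[n]subr0; exact: dv.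
exists m', G, Gd; split.
- move=> v; split=> [qv|[w <-]]; last first.
    rewrite GE /free_fun linear_sum big1 // => j _.
    have {gd gS gK GE Gd kerE} [_ qg] := gd j; have {}qg : q (g j) = 0 := qg.
    by rewrite linearZ_LR qg scaler0.
  pose cv i := component (row_grading m grP) i v.
  have dcv (i : nat) : gdeg (i : int) (cv i : gfree conn m 0).
    by move=> k; rewrite subr0; exact: (component_deg (row_grading m grP)).
  have [M vE _] := component_sum (row_grading m grP) v.
  have qc i : (i < M)%N -> q (cv i) = 0.
    apply: (Nind M (fun i => q (cv i))); first by move=> j; exact: (qd _ _ (dcv j)).
    by rewrite -[RHS]qv [in RHS]vE linear_sum.
  have /choice [w wP] : forall i : 'I_M, exists w : 'rV[B]_m', free_fun g w = cv i.
    move=> i; have [w _ wE] := gS (i : int) (cv i) (conj (dcv i) (qc i (ltn_ord i))).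
    by exists w.
  exists (\sum_i w i); rewrite GE linear_sum [RHS]vE.
  by apply: eq_bigr => i _; exact: wP.
- move=> n; have [pP gP] := gfree_proj conn m' 1.
  have rf : reg n (1 + 1) (gfree conn m' 1).
    by apply: reg_gproj => //; exact: gen_le_mono gP.
  have := reg_shift 1 (reg_kernel gS rf (rZ n.+1)).
  rewrite addrK.
  apply: (@reg_iso_lin _ _ _ _ (gshift 1 (gker (gfree_map conn gd)))
    (gker (row_map Gd)) idfun) => //.
    move=> k v [dv v0]; split; last by rewrite /= GE.
    by move=> j; rewrite subr0 -[k](addrK 1); exact: dv.
  by move=> k v /kerE kv; exists v.
- by move=> n v lt_n /kerE; apply: gK; lia.
Qed.

(** A matrix of degree 1 whose row relations satisfy the hypotheses of
    [cover_step]: the data from which the next differential is built. *)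
Record stage := Stage {
  st_n : nat;
  st_m : nat;
  st_G : 'M[B]_(st_m, st_n);
  st_deg : forall j k, gr 1%N (st_G j k);
  st_reg : forall n, reg n 1 (gker (row_map st_deg));
  st_low : forall (n : int) v, n < 1 -> gdeg n (v : gker (row_map st_deg)) -> v = 0
}.

(** The next stage is paired with a copy of its matrix that has [st_m s] columns
    by definition, so that consecutive differentials compose without casts. *)
Lemma next_stage (s : stage) : exists t : {t : stage & 'M[B]_(st_m t, st_m s)},
  [/\ forall j k, gr 1%N (projT2 t j k),
      forall v : 'rV_(st_m s), v *m st_G s = 0 <->
        exists w : 'rV_(st_m (projT1 t)), w *m projT2 t = v
    & forall v : 'rV_(st_m (projT1 t)),
        v *m projT2 t = 0 <-> v *m st_G (projT1 t) = 0].
Proof.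
have [|m [G [Gd [ex r l]]]] := cover_step (@st_reg s) (@st_low s).
  move=> M c dc cE i ltiM; have [_ _ _ gI] := row_grading (st_n s) grP.
  (* The target is shifted by 1: its degree i holds the rows of degree i + 1. *)
  pose c' j := if j is j'.+1 then c j' else 0.
  apply: (gI M.+1 c' _ _ i.+1) => //.
    case=> [|j] k /=; first by rewrite mxE; exact: gr_sub0 conn _.
    by have := dc j k; rewrite subr0 -PoszD addn1.
  by rewrite big_ord_recl /= add0r.
by exists (existT (fun t => 'M[B]_(st_m t, st_m s)) (Stage r l) G).
Qed.

Definition augmentation : {linear 'rV[B]_1 -> triv eps} :=
  free_fun (fun _ : 'I_1 => (1 : F) : triv eps).

Lemma augmentationE v : augmentation v = eps (v 0 0) :> F.
Proof. by apply: (etrans (big_ord1 _ _)); exact: mulr1. Qed.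

Lemma augmentation_deg n v :
  gdeg n (v : gfree conn 1 0) -> gdeg n (augmentation v : gm grtriv).
Proof.
move=> /(_ 0); rewrite subr0; case: n => [n|n] /= dv; last first.
  by apply: (etrans (augmentationE v)); rewrite dv rmorph0.
case: n dv => // n dv _.
by apply: (etrans (augmentationE v)); rewrite (eps_pos dv).
Qed.

Lemma grfree_proj m i : projective (grfree m i).
Proof. exact: projective_row. Qed.

Lemma grfree_gen m i : generated_in_degree i (grfree m i).
Proof.
move=> v; exists m, (fun k => v 0 k), (fun k => delta_mx 0 k); split.
  move=> k l; rewrite leqnn subnn mxE.
  rewrite eqxx /=; case: (l == k); rewrite ?mulr1n ?mulr0n; last exact: gr_sub0 conn _.
  by rewrite -(sc1 conn); exact: gr_sc conn _.
exact: row_sum_basis.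
Qed.

Lemma row_map_graded m n i (G : 'M[B]_(m, n)) : (forall j k, gr 1%N (G j k)) ->
  @graded_map _ _ (grfree m i.+1) (grfree n i) (mulmxr G).
Proof.
move=> Gd k v dv l; rewrite mxE; have [g0 gB _ _] := shift_grading i grP.
apply: (grading_sum (shift_grading i grP)) => j _; have := dv j.
case: ifP => [lt_ik dj|_ ->]; last by rewrite mul0r; exact: g0.
rewrite (ltnW lt_ik).
have -> : (k - i)%N = (k - i.+1 + 1)%N by lia.
exact: (gr_mul conn).
Qed.

Lemma grtriv_trivial : is_trivial_module grtriv.
Proof.
exists (triv_pi eps); split.
- by move=> x; exists (sc x); rewrite /triv_pi eps_sc.
- move=> a; have [N aE a0] := component_sum grP a.
  have [b bE] := gr_scP conn (component_deg grP 0 a).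
  have epsE : eps a = eps (component grP 0 a).
    case: N aE a0 => [|N] aE a0; first by rewrite a0 // aE big_ord0.
    rewrite {1}aE big_ord_recl rmorphD rmorph_sum big1 ?addr0 // => i _.
    exact: eps_pos (component_deg grP _ a).
  split=> [pa|[n [c [gc ->]]]]; last first.
    by rewrite /triv_pi rmorph_sum big1 // => i _; exact: eps_pos (gc i).
  have b0 : component grP 0 a = 0.
    have : eps a = 0 := pa; rewrite epsE bE eps_sc => ->; exact: sc0 conn.
  exists N, (fun i => component grP i.+1 a); split=> [i|].
    exact: component_deg.
  rewrite {1}aE -[LHS](@sum_ord_widen _ N N.+1 (fun i => component grP i a)) //.
  by rewrite big_ord_recl b0 add0r.
- by case=> // n a ga _; exact: eps_pos ga.
Qed.

Definition aug_map : gmap (gfree conn 1 0) (gm grtriv) :=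
  @glin _ _ (gfree conn 1 0) (gm grtriv) augmentation augmentation_deg.

Lemma aug_kernel n v :
  gdeg n (v : gker aug_map) -> gdeg n (v 0 0 : gplus conn).
Proof.
move=> [dv v0]; have := dv 0; rewrite subr0 => d0; split=> // n0.
have {}v0 : eps (v 0 0) = 0 by rewrite -augmentationE; exact: v0.
case: n n0 d0 {dv} => // n n0; have {n0}-> : n = 0%N by lia.
move=> /(gr_scP conn) [c cE]; rewrite cE -[c]eps_sc -cE v0.
exact: sc0 conn.
Qed.

Lemma reg_aug_kernel n : reg n 1 (gplus conn) -> reg n 1 (gker aug_map).
Proof.
pose i (a : B) : 'rV[B]_1 := const_mx a.
have idg k a : gdeg k (a : gplus conn) -> gdeg k (i a : gker aug_map).
  move=> [da a0]; have di : gdeg k (i a : gfree conn 1 0).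
    by move=> j; rewrite subr0 mxE.
  split; first exact: di.
  apply: (etrans (augmentationE _)).
  rewrite mxE; case: k da a0 di => [[|k]|k] /= da a0 _.
  - by rewrite a0 ?rmorph0.
  - exact: eps_pos da.
  - by rewrite da rmorph0.
have iB k a b : gdeg k (a : gplus conn) -> gdeg k (b : gplus conn) ->
    i (a - b) = i a - i b.
  by move=> _ _; apply/rowP => j; rewrite !mxE.
have iZ k l a (b : gplus conn) : gr l a -> gdeg k b -> i (a *: b) = a *: i b.
  by move=> _ _; apply/rowP => j; rewrite !mxE.
apply: (@reg_iso _ _ n 1 (gplus conn) (gker aug_map)
  (@GMap _ _ (gplus conn) (gker aug_map) (fun _ => i) idg iB iZ)).
  by move=> k a _ /rowP /(_ 0); rewrite !mxE.
move=> k v /aug_kernel dv; exists (v 0 0) => //.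
by apply/rowP => j; rewrite mxE ord1.
Qed.

(** Dimensions of the free modules in a sequence of matrices: [m i] is the number
    of rows of the i-th one, and n the number of columns of the first one. *)
Definition dims (n : nat) (m : nat -> nat) (i : nat) : nat :=
  if i is j.+1 then m j else n.

Lemma matrix_sequence (s : stage) :
  exists (m : nat -> nat) (G : forall i, 'M[B]_(m i, dims (st_n s) m i)),
  [/\ forall i j k, gr 1%N (G i j k),
      forall v, (exists w : 'rV_(st_m s), w *m st_G s = v) <->
        exists w : 'rV_(m 0%N), w *m G 0%N = v
    & forall i (v : 'rV_(m i)), v *m G i = 0 <->
        exists w : 'rV_(m i.+1), w *m G i.+1 = v].
Proof.
have [f fP] : exists f : forall t, {u : stage & 'M[B]_(st_m u, st_m t)}, forall t,
    [/\ forall j k, gr 1%N (projT2 (f t) j k),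
        forall v : 'rV_(st_m t), v *m st_G t = 0 <->
          exists w : 'rV_(st_m (projT1 (f t))), w *m projT2 (f t) = v
      & forall v : 'rV_(st_m (projT1 (f t))),
          v *m projT2 (f t) = 0 <-> v *m st_G (projT1 (f t)) = 0].
  exists (fun t => sval (cid (next_stage t))) => t.
  exact: svalP (cid (next_stage t)).
pose st i := iter i (fun t => projT1 (f t)) s.
pose m i := st_m (st i).
pose G i : 'M[B]_(m i, dims (st_n s) m i) :=
  match i return 'M[B]_(m i, dims (st_n s) m i) with
  | 0%N => st_G s
  | i.+1 => projT2 (f (st i))
  end.
exists m, G; split.
- by case=> [|i]; [exact: (@st_deg s) | have [Gd _ _] := fP (st i)].
- by [].
- case=> [|i] v; first by have [_ ex _] := fP s; exact: ex.
  have [_ _ HG] := fP (st i); have [_ ex _] := fP (st i.+1).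
  exact: iff_trans (HG v) (ex v).
Qed.

(** The resolution starts with B -> F, whose kernel is the augmentation ideal;
    the differentials are the matrices of the iterated stages, with the i-th free
    module generated in degree i. *)
Lemma resolution_of_reg : (forall n, reg n 1 (gplus conn)) ->
  exists (K : grmod) (P : nat -> grmod) (d : forall i, {linear P i.+1 -> P i})
         (e : {linear P 0%N -> K}),
    is_trivial_module K /\ linear_projective_resolution d e.
Proof.
move=> rplus.
have [| | |m1 [G1 [Gd1 [ex1 r1 l1]]]] :=
  @cover_step 1 (gm grtriv) augmentation augmentation_deg.
- by move=> n; exact: reg_aug_kernel.
- move=> n v n0 /aug_kernel [_ v0]; apply/rowP => k; rewrite ord1 mxE.
  by apply: v0; lia.
- by move=> M c dc; have [_ _ _ gI] := mdeg_grading grtriv; exact: gI.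
have [m [G [Gd ex0 ex]]] := matrix_sequence (Stage r1 l1).
exists grtriv, (fun i => grfree (dims 1 m i) i).
exists (fun i => mulmxr (G i)), augmentation; split; first exact: grtriv_trivial.
split.
- by move=> i; split; [exact: grfree_proj | exact: grfree_gen].
- split=> [n v dv n0|i]; last exact: (row_map_graded (i := i) (Gd i)).
  apply: (etrans (augmentationE v)); have := dv 0.
  by rewrite subn0; case: n n0 dv => // n _ _; exact: eps_pos.
- move=> x; exists (const_mx (sc x)); apply: (etrans (augmentationE _)).
  by rewrite mxE eps_sc.
- by move=> v; apply: (iff_trans (ex1 v)); exact: ex0.
- exact: ex.
Qed.

End Construction.

(** * Koszul algebras and the augmentation ideal *)
Section RightModules.
Variables (F : fieldType) (A : algType F) (gr : nat -> A -> Prop).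
Hypothesis gr_conn : connected_graded gr.
Local Notation B := (A^c).

Definition csc (c : F) : B := c%:A.

Lemma conv_connected : connected (gr : nat -> B -> Prop) csc.
Proof.
have [[g0 gB _ _] gZ gM g0P] := gr_conn; split=> //.
- by move=> a b; exact: scalerDl.
- move=> a b; rewrite /csc [RHS]/GRing.mul /=.
  by rewrite -scalerAl mul1r scalerA mulrC.
- exact: scale1r.
- by move=> i j a b da db; rewrite addnC; exact: gM.
- by move=> c; apply/g0P; exists c.
- by move=> a /g0P.
Qed.

Lemma csc_scale c (p : A) : csc c *: (p : B^o) = c *: p.
Proof. by rewrite /GRing.scale /= [LHS]/GRing.mul /= -scalerAr mulr1. Qed.

Lemma conv_fdim :
    (forall n, exists (T : finType) (w : T -> A), forall u, gr n u ->
       exists c : T -> F, u = \sum_t c t *: w t) ->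
  fdim csc (greg conv_connected).
Proof.
move=> fA; case=> n; last first.
  by exists void, (fun=> 0) => u ->; exists (fun=> 0); rewrite big_pred0 // => [[]].
have [T [w wP]] := fA n; exists T, w => u /wP [c ->]; exists c.
by apply: eq_bigr => t _; rewrite csc_scale.
Qed.

Variable eps : {rmorphism A -> F}.
Definition ceps : B -> F := eps.
Fact ceps_zmod : zmod_morphism ceps. Proof. by move=> p q; exact: (raddfB eps p q). Qed.
Fact ceps_monoid : monoid_morphism ceps.
Proof.
split=> [|p q]; first exact: (rmorph1 eps).
exact: (etrans (rmorphM eps q p) (mulrC _ _)).
Qed.
HB.instance Definition _ := GRing.isZmodMorphism.Build B F ceps ceps_zmod.
HB.instance Definition _ := GRing.isMonoidMorphism.Build B F ceps ceps_monoid.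

Lemma Koszul_reg : generated_in_degree_1 gr -> fdim csc (greg conv_connected) ->
    (forall c, eps c%:A = c) -> (forall n a, gr n.+1 a -> eps a = 0) ->
  Koszul A gr <-> forall n, reg n 1 (gplus conv_connected).
Proof.
move=> gen1 fA eps_sc eps_pos; have [grP _ _ _] := gr_conn.
split=> [[_ _ [K [P [dd [e [tK res]]]]]] n|rA].
  exact: (reg_of_resolution conv_connected grP tK res).
split=> //.
exact: (@resolution_of_reg F B gr csc conv_connected grP fA ceps eps_sc eps_pos rA).
Qed.

End RightModules.

(** * Algebras whose relations begin with a letter *)

(** The properties of the algebra of a poset on which the proof rests.  The
    letters are the elements of the poset without the least one, [la_next x y]
    means that y is in S_x(1), and [la_sum x] is r_x(1).  The projection
    [la_rho x] of the algebra to r_x R keeps the words that begin with x; its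
    existence and [la_ann], which computes the annihilator of r_x, say that
    relations begin with a letter. *)
Record letter_algebra (F : fieldType) := LetterAlgebra {
  la_alg :> algType F;
  la_deg : nat -> la_alg -> Prop;
  la_conn : connected_graded la_deg;
  la_gen1 : generated_in_degree_1 la_deg;
  la_let : finType;
  la_gen : la_let -> la_alg;
  la_next : rel la_let;
  la_sum : la_let -> la_alg;
  la_eps : {rmorphism la_alg -> F};
  la_rho : la_let -> {linear la_alg -> la_alg};
  la_fdim : forall n, exists (T : finType) (w : T -> la_alg),
    forall u, la_deg n u -> exists c : T -> F, u = \sum_t c t *: w t;
  la_epsA : forall c, la_eps c%:A = c;
  la_eps_deg : forall n u, la_deg n.+1 u -> la_eps u = 0;
  la_gen_deg : forall x, la_deg 1 (la_gen x);
  la_sumE : forall x, la_sum x = 0 \/ la_sum x = \sum_(y | la_next x y) la_gen y;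
  la_mul0 : forall x y, ~~ la_next x y -> la_gen x * la_gen y = 0;
  la_mul_sum : forall x, la_gen x * la_sum x = 0;
  la_ann : forall x u, la_gen x * u = 0 -> exists (b : la_let -> la_alg) (b0 : la_alg),
    u = \sum_(y | ~~ la_next x y) la_gen y * b y + la_sum x * b0;
  la_rho_gen : forall x y u,
    la_rho x (la_gen y * u) = if y == x then la_gen y * u else 0;
  la_rho_act : forall x u v, la_eps u = 0 -> la_rho x (u * v) = la_rho x u * v;
  la_rho1 : forall x, la_rho x 1 = 0;
  la_decomp : forall u, u = (la_eps u)%:A + \sum_x la_rho x u;
  la_factor : forall x u, exists q, la_rho x u = la_gen x * q;
  la_factor_deg : forall x n u, la_deg n.+1 u ->
    exists2 q, la_deg n q & la_rho x u = la_gen x * q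
}.

Section LetterModules.
Variables (F : fieldType) (L : letter_algebra F).
Local Notation X := (la_let L).
Local Notation R := (la_alg L).
Local Notation B := (R^c).
Local Notation Rdeg := (@la_deg F L).
Local Notation gr := (@la_deg F L : nat -> B -> Prop).
Local Notation conn := (conv_connected (@la_conn F L)).
Local Notation rg := (@la_gen F L).
Local Notation rg1 := (@la_sum F L).
Local Notation rho := (@la_rho F L).
Local Notation eps := (@la_eps F L).
Local Notation below1 := (@la_next F L).
Implicit Types (x y z : X) (Q : pred X).

Lemma la_grading : is_grading Rdeg. Proof. by have [] := la_conn L. Qed.
Lemma la_deg0P u : Rdeg 0 u <-> exists c : F, u = c%:A.
Proof. by have [_ _ _] := la_conn L; apply. Qed.
Lemma la_degM i j u v : Rdeg i u -> Rdeg j v -> Rdeg (i + j) (u * v).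
Proof. by have [_ _ + _] := la_conn L; apply. Qed.
Lemma la_deg0 n : Rdeg n 0. Proof. by have [] := la_grading. Qed.
Lemma la_deg_sum n (I : Type) (r : seq I) (P : pred I) (u : I -> R) :
  (forall i, P i -> Rdeg n (u i)) -> Rdeg n (\sum_(i <- r | P i) u i).
Proof. exact: (grading_sum la_grading). Qed.

Lemma la_eps_gen x : eps (rg x) = 0.
Proof. exact: la_eps_deg (la_gen_deg x). Qed.

Lemma la_sum_deg x : Rdeg 1 (rg1 x).
Proof.
case: (la_sumE x) => ->; first exact: la_deg0.
by apply: la_deg_sum => y _; exact: la_gen_deg.
Qed.

Lemma la_eps_sum x : eps (rg1 x) = 0.
Proof. exact: la_eps_deg (la_sum_deg x). Qed.

Lemma la_eps_rho x u : eps (rho x u) = 0.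
Proof. by have [q ->] := la_factor x u; rewrite rmorphM /= la_eps_gen mul0r. Qed.

Lemma la_rho_scalar x (c : F) : rho x c%:A = 0.
Proof. by rewrite linearZ /= la_rho1 scaler0. Qed.

Lemma la_rho_rho x y u : rho x (rho y u) = if y == x then rho y u else 0.
Proof. by have [q ->] := la_factor y u; exact: la_rho_gen. Qed.

Lemma la_rho_deg x n u : Rdeg n u -> Rdeg n (rho x u).
Proof.
case: n => [/la_deg0P [c ->]|n /(la_factor_deg x) [q dq ->]].
  by rewrite la_rho_scalar; exact: la_deg0.
by rewrite -add1n; apply: la_degM => //; exact: la_gen_deg.
Qed.

Lemma la_rho_sum x z u : ~~ below1 x z -> rho z (rg1 x * u) = 0.
Proof.
move=> nxz; case: (la_sumE x) => ->; first by rewrite mul0r raddf0.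
rewrite mulr_suml linear_sum big1 // => y xy; rewrite la_rho_gen.
by case: eqP => // yz; move: nxz; rewrite -yz xy.
Qed.

Lemma actE (a : B) (u : B^o) : a *: u = (u : R) * (a : R).
Proof. by []. Qed.

Lemma eps_of_rho (Q : pred X) (p : R) : p = \sum_(z | Q z) rho z p -> eps p = 0.
Proof. by move=> ->; rewrite rmorph_sum big1 // => z _; exact: la_eps_rho. Qed.

(** The sum of the right ideals r_z R for z in Q, cut out by the projections
    rather than spanned, so that the sum is visibly direct. *)
Definition Jmod Q : gmod gr.
Proof.
refine (@GMod B gr B^o
  (fun n u => hdeg gr n u /\ (u : R) = \sum_(z | Q z) rho z u) _ _ _).
- move=> n; split; first exact: hdeg0 conn _.
  by rewrite big1 // => z _; exact: raddf0.
- move=> n u v [du uE] [dv vE]; split; first exact: (hdegB conn).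
  by rewrite {1}uE {1}vE -sumrB; apply: eq_bigr => z _; rewrite [RHS]raddfB.
- move=> n i a u ga [du uE]; split; first exact: (hdegZ conn).
  have u0 := eps_of_rho uE; rewrite actE.
  rewrite {1}uE mulr_suml; apply: eq_bigr => z _.
  by rewrite -la_rho_act.
Defined.

(** The right ideal r_x(1) R. *)
Definition smod x : gmod gr.
Proof.
refine (@GMod B gr B^o
  (fun n u => exists2 v : B, hdeg gr (n - 1) v & (u : R) = rg1 x * v) _ _ _).
- by move=> n; exists 0; [exact: hdeg0 conn _ | rewrite mulr0].
- move=> n u v [u' du ->] [v' dv ->]; exists (u' - v'); first exact: (hdegB conn).
  by rewrite mulrBr.
- move=> n i a u ga [u' du ->]; exists (a * u'); last first.
    by rewrite actE -mulrA.
  by rewrite addrAC; exact: (hdegZ conn).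
Defined.

Lemma hdeg_lmul n i (p q : R) : Rdeg i p -> hdeg gr n q -> hdeg gr (n + i%:Z) (p * q : R).
Proof.
case: n => [n|n] /= dp dq; first by rewrite addnC; exact: la_degM.
by rewrite (dq : q = 0) mulr0; exact: hdeg0 conn _.
Qed.

(** Left multiplication by r_x, onto r_x R with its generator moved to degree
    0. *)
Definition rgmap x : gmap (greg conn) (gshift 1 (Jmod (pred1 x))).
Proof.
refine (@GMap _ _ (greg conn) (gshift 1 (Jmod (pred1 x)))
  (fun _ u => rg x * u : R) _ _ _).
- move=> n u du; split; first exact: (hdeg_lmul (la_gen_deg x) du).
  by rewrite big_pred1_eq la_rho_gen eqxx.
- by move=> n u v _ _; exact: (mulrBr (rg x) (u : R) (v : R)).
- by move=> n i a u _ _; exact: (mulrA (rg x) (u : R) (a : R)).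
Defined.

Definition annmod x := gker (rgmap x).

Lemma rgmap_surj x : gsurj (rgmap x).
Proof.
move=> n u [du uE]; rewrite big_pred1_eq in uE.
case: n du => [n|[|n]] /=.
- by rewrite addn1 => /(la_factor_deg x) [q dq uq]; exists q; rewrite // uE.
- move=> /la_deg0P [c uc]; exists 0; first by [].
  by rewrite mulr0 uE uc la_rho_scalar.
- by move=> u0; exists 0; rewrite // mulr0 (u0 : u = 0).
Qed.

(** R covers r_x R with kernel the annihilator of r_x. *)
Lemma reg_Jpred1 n x : reg n 1 (annmod x) -> reg n.+1 1 (Jmod (pred1 x)).
Proof.
move=> rA; have [pB gB] := greg_proj conn.
have rS : reg n.+1 0 (gshift 1 (Jmod (pred1 x))).
  by exists (greg conn), (rgmap x); split=> //; exact: rgmap_surj.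
have := reg_shift (- 1) rS; rewrite opprK add0r.
apply: (@reg_iso_lin _ _ _ _ (gshift (-1) (gshift 1 (Jmod (pred1 x))))
  (Jmod (pred1 x)) idfun) => //.
  by move=> m u; rewrite /= subrK.
by move=> m u mu; exists u; rewrite //= subrK.
Qed.

Lemma reg_annmod n x : reg n.+1 1 (Jmod (pred1 x)) -> reg n 1 (annmod x).
Proof.
move=> rJ; have [pB gB] := greg_proj conn.
have := reg_shift 1 rJ; rewrite subrr => rS.
have := reg_kernel (@rgmap_surj x) _ rS; apply.
by apply: reg_gproj => //; apply: gen_le_mono gB.
Qed.

Lemma proj_id Q (p : R) : rho^~ (\sum_(z | Q z) rho z p) =1
  (fun y => if Q y then rho y p else 0).
Proof.
move=> y; rewrite raddf_sum; case: ifPn => Qy.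
  rewrite (bigD1 y) //= la_rho_rho eqxx big1 ?addr0 // => z /andP[_ /negPf zy].
  by rewrite la_rho_rho zy.
rewrite big1 // => z Qz; rewrite /= la_rho_rho; case: eqP => // zy.
by rewrite -zy Qz in Qy.
Qed.

Lemma proj_deg Q n (u : B) : hdeg gr n u -> hdeg gr n (\sum_(z | Q z) rho z u : R).
Proof.
case: n => n /= du; first by apply: la_deg_sum => z _; exact: la_rho_deg.
by apply: big1 => z _; rewrite (du : u = 0) raddf0.
Qed.

Lemma proj_Jdeg Q n (u : B) : hdeg gr n u ->
  gdeg n ((\sum_(z | Q z) rho z u : R) : Jmod Q).
Proof.
move=> du; split; first exact: proj_deg.
by apply: eq_bigr => y Qy; rewrite proj_id Qy.
Qed.

Definition projmap (M : gmod gr) Q (f : {linear M -> B^o})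
    (fd : forall n u, gdeg n u -> hdeg gr n (f u))
    (fe : forall n u, gdeg n u -> eps (f u : R) = 0) : gmap M (Jmod Q).
Proof.
refine (@GMap _ _ M (Jmod Q) (fun _ u => \sum_(z | Q z) rho z (f u) : R) _ _ _).
- by move=> n u /fd; exact: proj_Jdeg.
- move=> n u v _ _; rewrite raddfB -sumrB; apply: eq_bigr => z _.
  exact: (raddfB (rho z)).
- move=> n i a u ga du; rewrite linearZ_LR.
  rewrite !actE mulr_suml.
  by apply: eq_bigr => z _; rewrite -la_rho_act //; exact: (fe n).
Defined.

Lemma Jmod_hdeg Q n u : gdeg n (u : Jmod Q) -> hdeg gr n (u : B).
Proof. by case. Qed.
Lemma Jmod_eps Q n u : gdeg n (u : Jmod Q) -> eps (u : R) = 0.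
Proof. by move=> [_ /eps_of_rho]. Qed.

Definition Jproj Q Q' : gmap (Jmod Q) (Jmod Q') :=
  @projmap (Jmod Q) Q' idfun (@Jmod_hdeg Q) (@Jmod_eps Q).

Lemma Jmod_sub Q Q' n u : subpred Q Q' -> gdeg n (u : Jmod Q) -> gdeg n (u : Jmod Q').
Proof.
move=> sub [du uE]; split=> //; rewrite {1}uE [RHS](bigID Q) /= [X in _ + X]big1 ?addr0.
  by apply: eq_bigl => z; case: (boolP (Q z)) => [/sub->|]; rewrite ?andbF.
by move=> z /andP[_ nQz]; rewrite uE proj_id (negPf nQz).
Qed.

Lemma reg_J_pred1 n c Q z : Q z -> reg n c (Jmod Q) -> reg n c (Jmod (pred1 z)).
Proof.
move=> Qz; apply: (@reg_retract _ _ _ _ _ _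
  (@glin _ _ (Jmod (pred1 z)) (Jmod Q) idfun _) (Jproj Q (pred1 z))).
  by move=> m u; apply: Jmod_sub => y /eqP ->.
by move=> sub m u [_ uE]; rewrite /= -uE.
Qed.

Lemma reg_J_eq n c Q Q' : Q =1 Q' -> reg n c (Jmod Q) -> reg n c (Jmod Q').
Proof.
move=> QE; apply: (@reg_iso_lin _ _ _ _ (Jmod Q) (Jmod Q') idfun) => //.
  by move=> m u; apply: Jmod_sub => y; rewrite QE.
by move=> m u du; exists u => //; apply: Jmod_sub du => y; rewrite QE.
Qed.

(** A finite direct sum is peeled off one letter at a time by [reg_extension]. *)
Lemma reg_J n c Q : (forall z, Q z -> reg n c (Jmod (pred1 z))) -> reg n c (Jmod Q).
Proof.
move=> rQ; pose s := enum Q.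
have : {subset s <= Q} by move=> z; rewrite mem_enum.
have : reg n c (Jmod (fun y => y \in s)) -> reg n c (Jmod Q).
  by apply: reg_J_eq => z; rewrite mem_enum.
move=> + sub; apply.
elim: s (enum_uniq Q : uniq s) sub => [_ _|z s IH /= /andP[zs us] sub].
  by apply: reg_zero => m u [_ ->]; exact: big_pred0.
have zQ : reg n c (Jmod (pred1 z)) by apply: rQ; apply: sub; rewrite inE eqxx.
pose p := Jproj (fun y => y \in z :: s) (pred1 z).
apply: (@reg_extension _ _ _ _ _ _ p) => //.
  move=> m u du; exists u; last by case: du => _ uE; rewrite /= -uE.
  by apply: Jmod_sub du => y /eqP ->; rewrite inE eqxx.
have rs : reg n c (Jmod (fun y => y \in s)).
  by apply: IH => // y ys; apply: sub; rewrite inE ys orbT.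
apply: (@reg_iso_lin _ _ _ _ (Jmod (fun y => y \in s)) (gker p) idfun) rs => //.
  move=> m u du; split; first by apply: Jmod_sub du => y; rewrite inE => ->; rewrite orbT.
  by case: du => _ uE; rewrite /= big_pred1_eq uE proj_id (negPf zs).
move=> m u [[du uE] u0]; exists u => //; split=> //.
move: u0; rewrite /= big_pred1_eq => u0.
rewrite {1}uE (bigD1 z) /= ?inE ?eqxx // u0 add0r; apply: eq_bigl => y.
by rewrite inE andbC; case: eqP => [->|]; rewrite //= (negPf zs).
Qed.

Lemma eps_ann x (p : R) : rg x * p = 0 -> eps p = 0.
Proof.
move=> /la_ann [b [b0 ->]]; rewrite rmorphD rmorph_sum rmorphM /= la_eps_sum mul0r addr0.
by apply: big1 => y _; rewrite rmorphM /= la_eps_gen mul0r.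
Qed.

Lemma annmod_hdeg x n u : gdeg n (u : annmod x) -> hdeg gr n (u : B).
Proof. by case. Qed.
Lemma annmod_eps x n u : gdeg n (u : annmod x) -> eps (u : R) = 0.
Proof. by move=> [_ /eps_ann]. Qed.

(** Projecting u = sum r_z b_z + r_x(1) b to the letters in S_x(1) kills the first
    sum, as z runs outside S_x(1).  The element b need not be homogeneous, and is
    replaced by its component of degree n - 1. *)
Lemma ann_decomp x n (u : R) : hdeg gr n u -> rg x * u = 0 ->
  exists2 v : R, hdeg gr (n - 1) v & \sum_(z | below1 x z) rho z u = rg1 x * v.
Proof.
move=> du /la_ann [b [b0 uE]].
have sE : \sum_(z | below1 x z) rho z u = rg1 x * b0.
  have -> : \sum_(z | below1 x z) rho z u = \sum_(z | below1 x z) rho z (rg1 x * b0).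
    apply: eq_bigr => z xz; rewrite {1}uE raddfD raddf_sum /= big1 ?add0r // => y nxy.
    by rewrite la_rho_gen; case: eqP => // yz; rewrite -yz in xz; rewrite xz in nxy.
  rewrite [RHS](la_decomp) rmorphM /= la_eps_sum mul0r scale0r add0r.
  rewrite [RHS](bigID (below1 x)) /= [X in _ + X]big1 ?addr0 // => z nxz.
  exact: la_rho_sum.
case: n du => [n|n] du; last first.
  exists 0; first exact: hdeg0 conn _.
  by rewrite mulr0 big1 // => z _; rewrite (du : u = 0) raddf0.
pose grB : @is_grading B gr := la_grading; pose M := grmod_reg conn grB.
exists (hcomp grB (n%:Z - 1) b0); first exact: (hcomp_deg grB).
have dS : mdeg n (rg1 x * b0 : M) by rewrite -sE; exact: (proj_deg _ (n := n) du).
have := component_scale grB n (b0 : B) (la_sum_deg x : mdeg 1 (rg1 x : M)).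
rewrite (component_homog (mdeg_grading M) dS) eqxx => sE'.
by rewrite sE; exact: sE'.
Qed.

Lemma ann_split x (u : R) : rg x * u = 0 ->
  u = \sum_(z | ~~ below1 x z) rho z u + \sum_(z | below1 x z) rho z u.
Proof.
move=> /eps_ann u0; rewrite {1}[u]la_decomp u0 scale0r add0r (bigID (below1 x)) addrC.
by [].
Qed.

Lemma smod_ann x n u : gdeg n (u : smod x) -> gdeg n (u : annmod x).
Proof.
move=> [v dv uE]; split.
  by rewrite uE -[n](subrK 1); exact: hdeg_lmul (la_sum_deg x) dv.
by rewrite /= uE mulrA la_mul_sum mul0r.
Qed.

(** The annihilator of r_x maps onto the sum of the r_z R with z outside S_x(1),
    with kernel r_x(1) R. *)
Lemma reg_ann_of_smod n c x : reg n c (smod x) ->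
  reg n c (Jmod (fun z => ~~ below1 x z)) -> reg n c (annmod x).
Proof.
move=> rs rJ.
pose p := @projmap (annmod x) (fun z => ~~ below1 x z) idfun
  (@annmod_hdeg x) (@annmod_eps x).
apply: (@reg_extension _ _ _ _ _ _ p) => //.
  move=> n' u [du uE]; exists u; last by rewrite /= -uE.
  split=> //=; rewrite uE mulr_sumr big1 // => z nxz.
  by have [q ->] := la_factor z (u : R); rewrite mulrA la_mul0 ?mul0r.
apply: (@reg_iso_lin _ _ _ _ (smod x) (gker p) idfun) rs => //.
  move=> m u du; split; first exact: smod_ann.
  case: du => v _ uE; rewrite /= big1 // => z nxz.
  by rewrite uE la_rho_sum.
move=> m u [[du xu] pu]; exists u => //.
have [v dv vE] := ann_decomp du xu; exists v => //.
by rewrite -vE [LHS](ann_split xu) -[RHS]add0r; congr (_ + _).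
Qed.

Lemma reg_smod_of_ann n c x : reg n c (annmod x) -> reg n c (smod x).
Proof.
have rdeg m u : gdeg m (u : annmod x) ->
    gdeg m ((\sum_(z | below1 x z) rho z u : R) : smod x).
  by move=> [du xu]; have [v dv ->] := ann_decomp du xu; exists v.
have rB m u v : gdeg m (u : annmod x) -> gdeg m (v : annmod x) ->
    \sum_(z | below1 x z) rho z (u - v) = \sum_(z | below1 x z) rho z u -
      \sum_(z | below1 x z) rho z v :> smod x.
  by move=> _ _; rewrite -sumrB; apply: eq_bigr => z _; exact: (raddfB (rho z)).
have rZ m i a u : gr i a -> gdeg m (u : annmod x) ->
    \sum_(z | below1 x z) rho z (a *: u) =
    a *: ((\sum_(z | below1 x z) rho z u : R) : smod x).
  move=> _ du; rewrite !actE mulr_suml.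
  by apply: eq_bigr => z _; rewrite -la_rho_act //; exact: annmod_eps du.
apply: (@reg_retract _ _ _ _ _ _
  (@glin _ _ (smod x) (annmod x) idfun (@smod_ann x))
  (@GMap _ _ (annmod x) (smod x) (fun _ u => \sum_(z | below1 x z) rho z u) rdeg rB rZ)).
move=> m u du /=; have [_ xu] := smod_ann du.
rewrite [RHS](ann_split xu) [X in _ = X + _]big1 ?add0r // => z nxz.
by case: du => v _ ->; rewrite la_rho_sum.
Qed.

Lemma reg_gplus n : reg n 1 (gplus conn) <-> reg n 1 (Jmod predT).
Proof.
have E (m : int) (u : R) : hdeg gr m u ->
    (m <= 0 -> u = 0) <-> u = \sum_z rho z u.
  move=> du; have := la_decomp u; case: m du => [[|m]|m] du.
  - move=> uE; split=> [/(_ isT) u0|{}uE _].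
      by rewrite {1}u0 big1 // => z _; rewrite u0 raddf0.
    have [c uc] := (proj1 (la_deg0P u)) du.
    by rewrite uE big1 // => z _; rewrite uc la_rho_scalar.
  - by rewrite (la_eps_deg du) scale0r add0r.
  - by rewrite (du : u = 0) => _; split=> // _; rewrite big1 // => z _; rewrite raddf0.
split.
  apply: (@reg_iso_lin _ _ _ _ (gplus conn) (Jmod predT) idfun) => //.
    by move=> m u [du /(E _ _ du)].
  by move=> m u [du /(E _ _ du)]; exists u.
apply: (@reg_iso_lin _ _ _ _ (Jmod predT) (gplus conn) idfun) => //.
  by move=> m u [du /(E _ _ du)].
by move=> m u [du /(E _ _ du)]; exists u.
Qed.

End LetterModules.

(** * Restriction to a closed set of letters *)
Lemma Koszul_Jmod (F : fieldType) (L : letter_algebra F) :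
  Koszul L (@la_deg F L) <-> forall n, reg n 1 (Jmod (L := L) predT).
Proof.
have K := @Koszul_reg F L (@la_deg F L) (la_conn L) (la_eps L) (@la_gen1 F L)
  (conv_fdim (la_conn L) (@la_fdim F L)) (@la_epsA F L) (@la_eps_deg F L).
by split=> [/K rL n|rL]; [apply/reg_gplus | apply/K => n; apply/reg_gplus].
Qed.

(** L' is the algebra of a set of letters of L which is closed under [la_next]:
    it is a quotient of L by the other letters, and also a subalgebra. *)
Record restriction (F : fieldType) (L L' : letter_algebra F) := Restriction {
  res_phi : {rmorphism L -> L'};
  res_iota : {rmorphism L' -> L};
  res_let : la_let L' -> la_let L;
  res_phi_deg : forall n u, la_deg n u -> la_deg n (res_phi u);
  res_iota_deg : forall n u, la_deg n u -> la_deg n (res_iota u);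
  res_iotaK : forall v, res_phi (res_iota v) = v;
  res_eps : forall u, la_eps L' (res_phi u) = la_eps L u;
  res_gen : forall y, res_iota (res_phi (la_gen (res_let y))) = la_gen (res_let y);
  res_kill : forall z, z \notin codom res_let -> res_phi (la_gen z) = 0;
  res_local : forall y u,
    la_gen (res_let y) * u = la_gen (res_let y) * res_iota (res_phi u);
  res_sum : forall y, res_phi (la_sum (res_let y)) = la_sum y;
  res_closed : forall y z, la_next (res_let y) z -> z \in codom res_let
}.

Section Restriction.
Variables (F : fieldType) (L L' : letter_algebra F) (res : restriction L L').
Local Notation phi := (res_phi res).
Local Notation iota := (res_iota res).
Local Notation j := (res_let res).
Local Notation B := (L^c).
Local Notation B' := (L'^c).
Local Notation gr := (@la_deg F L : nat -> B -> Prop).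
Local Notation gr' := (@la_deg F L' : nat -> B' -> Prop).
Local Notation conn := (conv_connected (la_conn L)).
Local Notation conn' := (conv_connected (la_conn L')).
Definition outside : pred (la_let L) := fun z => z \notin codom j.

Definition cphi : B -> B' := phi.
Fact cphi_zmod : zmod_morphism cphi.
Proof. by move=> u v; exact: (raddfB phi u v). Qed.
Fact cphi_monoid : monoid_morphism cphi.
Proof. by split=> [|u v]; [exact: (rmorph1 phi) | exact: (rmorphM phi v u)]. Qed.
HB.instance Definition _ := GRing.isZmodMorphism.Build B B' cphi cphi_zmod.
HB.instance Definition _ := GRing.isMonoidMorphism.Build B B' cphi cphi_monoid.

Lemma cphi_deg i (a : B) : gr i a -> gr' i (cphi a).
Proof. exact: res_phi_deg. Qed.

Local Notation gres := (gres cphi_deg).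

Lemma phi_rho_outside z (u : L) : outside z -> phi (la_rho z u) = 0.
Proof.
by move=> oz; have [q ->] := la_factor z u; rewrite rmorphM /= res_kill // mul0r.
Qed.

Lemma rho_inside z (u : L) : ~~ outside z -> la_rho z u = iota (phi (la_rho z u)).
Proof.
rewrite negbK => /codomP [y ->]; have [q ->] := la_factor (j y) u.
by rewrite !rmorphM /= res_gen -res_local.
Qed.

(** The part of u that begins with letters of L' is recovered from its image. *)
Lemma ker_phi (u : L) : phi u = 0 <-> u = \sum_(z | outside z) la_rho z u.
Proof.
split=> [u0|->]; last first.
  by rewrite rmorph_sum big1 // => z oz; exact: phi_rho_outside.
have := la_decomp u; rewrite -(res_eps res) u0 rmorph0 scale0r add0r.
rewrite (bigID outside) /= => uE; rewrite {1}uE -[RHS]addr0; congr (_ + _).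
rewrite (eq_bigr _ (fun z oz => rho_inside u oz)) -[RHS](rmorph0 iota) -rmorph_sum.
rewrite -[in RHS]u0 {2}uE; congr (iota _); rewrite rmorphD /= !rmorph_sum /=.
rewrite [X in _ = X + _]big1 ?add0r // => z oz; exact: phi_rho_outside.
Qed.

Lemma sum_inside y (u : L) :
  la_sum (j y) * u = iota (phi (la_sum (j y))) * iota (phi u).
Proof.
case: (la_sumE (j y)) => ->; first by rewrite !rmorph0 !mul0r.
rewrite !rmorph_sum !mulr_suml.
apply: eq_bigr => z /(res_closed (r := res)) /codomP [y' ->].
by rewrite /= res_gen -res_local.
Qed.

(** L covers L' with kernel the sum of the right ideals of the other letters. *)
Lemma reg_phi n : reg n 1 (Jmod (L := L) outside) -> reg n.+1 0 (gres (greg conn')).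
Proof.
move=> rJ; have [pB gB] := greg_proj conn.
have dphi m u : gdeg m (u : greg conn) -> gdeg m (cphi u : gres (greg conn')).
  by case: m => m /=; [exact: res_phi_deg | move=> ->; exact: (rmorph0 cphi)].
pose p := @GMap _ _ (greg conn) (gres (greg conn')) (fun _ => cphi) dphi
  (fun _ u v _ _ => raddfB phi u v) (fun _ _ a u _ _ => rmorphM phi u a).
exists (greg conn), p; split=> //.
  move=> m v dv; exists (iota v); last exact: res_iotaK.
  by case: m dv => m /=; [exact: res_iota_deg | move=> ->; exact: (rmorph0 iota)].
apply: (@reg_iso_lin _ _ _ _ (Jmod (L := L) outside) (gker p) idfun) rJ => //.
  by move=> m u [du /ker_phi uE].
by move=> m u [du /ker_phi uE]; exists u.
Qed.

Lemma smod_iso y : exists f : gmap (smod (j y)) (gres (smod y)), ginj f /\ gsurj f.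
Proof.
have dphi m u : gdeg m (u : smod (j y)) -> gdeg m (cphi u : gres (smod y)).
  move=> [v dv ->]; exists (phi v); last first.
    by rewrite /cphi (rmorphM phi) -(res_sum res).
  by case: (m - 1) dv => k /=; [exact: res_phi_deg | move=> ->; exact: (rmorph0 phi)].
exists (@GMap _ _ (smod (j y)) (gres (smod y)) (fun _ => cphi) dphi
  (fun _ u v _ _ => raddfB phi u v) (fun _ _ a u _ _ => rmorphM phi u a)); split.
  move=> m u [v _ uE] phiu; rewrite uE sum_inside -rmorphM -rmorphM -uE.
  by rewrite [X in iota X]phiu rmorph0.
move=> m u [v dv uE]; exists (la_sum (j y) * iota v).
  exists (iota v) => //.
  by case: (m - 1) dv => k /=; [exact: res_iota_deg | move=> ->; exact: (rmorph0 iota)].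
by rewrite uE /= /cphi (rmorphM phi) res_iotaK (res_sum res).
Qed.

End Restriction.

Lemma smod_low (F : fieldType) (M : letter_algebra F) (y : la_let M) (n : int) u :
  n < 1 -> gdeg n (u : smod y) -> u = 0.
Proof.
move=> lt_n [v dv uE]; have := dv; case E: (n - 1) => [k|k] /=; first lia.
by move=> v0; rewrite uE v0; exact: (mulr0 (la_sum y)).
Qed.

Lemma smod_fdim (F : fieldType) (M : letter_algebra F) (y : la_let M) :
  fdim (@csc F M) (smod y).
Proof.
move=> n; have [T [w wP]] := conv_fdim (la_conn M) (@la_fdim F M) n.
exists T, w => u [v dv uE]; apply: wP; rewrite uE -[n](subrK 1).
exact: (hdeg_lmul (la_sum_deg y) dv).
Qed.

(** The annihilator of r_x is a sum of right ideals of letters and of r_x(1) R,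
    so n steps for all letters give n + 1 steps for each of them. *)
Lemma reg_letters (F : fieldType) (L : letter_algebra F) :
    (forall n x, reg n 1 (smod (L := L) x)) ->
  forall n x, reg n 1 (Jmod (L := L) (pred1 x)).
Proof.
move=> rs; elim=> [//|n IH] x; apply: reg_Jpred1; apply: reg_ann_of_smod => //.
by apply: reg_J.
Qed.

Lemma Koszul_letters (F : fieldType) (L : letter_algebra F) :
  Koszul L (@la_deg F L) -> forall n x, reg n 1 (Jmod (L := L) (pred1 x)).
Proof. by move=> /Koszul_Jmod rL n x; apply: reg_J_pred1 (rL n). Qed.

(** The right ideal r_x(1) R is a direct summand of the annihilator of r_x, which
    is regular as the kernel of R -> r_x R. *)
Lemma Koszul_smod (F : fieldType) (L : letter_algebra F) :
  Koszul L (@la_deg F L) -> forall n x, reg n 1 (smod (L := L) x).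
Proof.
move=> /Koszul_letters rL n x; apply: reg_smod_of_ann; apply: reg_annmod.
exact: rL.
Qed.

Lemma Koszul_restriction (F : fieldType) (L L' : letter_algebra F) :
  restriction L L' -> Koszul L (@la_deg F L) -> Koszul L' (@la_deg F L').
Proof.
move=> res KL; apply/Koszul_Jmod => n; apply: reg_J => x _; apply: reg_letters.
move=> {n x} n y.
have rS k : reg k 0 (gres (@cphi_deg F L L' res) (greg (conv_connected (la_conn L')))).
  by apply/reg_pred/reg_phi/reg_J => z _; exact: Koszul_letters.
apply: (reg_ascent (conv_fdim (la_conn L') (@la_fdim F L')) n rS).
- exact: smod_fdim.
- by move=> k u; exact: smod_low.
move=> k; have [f [fi fs]] := smod_iso res y.
by apply: (reg_iso fi fs); exact: Koszul_smod.
Qed.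

Lemma Koszul_extension (F : fieldType) (L : letter_algebra F) :
    (forall x : la_let L, exists (L' : letter_algebra F) (res : restriction L L'),
       x \in codom (res_let res) /\ Koszul L' (@la_deg F L')) ->
  Koszul L (@la_deg F L).
Proof.
move=> H; apply/Koszul_Jmod => n; apply: reg_J => x _.
elim: n x => [//|n IH] x; have [L' [res [/codomP [y ->] KL']]] := H x.
apply: reg_Jpred1; apply: reg_ann_of_smod; last by apply: reg_J => z _; exact: IH.
have rS : reg n.+1 0 (gres (@cphi_deg F L L' res) (greg (conv_connected (la_conn L')))).
  by apply/reg_phi/reg_J => z _; exact: IH.
have [f [fi fs]] := smod_iso res y; apply: (reg_isoV fi fs).
apply: (reg_descent (conv_fdim (la_conn L') (@la_fdim F L')) rS) => //.
- exact: smod_fdim.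
- by move=> k u; exact: smod_low.
exact: Koszul_smod.
Qed.

(** * Left derivations of a presented algebra *)
Lemma mul_polyCXn (S : nzRingType) (p q : S) m n :
  (p%:P * 'X^m) * (q%:P * 'X^n) = (p * q)%:P * 'X^(m + n).
Proof.
rewrite -mulrA (mulrA 'X^m) -(commr_polyXn q%:P m) !mulrA -polyCM -mulrA.
by rewrite -exprD.
Qed.

Lemma polyCXn_linear (F : fieldType) (A : algType F) n c (p q : A) :
  (c *: p + q)%:P * 'X^n = (c%:A)%:P * (p%:P * 'X^n) + q%:P * 'X^n.
Proof. by rewrite polyCD mulrDl mulrA -polyCM -scalerAl mul1r. Qed.

Lemma scale_combine (F : fieldType) (V : lmodType F) (c a b : F) (w x y : V) :
  c *: (a *: w + x) + (b *: w + y) = (c * a + b) *: w + (c *: x + y).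
Proof. by rewrite scalerDl scalerDr scalerA addrACA. Qed.

Lemma sum_combine (F : fieldType) (V : lmodType F) (I : finType) (c : F) (a b : I -> V) :
  \sum_i (c *: a i + b i) = c *: (\sum_i a i) + \sum_i b i.
Proof. by rewrite big_split -scaler_sumr. Qed.

Lemma scaler_sum_linear (F : fieldType) (V : lmodType F) (I : finType) (c : F)
    (a b : I -> F) (w : I -> V) :
  c *: (\sum_i a i *: w i) + \sum_i b i *: w i = \sum_i (c * a i + b i) *: w i.
Proof.
rewrite scaler_sumr -big_split; apply: eq_bigr => i _.
by rewrite scalerDl scalerA.
Qed.

Lemma sum_indicator (F : fieldType) (V : lmodType F) (I : finType) (i : I) (w : I -> V) :
  w i = \sum_j (j == i)%:R *: w j.
Proof.
rewrite (bigD1 i) //= eqxx scale1r big1 ?addr0 // => j /negPf ->.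
exact: scale0r.
Qed.

Section RightSpan.
Variables (F : fieldType) (A : algType F) (X : finType) (P : pred X) (g : X -> A) (s : A).

Definition right_span (u : A) : Prop :=
  exists (b : X -> A) (b0 : A), u = \sum_(y | P y) g y * b y + s * b0.

Lemma right_span0 : right_span 0.
Proof. by exists (fun=> 0), 0; rewrite mulr0 addr0 big1 // => y _; rewrite mulr0. Qed.

Lemma right_spanD u v : right_span u -> right_span v -> right_span (u + v).
Proof.
move=> [b [b0 ->]] [c [c0 ->]]; exists (fun y => b y + c y), (b0 + c0).
rewrite addrACA mulrDr -big_split; congr (_ + _).
by apply: eq_bigr => y _; rewrite mulrDr.
Qed.

Lemma right_spanZ c u : right_span u -> right_span (c *: u).
Proof.
move=> [b [b0 ->]]; exists (fun y => c *: b y), (c *: b0).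
rewrite scalerDr scalerAr scaler_sumr; congr (_ + _).
by apply: eq_bigr => y _; rewrite scalerAr.
Qed.

Lemma right_span_gen y u : P y -> right_span (g y * u).
Proof.
move=> Py; exists (fun z => if z == y then u else 0), 0.
rewrite mulr0 addr0 (bigD1 y) //= eqxx big1 ?addr0 // => z /andP[_ /negPf ->].
by rewrite mulr0.
Qed.

Lemma right_span_extra u : right_span (s * u).
Proof. by exists (fun=> 0), u; rewrite big1 ?add0r // => y _; rewrite mulr0. Qed.

Lemma right_span_kill a u : (forall y, P y -> a * g y = 0) -> a * s = 0 ->
  right_span u -> a * u = 0.
Proof.
move=> ag as0 [b [b0 ->]]; rewrite mulrDr mulrA as0 mul0r addr0 mulr_sumr big1 // => y Py.
by rewrite mulrA ag ?mul0r.
Qed.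

End RightSpan.

(** T stands for the tensor algebra and R for its quotient by relations which are
    products of a letter g x by something linear.  The derivation del x deletes an
    initial letter x, and kills the words that begin with another letter. *)
Section LeftDerivations.
Variables (F : fieldType) (T : lalgType F) (R : algType F) (X : finType) (next : rel X).
Variables (pi : {rmorphism T -> R}) (Rel : T -> Prop) (g s : X -> T).
Hypothesis piZ : forall c u, pi (c *: u) = c *: pi u.
Hypothesis pi_surj : forall p, exists u, p = pi u.
Hypothesis pi0 : forall u, pi u = 0 <-> ideal_gen Rel u.
Hypothesis RelP : forall r, Rel r ->
  (exists x y, ~~ next x y /\ r = g x * g y) \/ exists x, r = g x * s x.
Hypothesis pi_mul0 : forall x y, ~~ next x y -> pi (g x) * pi (g y) = 0.
Hypothesis pi_mul_sum : forall x, pi (g x) * pi (s x) = 0.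
Variables (e : T -> F) (eps : {rmorphism R -> F}) (del : X -> T -> T).
Hypothesis eps_piE : forall u, eps (pi u) = e u.
Hypothesis delP : forall x c u v, del x (c *: u + v) = c *: del x u + del x v.
Hypothesis del_g : forall x y u, del x (g y * u) = if y == x then u else 0.
Hypothesis del_mul : forall x u v, del x (u * v) = del x u * v + e u *: del x v.
Hypothesis del_decomp : forall u, u = e u *: 1 + \sum_x g x * del x u.

Local Notation gp := (fun x => pi (g x)).
Local Notation ann_span x := (right_span (fun y => ~~ next x y) gp (pi (s x))).

Let del0 x : del x 0 = 0.
Proof.
have := delP x 1 0 0; rewrite !scale1r addr0 => /esym/(canRL (addrK _)).
by rewrite subrr.
Qed.

Let delB x u v : del x (u - v) = del x u - del x v.
Proof. by rewrite addrC -scaleN1r delP scaleN1r addrC. Qed.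

(** Deleting the first letter of a multiple a r b of a relation leaves a multiple
    of r, unless a is a scalar; then only the second factor of r remains, and it
    is in the right ideal generated by the elements that r_x kills. *)
Lemma del_ideal x u : ideal_gen Rel u -> ann_span x (pi (del x u)).
Proof.
elim=> [|a r b w Rr Iw IH]; first by rewrite del0 rmorph0; exact: right_span0.
have -> : pi (del x (a * r * b + w)) = e a *: pi (del x (r * b)) + pi (del x w).
  have rb0 : pi (r * b) = 0.
    by apply/pi0; have := ideal_genD 1 b Rr (ideal_gen0 _); rewrite mul1r addr0.
  rewrite -[a * r * b]scale1r delP scale1r -mulrA del_mul !rmorphD rmorphM /= rb0.
  by rewrite mulr0 add0r piZ.
apply: right_spanD => //; apply: right_spanZ.
have [[y [z [nyz ->]]]|[y ->]] := RelP Rr; rewrite -mulrA del_g; case: eqP => [yx|_].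
- by rewrite rmorphM; apply: (right_span_gen gp); rewrite -yx.
- by rewrite rmorph0; exact: right_span0.
- by rewrite yx rmorphM; exact: right_span_extra.
- by rewrite rmorph0; exact: right_span0.
Qed.

Lemma span_ann x p : ann_span x p -> pi (g x) * p = 0.
Proof. by apply: right_span_kill => [y|]; [exact: pi_mul0 | exact: pi_mul_sum]. Qed.

Lemma ann_del x p : pi (g x) * p = 0 -> ann_span x p.
Proof.
have [u ->] := pi_surj p; rewrite -rmorphM => /pi0 /(del_ideal x).
by rewrite del_g eqxx.
Qed.

(** The projection to g x R: delete the first letter x, then put it back.  It is
    computed on a representative in T. *)
Definition lead (x : X) (p : R) : R := pi (g x) * pi (del x (sval (cid (pi_surj p)))).

(** By [del_ideal] the ambiguity of the representative is killed by g x. *)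
Lemma leadE x u : lead x (pi u) = pi (g x) * pi (del x u).
Proof.
apply/eqP; rewrite -subr_eq0 -mulrBr -rmorphB -delB; apply/eqP/span_ann/del_ideal/pi0.
by rewrite rmorphB /= -(svalP (cid (pi_surj (pi u)))) subrr.
Qed.

Fact lead_linear x : linear (lead x).
Proof.
move=> c p q; have [u ->] := pi_surj p; have [v ->] := pi_surj q.
by rewrite -piZ -rmorphD !leadE delP rmorphD piZ mulrDr scalerAr.
Qed.
HB.instance Definition _ x := GRing.isLinear.Build F R R _ (lead x) (lead_linear x).

Lemma lead_act x p q : eps p = 0 -> lead x (p * q) = lead x p * q.
Proof.
have [u ->] := pi_surj p; have [v ->] := pi_surj q; rewrite eps_piE => u0.
by rewrite -rmorphM !leadE del_mul u0 scale0r addr0 rmorphM mulrA.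
Qed.

Lemma lead_gen x y p : lead x (pi (g y) * p) = if y == x then pi (g y) * p else 0.
Proof.
have [u ->] := pi_surj p; rewrite -rmorphM leadE del_g.
by case: eqP => [->|_]; rewrite ?rmorphM // rmorph0 mulr0.
Qed.

Lemma lead1 x : lead x 1 = 0.
Proof.
have e1 : e 1 = 1 by rewrite -eps_piE !rmorph1.
have := del_mul x 1 1; rewrite !mulr1 e1 scale1r => /esym/(canRL (addrK _)).
by rewrite subrr -(rmorph1 pi) leadE => ->; rewrite rmorph0 mulr0.
Qed.

Lemma lead_decomp p : p = (eps p)%:A + \sum_x lead x p.
Proof.
have [u ->] := pi_surj p; rewrite {1}(del_decomp u) eps_piE rmorphD piZ rmorph1.
by rewrite rmorph_sum; congr (_ + _); apply: eq_bigr => x _; rewrite leadE rmorphM.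
Qed.

Lemma lead_factor x p : exists q, lead x p = pi (g x) * q.
Proof. by eexists. Qed.

Variable deg : nat -> R -> Prop.
Hypothesis deg_conn : connected_graded deg.
Hypothesis deg_gen1 : generated_in_degree_1 deg.
Hypothesis deg_fdim : forall n, exists (I : finType) (w : I -> R),
  forall u, deg n u -> exists c : I -> F, u = \sum_i c i *: w i.
Hypothesis eps_scalar : forall c, eps c%:A = c.
Hypothesis eps_pos : forall n u, deg n.+1 u -> eps u = 0.
Hypothesis deg_g : forall x, deg 1 (pi (g x)).
Hypothesis pi_sE : forall x,
  pi (s x) = 0 \/ pi (s x) = \sum_(y | next x y) pi (g y).
Hypothesis deg_ind : forall n (P : R -> Prop), P 0 ->
    (forall c u v, P u -> P v -> P (c *: u + v)) ->
    (forall t, size t = n -> P (\prod_(x <- t) pi (g x))) ->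
  forall p, deg n p -> P p.

Let deg_word t : deg (size t) (\prod_(x <- t) pi (g x)).
Proof.
have [_ _ degM deg0P] := deg_conn; elim: t => [|x t IH].
  by rewrite big_nil; apply/deg0P; exists 1; rewrite scale1r.
by rewrite big_cons /= -add1n; apply: degM.
Qed.

Lemma lead_factor_deg x n p : deg n.+1 p ->
  exists2 q, deg n q & lead x p = pi (g x) * q.
Proof.
have [[deg0 degB _ _] degZ _ _] := deg_conn.
move: p; apply: (@deg_ind n.+1 (fun p => exists2 q, deg n q & lead x p = pi (g x) * q)) =>
  [|c u v [a da uE] [b db vE]|[//|y t] [tn]].
- by exists 0; [exact: deg0 | rewrite raddf0 mulr0].
- exists (c *: a + b); last by rewrite linearP /= uE vE mulrDr scalerAr.
  rewrite -[b]opprK; apply: (degB); first exact: degZ.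
  by rewrite -scaleN1r; exact: degZ.
rewrite big_cons lead_gen; case: eqP => [->|_].
  by exists (\prod_(x <- t) pi (g x)); [rewrite -tn; exact: deg_word|].
by exists 0; [exact: deg0 | rewrite mulr0].
Qed.

Definition derived_letters : letter_algebra F :=
  @LetterAlgebra F R deg deg_conn deg_gen1 X gp next (fun x => pi (s x)) eps
    (fun x => lead x) deg_fdim eps_scalar eps_pos deg_g pi_sE pi_mul0 pi_mul_sum
    ann_del lead_gen lead_act lead1 lead_decomp lead_factor lead_factor_deg.

End LeftDerivations.

(** * The algebra of a poset *)
Section AlgebraOfPoset.
Variables (F : fieldType) (d : Order.disp_t) (G : finBPOrderType d).
Local Notation X := (nonbot G).
Local Notation T := {malg F[{fmonom nonbot G}]}.
Local Notation R := (R_alg F G).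
Local Notation word s := (<< FMonom s >> : T).

Lemma word_nil : word [::] = 1.
Proof. by congr << _ >>; apply/eqP; rewrite fmP fm1. Qed.

Lemma word_cons x s : word (x :: s) = rgen F x * word s.
Proof.
rewrite malgM_def fgmulUU mulr1; congr << _ >>.
by apply/eqP; rewrite fmP fmM fmuE.
Qed.

Lemma mon_ind (P : T -> Prop) : P 0 ->
    (forall c u v, P u -> P v -> P (c *: u + v)) -> (forall s, P (word s)) ->
  forall u, P u.
Proof.
move=> P0 PD Pw u; rewrite (monalgE u).
apply: (big_rec P) => // k v _ Pv.
have -> : << u@_k *g k >> = u@_k *: word k.
  by apply/malgP => l; rewrite mcoeffZ !mcoeffU mulr_natr fmK.
exact: PD.
Qed.

Definition Rpi (u : T) : R := quot_pi (@R_rel F d G) u.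

Fact Rpi_zmod : zmod_morphism Rpi.
Proof. exact: quot_pi_additive. Qed.
Fact Rpi_monoid : monoid_morphism Rpi.
Proof. exact: quot_pi_monoid. Qed.
Fact Rpi_scalable : scalable Rpi.
Proof. exact: quot_pi_scalable. Qed.
HB.instance Definition _ := GRing.isZmodMorphism.Build T R Rpi Rpi_zmod.
HB.instance Definition _ := GRing.isMonoidMorphism.Build T R Rpi Rpi_monoid.
HB.instance Definition _ := GRing.isScalable.Build F T R *:%R Rpi Rpi_scalable.

Lemma Rpi_surj (p : R) : exists u, p = Rpi u.
Proof. exact: quot_piP. Qed.

Lemma Rpi_eq0 u : Rpi u = 0 <-> ideal_gen (@R_rel F d G) u.
Proof.
rewrite -(raddf0 Rpi); split=> [/quot_pi_eq|Iu]; first by rewrite subr0.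
by apply/quot_pi_eq; rewrite subr0.
Qed.

Definition rg (x : X) : R := Rpi (rgen F x).
Definition rg1 (x : X) : R := Rpi (rgen1 F x).
Definition rword (s : seq X) : R := \prod_(x <- s) rg x.

Lemma Rpi_word s : Rpi (word s) = rword s.
Proof.
rewrite /rword; elim: s => [|x s IH]; first by rewrite word_nil rmorph1 big_nil.
by rewrite word_cons rmorphM /= IH big_cons.
Qed.

Lemma R_ind (P : R -> Prop) : P 0 ->
    (forall c u v, P u -> P v -> P (c *: u + v)) -> P 1 ->
    (forall x u, P u -> P (rg x * u)) ->
  forall u, P u.
Proof.
move=> P0 PD P1 PM u; have [{}u ->] := Rpi_surj u.
elim/mon_ind: u => [|c u v Pu Pv|s]; first by rewrite raddf0.
  by rewrite linearP; exact: PD.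
rewrite Rpi_word /rword.
by elim: s => [|x s IH]; rewrite ?big_nil ?big_cons //; exact: PM.
Qed.

Definition below1 (x : X) : pred X := fun y => val y \in S1 (val x).

Lemma rg1E x : rg1 x =
  if (2 <= rk (val x))%N then \sum_(y | below1 x y) rg y else 0.
Proof.
by rewrite /rg1 /rgen1; case: ifP => _; rewrite ?raddf0 // raddf_sum.
Qed.

Lemma rg_mul0 x y : ~~ below1 x y -> rg x * rg y = 0.
Proof.
move=> nxy; rewrite -rmorphM; apply/Rpi_eq0.
rewrite -[_ * _]addr0 -[X in X + 0]mulr1 -[X in X * 1]mul1r.
by apply: ideal_genD; [exact: R_rel_mul | constructor].
Qed.

Lemma rg_mul_rg1 x : rg x * rg1 x = 0.
Proof.
rewrite -rmorphM; apply/Rpi_eq0.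
rewrite -[_ * _]addr0 -[X in X + 0]mulr1 -[X in X * 1]mul1r.
by apply: ideal_genD; [exact: R_rel_sum | constructor].
Qed.

Section Hom.
Variable S : nzRingType.

(** The data of a morphism from R: images of the scalars and of the generators
    that commute and satisfy the relations. *)
Record hom_data := HomData {
  hd_sc : {rmorphism F -> S};
  hd_gen : X -> S;
  hd_comm : forall c s, hd_sc c * s = s * hd_sc c;
  hd_mul0 : forall x y, ~~ below1 x y -> hd_gen x * hd_gen y = 0;
  hd_sum0 : forall x, (2 <= rk (val x))%N ->
    hd_gen x * \sum_(y | below1 x y) hd_gen y = 0
}.

Variable D : hom_data.

Definition mon_hom (m : {fmonom X}) : S := \prod_(x <- m) hd_gen D x.
Fact mon_hom_mmorphism : mmorphism mon_hom.
Proof.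
by split=> [m m'|]; rewrite /mon_hom ?fmM ?big_cat // fm1 big_nil.
Qed.
HB.instance Definition _ := isMultiplicative.Build _ S mon_hom mon_hom_mmorphism.

Definition T_hom (u : T) : S := mmap (hd_sc D) mon_hom u.
Fact T_hom_zmod : zmod_morphism T_hom.
Proof. by move=> u v; rewrite /T_hom raddfB. Qed.
HB.instance Definition _ := GRing.isZmodMorphism.Build T S T_hom T_hom_zmod.

Fact T_hom_monoid : monoid_morphism T_hom.
Proof.
have [TM T1] := @commr_mmap_is_multiplicative _ _ _ (hd_sc D) mon_hom
  (fun g m m' => hd_comm D _ _).
by [].
Qed.
HB.instance Definition _ := GRing.isMonoidMorphism.Build T S T_hom T_hom_monoid.

Lemma T_hom_gen x : T_hom (rgen F x) = hd_gen D x.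
Proof. by rewrite /T_hom mmapU /= rmorph1 mul1r /mon_hom fmU big_seq1. Qed.

Lemma T_hom_scale c u : T_hom (c *: u) = hd_sc D c * T_hom u.
Proof. exact: mmapZ. Qed.

Lemma T_hom_ideal u : ideal_gen (@R_rel F d G) u -> T_hom u = 0.
Proof.
elim=> [|a r b w Rr _ IH]; first exact: raddf0.
rewrite raddfD /= IH addr0 !rmorphM /=.
suff -> : T_hom r = 0 by rewrite mulr0 mul0r.
case: Rr => [x y nxy|x]; rewrite rmorphM /= !T_hom_gen; first exact: hd_mul0.
rewrite /rgen1; case: ifP => rkx; last by rewrite raddf0 mulr0.
rewrite raddf_sum -[RHS](hd_sum0 D rkx); congr (_ * _).
by apply: eq_bigr => y _; exact: T_hom_gen.
Qed.

Definition R_hom (p : R) : S := T_hom (quot_repr p).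

Lemma R_homE u : R_hom (Rpi u) = T_hom u.
Proof.
apply/eqP; rewrite -subr_eq0 -raddfB; apply/eqP/T_hom_ideal.
exact: quot_repr_pi.
Qed.

Fact R_hom_zmod : zmod_morphism R_hom.
Proof.
move=> p q; have [u ->] := Rpi_surj p; have [v ->] := Rpi_surj q.
by rewrite -raddfB !R_homE raddfB.
Qed.
Fact R_hom_monoid : monoid_morphism R_hom.
Proof.
split; first by rewrite -(rmorph1 Rpi) R_homE rmorph1.
move=> p q; have [u ->] := Rpi_surj p; have [v ->] := Rpi_surj q.
by rewrite -rmorphM !R_homE rmorphM.
Qed.
HB.instance Definition _ := GRing.isZmodMorphism.Build R S R_hom R_hom_zmod.
HB.instance Definition _ := GRing.isMonoidMorphism.Build R S R_hom R_hom_monoid.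

Lemma R_hom_gen x : R_hom (rg x) = hd_gen D x.
Proof. by rewrite /rg R_homE T_hom_gen. Qed.

Lemma R_hom_scale c p : R_hom (c *: p) = hd_sc D c * R_hom p.
Proof.
by have [u ->] := Rpi_surj p; rewrite -linearZ !R_homE T_hom_scale.
Qed.

End Hom.

Local Notation Rdeg := (@R_deg F d G).

Lemma Rdeg0 n : Rdeg n 0.
Proof. by exists 0; rewrite ?msupp0 // raddf0. Qed.

Lemma RdegB n p q : Rdeg n p -> Rdeg n q -> Rdeg n (p - q).
Proof.
move=> [u hu ->] [v hv ->]; exists (u - v); last by rewrite raddfB.
by move=> m /(fsubsetP (msuppB_le _ _)); rewrite in_fsetU => /orP[/hu|/hv].
Qed.

Lemma RdegZ n c p : Rdeg n p -> Rdeg n (c *: p).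
Proof.
move=> [u hu ->]; exists (c *: u); last by rewrite linearZ.
by move=> m /(fsubsetP (msuppZ_le _ _)) /hu.
Qed.

Lemma RdegD n p q : Rdeg n p -> Rdeg n q -> Rdeg n (p + q).
Proof.
move=> hp hq; rewrite -[q]opprK; apply: RdegB => //.
by rewrite -scaleN1r; exact: RdegZ.
Qed.

Lemma RdegM m n p q : Rdeg m p -> Rdeg n q -> Rdeg (m + n) (p * q).
Proof.
move=> [u hu ->] [v hv ->]; exists (u * v); last by rewrite rmorphM.
by move=> k /msuppM_le [k1 [k2 [/hu <- /hv <- ->]]]; rewrite fdegM.
Qed.

Lemma Rdeg_gen x : Rdeg 1 (rg x).
Proof.
exists (rgen F x) => // m; rewrite msuppU1 in_fset1 => /eqP ->.
exact: fdegU.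
Qed.

Lemma Rdeg1 : Rdeg 0 1.
Proof.
exists 1; last by rewrite rmorph1.
move=> m; rewrite -[1]/(<< _ >>) msuppU1 in_fset1 => /eqP ->; exact: fdeg1.
Qed.

Lemma Rdeg_word s : Rdeg (size s) (rword s).
Proof.
rewrite /rword; elim: s => [|x s IH]; first by rewrite big_nil; exact: Rdeg1.
by rewrite big_cons /= -add1n; apply: RdegM => //; exact: Rdeg_gen.
Qed.

Lemma Rdeg_ind n (P : R -> Prop) : P 0 ->
    (forall c u v, P u -> P v -> P (c *: u + v)) ->
    (forall s, size s = n -> P (rword s)) ->
  forall p, Rdeg n p -> P p.
Proof.
move=> P0 PD Pw p [u hu ->]; rewrite -/(Rpi u) (monalgE u) linear_sum big_seq.
apply: (big_rec P) => // k v /hu hk Pv.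
have -> : << u@_k *g k >> = u@_k *: word k.
  by apply/malgP => l; rewrite mcoeffZ !mcoeffU mulr_natr fmK.
rewrite linearZ /= Rpi_word; apply: PD => //; exact: Pw.
Qed.

Lemma scalar_comm (A : algType F) (c : F) (s : A) : in_alg A c * s = s * in_alg A c.
Proof. by rewrite /= -scalerAl mul1r -scalerAr mulr1. Qed.

Fact eps_mul0 x y : ~~ below1 x y -> (0 : F) * 0 = 0. Proof. by rewrite mulr0. Qed.
Fact eps_sum0 (x : X) : (2 <= rk (val x))%N -> (0 : F) * \sum_(y | below1 x y) 0 = 0.
Proof. by rewrite mul0r. Qed.
Definition eps : R -> F :=
  R_hom (@HomData F idfun (fun=> 0) (fun c s => mulrC c s) eps_mul0 eps_sum0).
HB.instance Definition _ := GRing.RMorphism.on eps.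

Lemma eps_gen x : eps (rg x) = 0.
Proof. exact: R_hom_gen. Qed.

Lemma eps_scale c p : eps (c *: p) = c * eps p.
Proof. exact: R_hom_scale. Qed.

Lemma eps_deg n p : Rdeg n.+1 p -> eps p = 0.
Proof.
elim/Rdeg_ind => [|c u v u0 v0|[//|x s] _]; first exact: raddf0.
  by rewrite rmorphD /= eps_scale u0 v0 mulr0 addr0.
by rewrite /rword big_cons rmorphM /= eps_gen mul0r.
Qed.

Lemma Rdeg0P p : Rdeg 0 p <-> exists c : F, p = c%:A.
Proof.
split=> [|[c ->]]; last by apply: RdegZ; exact: Rdeg1.
elim/Rdeg_ind => [|c u v [a ->] [b ->]|[|//] _].
- by exists 0; rewrite scale0r.
- by exists (c * a + b); rewrite scalerDl scalerA.
by exists 1; rewrite /rword big_nil scale1r.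
Qed.

Fact theta_comm (c : F) (q : {poly R}) :
  (polyC \o in_alg R) c * q = q * (polyC \o in_alg R) c.
Proof.
apply/polyP => i; rewrite /= coefCM coefMC; exact: scalar_comm.
Qed.
Fact theta_mul0 x y : ~~ below1 x y ->
  ((rg x)%:P * 'X^1) * ((rg y)%:P * 'X^1) = 0 :> {poly R}.
Proof. by move=> nxy; rewrite mul_polyCXn rg_mul0 // polyC0 mul0r. Qed.
Fact theta_sum0 x : (2 <= rk (val x))%N ->
  ((rg x)%:P * 'X^1) * \sum_(y | below1 x y) ((rg y)%:P * 'X^1) = 0 :> {poly R}.
Proof.
move=> rkx; rewrite -mulr_suml -(raddf_sum (@polyC R)) mul_polyCXn.
by have := rg1E x; rewrite rkx => <-; rewrite rg_mul_rg1 polyC0 mul0r.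
Qed.
(** The coaction of the grading: it sends r_x to r_x X, hence an element u of
    degree n to u X^n.  It shows that the homogeneous parts are independent. *)
Definition theta : R -> {poly R} :=
  R_hom (@HomData {poly R} (polyC \o in_alg R) _ theta_comm theta_mul0 theta_sum0).
HB.instance Definition _ := GRing.RMorphism.on theta.

Lemma theta_deg n p : Rdeg n p -> theta p = p%:P * 'X^n.
Proof.
elim/Rdeg_ind => [|c u v uE vE|s <-].
- by rewrite raddf0 mul0r.
- have thZ : theta (c *: u) = (c%:A)%:P * theta u by exact: R_hom_scale.
  have thD : theta (c *: u + v) = theta (c *: u) + theta v by exact: rmorphD.
  by rewrite thD thZ uE vE; apply: esym; exact: polyCXn_linear.
rewrite /rword; elim: s => [|x s IH]; first by rewrite big_nil rmorph1 mulr1.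
have thg : theta (rg x) = (rg x)%:P * 'X^1 by exact: R_hom_gen.
by rewrite big_cons rmorphM /= IH thg mul_polyCXn.
Qed.

Lemma R_grading : is_grading Rdeg.
Proof.
split.
- exact: Rdeg0.
- exact: RdegB.
- move=> p; have [u ->] := Rpi_surj p.
  elim/mon_ind: u => [|c u v [m [a [da uE]]] [n [b [db vE]]]|s].
  + by exists 0%N, (fun=> 0); split=> [i|]; [exact: Rdeg0 | rewrite big_ord0 raddf0].
  + pose e (k : nat) (a : nat -> R) (l : nat) := if (l < k)%N then a l else 0.
    exists (maxn m n), (fun i => c *: e m a i + e n b i); split=> [i|].
      by apply: RdegD; [apply: RdegZ|]; rewrite /e; case: ifP => // _; exact: Rdeg0.
    have eE k l (h : nat -> R) : (k <= l)%N -> \sum_(i < l) e k h i = \sum_(i < k) h i.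
      move=> lekl.
      rewrite (@sum_ord_widen _ k) // => [|i]; last by rewrite /e ltnNge => ->.
      by apply: eq_bigr => i _; rewrite /e ltn_ord.
    rewrite linearP big_split -scaler_sumr /= !eE ?leq_maxl ?leq_maxr //.
    by rewrite -uE -vE.
  + exists (size s).+1, (fun i => if i == size s then rword s else 0); split=> [i|].
      by case: eqP => [->|_]; [exact: Rdeg_word | exact: Rdeg0].
    rewrite Rpi_word big_ord_recr /= eqxx big1 ?add0r // => i _.
    by rewrite ltn_eqF.
move=> n c dc c0 i ltin.
have := congr1 (fun q : {poly R} => q`_i) (congr1 theta c0); rewrite raddf0 coef0 => <-.
rewrite raddf_sum coef_sum (bigD1 (Ordinal ltin)) //= big1 => [|j nji].
  by rewrite (theta_deg (dc i)) coefCM coefXn eqxx mulr1 addr0.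
rewrite (theta_deg (dc j)) coefCM coefXn; case: eqP => [ij|_]; last by rewrite mulr0.
by case/eqP: nji; apply/val_inj.
Qed.

Lemma R_connected : connected_graded Rdeg.
Proof.
split; [exact: R_grading | exact: RdegZ | exact: RdegM | exact: Rdeg0P].
Qed.

Lemma R_gen1 : generated_in_degree_1 Rdeg.
Proof.
move=> S S1 SD SM Sg; elim/R_ind => [|c u v Su Sv|//|x u Su].
- by rewrite -[0](subrr 1) addrC -scaleN1r; apply: SD.
- exact: SD.
- by apply: SM => //; apply: Sg; exact: Rdeg_gen.
Qed.

Lemma R_fdim n : exists (T : finType) (w : T -> R),
  forall u, Rdeg n u -> exists c : T -> F, u = \sum_t c t *: w t.
Proof.
exists (n.-tuple X : finType), (fun t : n.-tuple X => rword (tval t)) => u.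
elim/Rdeg_ind: u /.
- by exists (fun=> 0); apply: esym; apply: big1 => t _; exact: (scale0r (rword (tval t))).
- move=> c u v [a uE] [b vE]; exists (fun t => c * a t + b t).
  by rewrite uE vE; exact: scaler_sum_linear.
- move=> s sn; pose t := Tuple (introT eqP sn).
  exists (fun t' => (t' == t)%:R).
  exact: (sum_indicator t (fun t : n.-tuple X => rword t)).
Qed.

Definition tail_of (x : X) (m : {fmonom X}) : T :=
  if fmonom_val m is y :: s then if y == x then word s else 0 else 0.

Definition delta (x : X) : T -> T := malg_lin (tail_of x).
HB.instance Definition _ x := GRing.Linear.on (delta x).

Lemma delta_word x s : delta x (word s) = tail_of x (FMonom s).
Proof. by rewrite /delta /malg_lin malg_evalU ?scale1r. Qed.

Lemma delta1 x : delta x 1 = 0.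
Proof. by rewrite -word_nil delta_word. Qed.

Lemma deltaP x c u v : delta x (c *: u + v) = c *: delta x u + delta x v.
Proof. exact: linearP. Qed.

Lemma delta0 x : delta x 0 = 0.
Proof. exact: raddf0. Qed.

Lemma tensor_mulrP (c : F) (u v w : T) : w * (c *: u + v) = c *: (w * u) + w * v.
Proof.
apply: (etrans (mulrDr _ _ _)); congr (_ + _); exact: esym (malg_scalerAr _ _ _).
Qed.

Lemma tensor_mullP (c : F) (u v w : T) : (c *: u + v) * w = c *: (u * w) + v * w.
Proof. by rewrite mulrDl -scalerAl. Qed.

Lemma delta_gen x y u : delta x (rgen F y * u) = if y == x then u else 0.
Proof.
elim/mon_ind: u => [|c u v uE vE|s].
- by rewrite mulr0 delta0 if_same.
- apply: (etrans (congr1 (delta x) (tensor_mulrP c u v _))).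
  apply: (etrans (deltaP x c _ _)).
  apply: (etrans (congr2 (fun a b => c *: a + b) uE vE)).
  by case: (y == x); rewrite // scaler0 addr0.
by rewrite -word_cons delta_word.
Qed.

Lemma delta_mul x u v : delta x (u * v) = delta x u * v + u@_mone *: delta x v.
Proof.
elim/mon_ind: u => [|c u w uE wE|s].
- by rewrite mul0r delta0 mul0r mcoeff0 scale0r addr0.
- apply: (etrans (congr1 (delta x) (tensor_mullP c u w v))).
  apply: (etrans (deltaP x c _ _)).
  apply: (etrans (congr2 (fun a b => c *: a + b) uE wE)).
  apply: esym; apply: (etrans (congr2 (fun a b => a * v + b *: delta x v)
    (deltaP x c u w) (etrans (mcoeffD _ _ _) (congr1 (+%R^~ _) (mcoeffZ _ _ _))))).
  move: (delta x u) (delta x w) (delta x v) => a b e.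
  apply: (etrans (congr1 (+%R^~ _) (tensor_mullP c a b v))).
  move: (a * v) (b * v) => {}a {}b.
  by rewrite scalerDr (scalerDl e) scalerA addrACA.
case: s => [|y s].
  by rewrite word_nil mul1r delta1 mul0r add0r mcoeff1 eqxx scale1r.
have -> : (word (y :: s))@_mone = 0.
  by rewrite mcoeffU1 (_ : _ == _ = false) // fmP fm1.
have -> : delta x (word (y :: s)) = if y == x then word s else 0.
  by rewrite delta_word.
rewrite scale0r addr0 word_cons -mulrA.
apply: (etrans (delta_gen x y (word s * v))).
by case: (y == x); rewrite ?mul0r.
Qed.

Lemma tensor_decomp u : u = u@_mone *: 1 + \sum_x rgen F x * delta x u.
Proof.
elim/mon_ind: u => [|c u v uE vE|s].
- by rewrite mcoeff0 scale0r add0r big1 // => x _; rewrite delta0 mulr0.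
- have E x : rgen F x * delta x (c *: u + v) =
      c *: (rgen F x * delta x u) + rgen F x * delta x v.
    exact: (etrans (congr1 _ (deltaP x c u v)) (tensor_mulrP _ _ _ _)).
  have AE : \sum_x rgen F x * delta x (c *: u + v) =
      c *: (\sum_x rgen F x * delta x u) + \sum_x rgen F x * delta x v.
    apply: (etrans (eq_bigr _ (fun x _ => E x))).
    exact: sum_combine.
  have cE : (c *: u + v)@_mone = c * u@_mone + v@_mone.
    exact: (etrans (mcoeffD _ _ _) (congr1 (+%R^~ _) (mcoeffZ _ _ _))).
  apply: (etrans (congr2 (fun a b => c *: a + b) uE vE)).
  apply: (etrans (scale_combine c _ _ _ _ _)); apply: esym.
  exact: (congr2 (fun k w => k *: 1 + w) cE AE).
case: s => [|y s].
  by rewrite word_nil mcoeff1 eqxx scale1r big1 ?addr0 // => x _; rewrite delta1 mulr0.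
have -> : (word (y :: s))@_mone = 0.
  by rewrite mcoeffU1 (_ : _ == _ = false) // fmP fm1.
rewrite scale0r add0r (bigD1 y) //= big1 => [|x /negPf xy].
  by rewrite delta_word /tail_of /= eqxx addr0 word_cons.
by rewrite delta_word /tail_of /= eq_sym xy mulr0.
Qed.

Lemma eps_pi u : eps (Rpi u) = u@_mone.
Proof.
elim/mon_ind: u => [|c u v uE vE|s].
- by rewrite mcoeff0 !rmorph0.
- rewrite mcoeffD mcoeffZ -uE -vE -eps_scale.
  have -> : Rpi (c *: u + v) = c *: Rpi u + Rpi v by exact: linearP.
  exact: rmorphD.
case: s => [|x s]; first by rewrite word_nil mcoeff1 eqxx !rmorph1.
have -> : (word (x :: s))@_mone = 0.
  by rewrite mcoeffU1 (_ : _ == _ = false) // fmP fm1.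
rewrite Rpi_word /rword big_cons.
by apply: (etrans (rmorphM eps _ _)); rewrite /= eps_gen mul0r.
Qed.

End AlgebraOfPoset.

(** * Ranks in an interval *)
Section RankBelow.
Variables (d : Order.disp_t) (G : finBPOrderType d) (x : G).
Local Notation H := (below x).
Implicit Types (y z : H).

(** The predicate whose maximal sets are the maximal chains. *)
Definition chain_below (T : finBPOrderType d) (y : T) (D : {set T}) :=
  (D \subset [set z : T | (\bot <= z <= y)%O]) && is_chain D.

Lemma le_below y z : (y <= z)%O = (val y <= val z)%O.
Proof. by rewrite -Order.le_val. Qed.

Lemma lt_below y z : (y < z)%O = (val y < val z)%O.
Proof. by rewrite !lt_neqAle le_below. Qed.

Lemma mem_val_image (C : {set H}) z : (val z \in val @: C) = (z \in C).
Proof. exact: (mem_imset C z val_inj). Qed.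

Lemma chain_below_image y (C : {set H}) :
  chain_below (val y) (val @: C) = chain_below y C.
Proof.
congr (_ && _).
  apply/subsetP/subsetP => sub z.
    move=> zC; have := sub (val z).
    by rewrite mem_val_image !inE !le0x /= -le_below => /(_ zC).
  by move=> /imsetP [z' z'C ->]; have := sub z' z'C; rewrite !inE !le0x /= le_below.
apply/forall_inP/forall_inP => ch z zC; apply/forall_inP => w wC.
  have /forall_inP /(_ (val w)) := ch (val z) (imset_f val zC).
  by rewrite mem_val_image => /(_ wC); rewrite /Order.comparable !le_below.
have /imsetP [z' z'C ->] := zC; have /imsetP [w' w'C ->] := wC.
have /forall_inP /(_ w' w'C) := ch z' z'C.
by rewrite /Order.comparable !le_below.
Qed.

Lemma chain_below_preim y (D : {set G}) : chain_below (val y) D ->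
  D = val @: [set z : H | val z \in D].
Proof.
move=> /andP[/subsetP sub _]; apply/setP => z; apply/idP/imsetP => [zD|[z' + ->]].
  have := sub z zD; rewrite inE => /andP[_ zy].
  have zx : (z <= x)%O by apply: le_trans zy _; exact: (valP y).
  by exists (Sub z zx : H); rewrite ?inE SubK.
by rewrite inE.
Qed.

Lemma max_chain_image y (C : {set H}) : max_chain (val y) (val @: C) = max_chain y C.
Proof.
apply/maxsetP/maxsetP => -[ch mx].
  split=> [|C' ch' sub]; first by rewrite -[_ && _]chain_below_image.
  apply: (imset_inj val_inj); apply: mx; last exact: imsetS.
  by rewrite -[_ && _]chain_below_image in ch'.
split=> [|D chD sub]; first by rewrite -[_ && _]/(chain_below _ _) chain_below_image.
have DE := chain_below_preim chD; rewrite DE.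
suff -> : [set z : H | val z \in D] = C by [].
apply: mx.
  by have := chD; rewrite -[_ && _]/(chain_below _ _) {1}DE chain_below_image.
apply/subsetP => z zC; rewrite inE; apply: (subsetP sub); exact: imset_f.
Qed.

(** The inclusion of the interval identifies the maximal chains up to y. *)
Lemma rk_below y : rk y = rk (val y).
Proof.
apply/eqP; rewrite eqn_leq; apply/andP; split; apply/bigmax_leqP => C mC.
  rewrite -(card_imset (mem C) val_inj); apply: leq_bigmax_cond.
  by rewrite max_chain_image.
have /maxsetP [ch _] := mC; have CE := chain_below_preim ch.
rewrite CE (card_imset _ val_inj); apply: leq_bigmax_cond.
by rewrite -max_chain_image -CE.
Qed.

Lemma S1_below y z : (z \in S1 y) = (val z \in S1 (val y)).
Proof. by rewrite !inE lt_below !rk_below. Qed.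

Definition up (y : nonbot H) : nonbot G :=
  exist (fun z : G => z != \bot%O) (val (val y)) (valP y).

End RankBelow.

(** * The interval algebra as a restriction *)
Section PosetLetters.
Variables (F : fieldType) (d : Order.disp_t) (G : finBPOrderType d).
Local Notation X := (nonbot G).
Local Notation T := {malg F[{fmonom nonbot G}]}.
Local Notation R := (R_alg F G).
Local Notation Rdeg := (@R_deg F d G).
Local Notation Rpi := (@Rpi F d G).

Fact Rpi_rel r : @R_rel F d G r ->
  (exists x y : X, ~~ below1 x y /\ r = rgen F x * rgen F y) \/
  exists x : X, r = rgen F x * rgen1 F x.
Proof. by case=> [x y nxy|x]; [left; exists x, y | right; exists x]. Qed.

Fact RpiZ c (u : T) : Rpi (c *: u) = c *: Rpi u.
Proof. exact: linearZ. Qed.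

Fact eps_alg (c : F) : eps (c%:A : R) = c.
Proof. by rewrite eps_scale rmorph1 mulr1. Qed.

Fact rg1_cases x : rg1 F x = 0 \/ rg1 F x = \sum_(y : X | below1 x y) rg F y.
Proof. by have := rg1E F x; case: ifP => _ ->; [right | left]. Qed.

Definition poset_letters : letter_algebra F :=
  derived_letters (pi := Rpi) RpiZ (@Rpi_surj F d G) (@Rpi_eq0 F d G) Rpi_rel
    (@rg_mul0 F d G) (@rg_mul_rg1 F d G) (@eps_pi F d G)
    (@deltaP F d G) (@delta_gen F d G) (@delta_mul F d G) (@tensor_decomp F d G)
    (@R_connected F d G) (@R_gen1 F d G) (@R_fdim F d G) eps_alg (@eps_deg F d G)
    (@Rdeg_gen F d G) rg1_cases (@Rdeg_ind F d G).

End PosetLetters.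

Section AlgebraHom.
Variables (F : fieldType) (d : Order.disp_t) (G : finBPOrderType d).
Variables (S : algType F) (g : nonbot G -> S).
Hypothesis g_mul0 : forall x y, ~~ below1 x y -> g x * g y = 0.
Hypothesis g_sum0 : forall x, (2 <= rk (val x))%N ->
  g x * \sum_(y | below1 x y) g y = 0.

Definition alg_hom : R_alg F G -> S :=
  R_hom (@HomData F d G S (in_alg S) g (@scalar_comm F S) g_mul0 g_sum0).
HB.instance Definition _ := GRing.RMorphism.on alg_hom.

Lemma alg_hom_gen x : alg_hom (rg F x) = g x.
Proof. exact: R_hom_gen. Qed.

Lemma alg_hom_linear c u v : alg_hom (c *: u + v) = c *: alg_hom u + alg_hom v.
Proof.
apply: (etrans (rmorphD alg_hom _ _)); congr (_ + _).
by apply: (etrans (R_hom_scale _ _ _)); rewrite /= -scalerAl mul1r.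
Qed.

Lemma alg_hom_genM x u : alg_hom (rg F x * u) = g x * alg_hom u.
Proof. by apply: (etrans (rmorphM alg_hom _ _)); rewrite /= alg_hom_gen. Qed.

Lemma alg_hom_deg (deg : nat -> S -> Prop) : connected_graded deg ->
  (forall x, deg 1 (g x)) -> forall n u, R_deg F G n u -> deg n (alg_hom u).
Proof.
move=> [[deg0 degB _ _] degZ degM deg0P] dg n u.
move: u; apply: (Rdeg_ind (P := fun u => deg n (alg_hom u))) => [|c u v du dv|s <-].
- by rewrite rmorph0; exact: deg0.
- rewrite alg_hom_linear -[alg_hom v]opprK; apply: (degB); first exact: degZ.
  by rewrite -scaleN1r; exact: degZ.
rewrite /rword; elim: s => [|x s IH].
  by rewrite big_nil rmorph1; apply/deg0P; exists 1; rewrite scale1r.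
by rewrite big_cons alg_hom_genM /= -add1n; exact: degM.
Qed.

End AlgebraHom.

Lemma mul_mul0l (A : pzRingType) (a b c : A) : a * b = 0 -> a * (b * c) = 0.
Proof. by rewrite mulrA => ->; rewrite mul0r. Qed.

Section BelowVertex.
Variables (F : fieldType) (d : Order.disp_t) (G : finBPOrderType d) (x0 : G).
Local Notation H := (below x0).
Local Notation X := (nonbot G).
Local Notation Y := (nonbot H).
Local Notation up := (@up d G x0).

Lemma up_inj : injective up.
Proof.
move=> y z /(congr1 val) yz; apply: val_inj; apply: val_inj; exact: yz.
Qed.

Lemma below1_up y z : below1 (up y) (up z) = below1 y z.
Proof. by rewrite /below1 S1_below. Qed.

Lemma up_codom (z : X) : (val z <= x0)%O -> z \in codom up.
Proof.
move=> zx; pose z' : H := Sub (val z) zx.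
have nz : z' != \bot%O by rewrite -val_eqE; exact: (valP z).
by apply/codomP; exists (Sub z' nz); exact: val_inj.
Qed.

Lemma below1_codom y z : below1 (up y) z -> z \in codom up.
Proof.
rewrite /below1 inE => /andP[zy _]; apply: up_codom.
by apply: le_trans (ltW zy) _; exact: (valP (val y)).
Qed.

Lemma rk_up y : rk (val (up y)) = rk (val y).
Proof. by rewrite rk_below. Qed.

Lemma sum_up (V : nmodType) (P : pred X) (f : X -> V) :
    (forall z, P z -> z \in codom up) ->
  \sum_(z | P z) f z = \sum_(y | P (up y)) f (up y).
Proof.
move=> PY; transitivity (\sum_(z in up @: [set y | P (up y)]) f z).
  apply: eq_bigl => z; apply/idP/imsetP => [Pz|[y + ->]]; last by rewrite inE.
  by have /codomP [y zy] := PY z Pz; exists y => //; rewrite inE -zy.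
rewrite big_imset => [|y z _ _]; last exact: up_inj.
by apply: eq_bigl => y; rewrite inE.
Qed.

(** The images of the generators under R -> R_x. *)
Definition down_gen (z : X) : R_alg F H :=
  if [pick y | up y == z] is Some y then rg F y else 0.

Lemma down_gen_up y : down_gen (up y) = rg F y.
Proof.
rewrite /down_gen; case: pickP => [z /eqP /up_inj -> //|/(_ y)].
by rewrite eqxx.
Qed.

Lemma down_gen0 z : z \notin codom up -> down_gen z = 0.
Proof.
rewrite /down_gen; case: pickP => // y /eqP <-.
by rewrite codom_f.
Qed.

Fact down_mul0 x y : ~~ below1 x y -> down_gen x * down_gen y = 0.
Proof.
have [/codomP [x' ->]|/down_gen0 ->] := boolP (x \in codom up); last by rewrite mul0r.
have [/codomP [y' ->]|/down_gen0 ->] := boolP (y \in codom up); last by rewrite mulr0.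
by rewrite below1_up !down_gen_up; exact: rg_mul0.
Qed.

Lemma sum_down x : \sum_(y | below1 (up x) y) down_gen y = \sum_(y | below1 x y) rg F y.
Proof.
rewrite (sum_up _ (@below1_codom x)).
under eq_bigl => y do rewrite below1_up.
by apply: eq_bigr => y _; exact: down_gen_up.
Qed.

Fact down_sum0 x : (2 <= rk (val x))%N ->
  down_gen x * \sum_(y | below1 x y) down_gen y = 0.
Proof.
have [/codomP [x' ->]|/down_gen0 -> _] := boolP (x \in codom up); last by rewrite mul0r.
rewrite rk_up sum_down down_gen_up => rkx.
by have := rg_mul_rg1 F x'; rewrite rg1E rkx.
Qed.

Definition down : R_alg F G -> R_alg F H := alg_hom down_mul0 down_sum0.
HB.instance Definition _ := GRing.RMorphism.on down.

Definition up_gen (y : Y) : R_alg F G := rg F (up y).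

Fact up_mul0 x y : ~~ below1 x y -> up_gen x * up_gen y = 0.
Proof. by rewrite -below1_up; exact: rg_mul0. Qed.

Lemma rg1_up x : rg1 F (up x) =
  if (2 <= rk (val x))%N then \sum_(y | below1 x y) up_gen y else 0.
Proof.
rewrite rg1E rk_up; case: ifP => // _; rewrite (sum_up _ (@below1_codom x)).
by apply: eq_bigl => y; rewrite below1_up.
Qed.

Fact up_sum0 x : (2 <= rk (val x))%N ->
  up_gen x * \sum_(y | below1 x y) up_gen y = 0.
Proof. by move=> rkx; have := rg_mul_rg1 F (up x); rewrite rg1_up rkx. Qed.

Definition lift : R_alg F H -> R_alg F G := alg_hom up_mul0 up_sum0.
HB.instance Definition _ := GRing.RMorphism.on lift.

Lemma down_rg z : down (rg F z) = down_gen z.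
Proof. exact: alg_hom_gen. Qed.

Lemma lift_rg y : lift (rg F y) = rg F (up y).
Proof. exact: alg_hom_gen. Qed.

Lemma liftK v : down (lift v) = v.
Proof.
elim/R_ind: v => [|c u v uE vE||x u uE].
- by rewrite !rmorph0.
- apply: (etrans (congr1 down (alg_hom_linear _ _ c u v))).
  apply: (etrans (alg_hom_linear _ _ c _ _)).
  exact: (congr2 (fun a b => c *: a + b) uE vE).
- by rewrite !rmorph1.
apply: (etrans (congr1 down (alg_hom_genM _ _ x u))).
apply: (etrans (alg_hom_genM _ _ (up x) _)).
exact: (congr2 *%R (down_gen_up x) uE).
Qed.

Lemma eps_down u : eps (down u) = eps u.
Proof.
elim/R_ind: u => [|c u v uE vE||x u uE].
- by rewrite !rmorph0.
- apply: (etrans (congr1 (@eps _ _ _) (alg_hom_linear _ _ c u v))).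
  have E (K : finBPOrderType d) (a b : R_alg F K) : eps (c *: a + b) = c * eps a + eps b.
    by rewrite rmorphD /= eps_scale.
  apply: (etrans (E _ _ _)); apply: (etrans (congr2 (fun a b => c * a + b) uE vE)).
  exact: esym (E _ _ _).
- by rewrite !rmorph1.
apply: (etrans (congr1 (@eps _ _ _) (alg_hom_genM _ _ x u))).
apply: (etrans (rmorphM _ _ _)); apply: esym; apply: (etrans (rmorphM _ _ _)).
rewrite /= eps_gen mul0r; have [/codomP [y ->]|/down_gen0 ->] := boolP (x \in codom up).
  by rewrite down_gen_up eps_gen mul0r.
by rewrite rmorph0 mul0r.
Qed.

(** In a nonzero word each letter lies below the previous one, so a word that
    begins below x0 only involves letters below x0. *)
Lemma rg_local y u : rg F (up y) * u = rg F (up y) * lift (down u).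
Proof.
elim/R_ind: u y => [|c u v uE vE||x u uE] y.
- by rewrite !rmorph0.
- have lin a b : rg F (up y) * (c *: a + b) = c *: (rg F (up y) * a) + rg F (up y) * b.
    by rewrite mulrDr scalerAr.
  apply: (etrans (lin u v)).
  apply: (etrans (congr2 (fun a b => c *: a + b) (uE y) (vE y))).
  apply: esym; apply: (etrans (congr1 (fun w => _ * lift w) (alg_hom_linear _ _ c u v))).
  apply: (etrans (congr1 (fun w => _ * w) (alg_hom_linear _ _ c _ _))).
  exact: lin.
- by rewrite !rmorph1.
have E : lift (down (rg F x * u)) = lift (down_gen x) * lift (down u).
  apply: (etrans (congr1 lift (alg_hom_genM _ _ x u))); exact: rmorphM.
have [/codomP [x' xE]|nx] := boolP (x \in codom up).
  rewrite xE in E *; congr (_ * _).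
  apply: (etrans (uE x')); apply: esym; apply: (etrans E).
  exact: (congr1 ( *%R^~ _) (etrans (congr1 lift (down_gen_up x')) (lift_rg x'))).
apply: (etrans (mul_mul0l u (rg_mul0 F (contra (@below1_codom y x) nx)))).
apply: esym; apply: (etrans (congr1 ( *%R _) E)).
have z0 : lift (down_gen x) = 0 by rewrite (down_gen0 nx) rmorph0.
by rewrite z0 mul0r mulr0.
Qed.

Lemma down_rg1 y : down (rg1 F (up y)) = rg1 F y.
Proof.
rewrite rg1_up rg1E; case: ifP => _; last by rewrite rmorph0.
rewrite rmorph_sum; apply: eq_bigr => z _.
by rewrite /= down_rg down_gen_up.
Qed.

Lemma down_deg n u : R_deg F G n u -> R_deg F H n (down u).
Proof.
apply: alg_hom_deg; first exact: R_connected.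
move=> x; have [/codomP [y ->]|/down_gen0 ->] := boolP (x \in codom up).
  by rewrite down_gen_up; exact: Rdeg_gen.
exact: Rdeg0.
Qed.

Lemma lift_deg n u : R_deg F H n u -> R_deg F G n (lift u).
Proof. by apply: alg_hom_deg; [exact: R_connected | move=> x; exact: Rdeg_gen]. Qed.

Lemma down_kill z : z \notin codom up -> down (rg F z) = 0.
Proof. by move=> nz; rewrite down_rg down_gen0. Qed.

Lemma lift_down_rg y : lift (down (rg F (up y))) = rg F (up y).
Proof. by rewrite down_rg down_gen_up lift_rg. Qed.

Definition below_restriction : restriction (poset_letters F G) (poset_letters F H) :=
  @Restriction F (poset_letters F G) (poset_letters F H) down lift up
    down_deg lift_deg liftK eps_down lift_down_rg down_kill rg_local down_rg1
    below1_codom.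

End BelowVertex.

Theorem theorem1p3 (F : fieldType) (d : Order.disp_t) (Gamma : finBPOrderType d)
    (Gamma_ranked : ranked Gamma) (Gamma_uniform : uniform Gamma) :
  Koszul (R_alg F Gamma) (R_deg F Gamma) <->
  forall x : Gamma, Koszul (R_alg F (below x)) (R_deg F (below x)).
Proof.
split=> [KG x|KG].
  exact: (Koszul_restriction (below_restriction F x) KG).
apply: (@Koszul_extension F (poset_letters F Gamma)) => x.
exists (poset_letters F (below (val x))), (below_restriction F (val x)).
by split; [exact: (up_codom (lexx (val x))) | exact: KG].
Qed.
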